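(* Let $u,q\in(0,1)$ and let $z_1,\dots,z_6,d$ be generic complex parameters. Put $-\rho_1=d$ and $-\rho_2=\frac{z_1z_3z_5}{z_2z_4z_6\,q\,d}$. The isomonodromic dynamics on the moduli spaces of connections described in the context corresponding to the parameter evolution $$\bar z_2=qz_2,\quad \bar z_4=qz_4,\quad \bar d=q^{-1}d,\quad \bar z_i=z_i\ \text{otherwise},$$ is equivalent to the standard $q$-P$(A_1^{(1)})$ dynamics (given in the context) through the following change of coordinates from the isomonodromic coordinates $(x,y)$ to the Painlev\'e coordinates $(f,g)$: $$f(x,y)=\frac{\sigma_3(xy+u(y-1))-u^2(x^2-\sigma_1x+\sigma_2(y+1))+u^3(1-y)(\sigma_1-x)+u^4(1+y)}{\sigma_3x(xy+u(y-1))-u^2(\sigma_2xy+\sigma_3(y+1))+u^3\sigma_2(1-y)+u^4(\sigma_1(1+y)-x)+u^5(y-1)},$$ $$g(x,y)=\frac{xyz_6+uz_6(y-1)-u^2(1+y)}{z_6(1+y)-x-u(1-y)},$$ where $\sigma_1=z_2+z_4+z_6$, $\sigma_2=z_2z_4+z_4z_6+z_6z_2$, $\sigma_3=z_2z_4z_6$. The inverse change of coordinates is $$x(f,g)=\frac{(\kappa_1-\kappa_2)g+\nu_6(1+\kappa_1\kappa_2)(1-fg)+\nu_6^2(\kappa_1-\kappa_2)f}{\kappa_1-\kappa_2fg},$$ $$y(f,g)=\frac{\nu_1\nu_6(1-fg)(\nu_6\kappa_1-(1+\kappa_1\kappa_2)g)+\kappa_2fg((\nu_1\nu_6-1)g-\nu_6)+\nu_1\kappa_2g^2+\kappa_1(1-\nu_1g)(g+\nu_6)}{(1-fg)(\nu_6-\kappa_2(g-\nu_6\kappa_1))-\nu_6\big((g+\nu_6)(\kappa_1\nu_1+\kappa_2f(1-g\nu_1))-\kappa_1(1+\nu_6f)\big)}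 .$$ The corresponding matching of parameters is $$\nu_1=\frac1{z_6},\ \nu_2=\frac1{z_1},\ \nu_3=\frac1{z_3},\ \nu_4=\frac1{z_5},\ \nu_5=\frac{uz_4}{z_2},\ \nu_6=u,\ \nu_7=\frac{-\rho_1z_4z_6}u,\ \nu_8=\frac{-\rho_2z_4z_6}u,\ \kappa_1=\frac u{z_2},\ \kappa_2=\frac{z_4}u .$$
   Context: Notation: $\sigma(z)=z+\frac{u^2}{qz}$, so $\sigma(z/q)=\frac zq+\frac{u^2}z$. Connections. For $\lambda=(z_1,\dots,z_6,d_1,d_2)$, where $d$ denotes one of $d_1,d_2$ and $\{d_1,d_2\}=\{-\rho_1,-\rho_2\}$, a connection of type $\lambda$ is given by a rational matrix $A(z)=\frac{1}{P(z)}\begin{bmatrix} b_{11}(z) & b_{12}(z)/z \\ b_{21}(z) & b_{22}(z) \end{bmatrix}$, $b_{21}(0)=0$, with polynomials $b_{ij}$, $\deg b_{11}\le6$, $\deg b_{12}\le8$, $\deg b_{21}\le5$, $\deg b_{22}\le6$, such that: (1) $\det A=Q/P$ with $P(z)=(z-z_1)(z-\frac{u^2}{z_2})(z-z_3)(z-\frac{u^2}{z_4})(z-z_5)(z-\frac{u^2}{z_6})$ and $Q(z)=\frac{z_1z_3z_5}{z_2z_4z_6}(z-\frac{u^2}{z_1})(z-z_2)(z-\frac{u^2}{z_3})(z-z_4)(z-\frac{u^2}{z_5})(z-z_6)$; (2) (asymptotic condition) with $S(x)=\mathrm{diag}(1,x)$, $S(\sigma(z/q))A(z)S^{-1}(\sigma(z))\sim\mathrm{diag}(d_1,d_2)$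 as $z\to\infty$; (3) (involution condition) $A(u^2/z)=A^{-1}(z)$, and $A(u)$ is the identity matrix. Such matrices are considered modulo $A(z)\mapsto R(\sigma(z/q))A(z)R^{-1}(\sigma(z))$, where $R(x)=\begin{bmatrix} r_{11} & r_{12}(x) \\ 0 & r_{22} \end{bmatrix}$, $r_{11},r_{22}\in\mathbb{C}\setminus\{0\}$, $r_{12}$ a polynomial of degree $\le1$. Isomonodromic dynamics. It sends (the class of) $A$ of type $\lambda$ to (the class of) its unique modification $\overline A(z)=R(\sigma(z/q))A(z)R^{-1}(\sigma(z))$, $R$ an invertible matrix of rational functions, that is a connection of the type $\overline\lambda$ obtained from the given parameter evolution (so $\bar\rho_i=q^{-1}\rho_i$). Coordinates $(x,y)$. Using gauge transformations, $b_{21}$ is reduced to $b_{21}(z)=z(z^2-u^2)(z-t)(z-\frac{u^2}t)$; put $p=b_{11}(t)/P(t)$. The involution condition induces the involution $(t,p)\leftrightarrow(u^2/t,1/p)$, and the involution-invariant coordinates are $x=t+\frac{u^2}t$, $y=\frac{pt-u}{pu-t}$. For $\overline A$ the same formulas give $(\bar x,\bar y)$, and $(\bar f,\bar g)$ are obtained from $(\bar x,\bar y)$ using $\overline\lambda$. Standard $q$-P$(A_1^{(1)})$ dynamics: parameters evolve by $\overline\kappa_1=\kappa_1/q$, $\overline\kappa_2=q\kappa_2$, $\overline\nu_i=\nu_i$ ($i=1,\dots,8$), where $q=\frac{\kappa_1^2\kappa_2^2}{\nu_1\cdots\nu_8}$, and $$\frac{(fg-\frac{\kappa_1}{\kappa_2})(\overline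 fg-\frac{\kappa_1}{q\kappa_2})}{(fg-1)(\overline fg-1)}=\frac{\prod_{i=5}^8(g-\frac{\nu_i}{\kappa_2})}{\prod_{i=1}^4(g-\frac1{\nu_i})},\qquad \frac{(fg-\frac{\kappa_1}{\kappa_2})(f\underline g-\frac{q\kappa_1}{\kappa_2})}{(fg-1)(f\underline g-1)}=\frac{\prod_{i=5}^8(f-\frac{\kappa_1}{\nu_i})}{\prod_{i=1}^4(f-\nu_i)},$$ where overline/underline denote the next/previous step; the second equation shifted by one step determines $\overline g$ from $(\overline f,g)$. All changes of coordinates are understood as birational maps.
   Formalization: The involution condition also requires A(-u) to be the identity (with only A(u)=1, A(-u)=±1 gives two families with the same (x,y), and the q-P equations hold only for +); the asymptotic condition ''~ diag(d1,d2)'' is read as: the limit is similar to diag(d1,d2). *)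

(* Defs.v *)
From HB Require Import structures.
From mathcomp Require Import all_boot all_order all_algebra.
From mathcomp Require Import generic_quotient mpoly.

Set Implicit Arguments.
Unset Strict Implicit.
Unset Printing Implicit Defensive.

Import GRing.Theory.
Local Open Scope ring_scope.
Local Open Scope quotient_scope.

Section Generic.
Variables (F : fieldType) (n : nat).

Definition generic (P : ('I_n -> F) -> Prop) : Prop :=
  exists2 N : {mpoly F[n]}, N != 0 & forall v, meval v N != 0 -> P v.

(* P holds off countably many proper hypersurfaces: a single hypersurface does
   not suffice for the parameters, because a modification is unique only if the
   z_i avoid all resonances such as z_1 = q ^ k z_3, k an integer. *)
Definition very_generic (P : ('I_n -> F) -> Prop) : Prop :=
  exists2 N : nat -> {mpoly F[n]}, (forall k, N k != 0) &
    forall v, (forall k, meval v (N k) != 0) -> P v.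

End Generic.

Section RationalFunctions.
Variable F : fieldType.

Definition ratfun := {fraction {poly F}}.

Definition of_poly (p : {poly F}) : ratfun := FracField.tofrac p.
Definition of_const (c : F) : ratfun := of_poly c%:P.
Definition var : ratfun := of_poly 'X.

(* The composite r(s(z)); independent of the representative of r as soon as s
   is not constant, which is the case in all uses below. *)
Definition subst (s r : ratfun) : ratfun :=
  (map_poly of_const \n_(repr r)).[s] / (map_poly of_const \d_(repr r)).[s].

Definition has_value (r : ratfun) (a c : F) : Prop :=
  exists p d : {poly F},
    [/\ d.[a] != 0, r = of_poly p / of_poly d & p.[a] / d.[a] = c].

(* The limit at infinity is read off at w = 0 after the change z = 1/w. *)
Definition has_limit (r : ratfun) (c : F) : Prop :=
  has_value (subst var^-1 r) 0 c.

Definition mx2 (T : Type) (a b c d : T) : 'M[T]_2 :=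
  \matrix_(i < 2, j < 2)
    (if i == 0 then (if j == 0 then a else b) else (if j == 0 then c else d)).

Definition subst_mx (s : ratfun) (A : 'M[ratfun]_2) : 'M[ratfun]_2 :=
  map_mx (subst s) A.

Definition mx_has_value (A : 'M[ratfun]_2) (a : F) (B : 'M[F]_2) : Prop :=
  forall i j, has_value (A i j) a (B i j).

Definition mx_has_limit (A : 'M[ratfun]_2) (B : 'M[F]_2) : Prop :=
  forall i j, has_limit (A i j) (B i j).

End RationalFunctions.

Arguments var {F}.

Record param (F : Type) :=
  Param { z1 : F; z2 : F; z3 : F; z4 : F; z5 : F; z6 : F; dd : F }.

Definition param_of (F : Type) (v : 'I_7 -> F) : param F :=
  Param (v (inord 0)) (v (inord 1)) (v (inord 2)) (v (inord 3))
        (v (inord 4)) (v (inord 5)) (v (inord 6)).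

Section Connections.
Variables (F : fieldType) (u q : F).
Implicit Types (l : param F) (A : 'M[ratfun F]_2).

Definition minus_rho1 l : F := dd l.
Definition minus_rho2 l : F :=
  (z1 l * z3 l * z5 l) / (z2 l * z4 l * z6 l * q * dd l).

Definition evolve l : param F :=
  Param (z1 l) (q * z2 l) (z3 l) (q * z4 l) (z5 l) (z6 l) (q^-1 * dd l).

Definition sigma (w : ratfun F) : ratfun F :=
  w + of_const (u ^+ 2) / (of_const q * w).

Definition sigma_z : ratfun F := sigma var.
Definition sigma_zq : ratfun F := sigma (var / of_const q).

Definition Ppol l : {poly F} :=
  ('X - (z1 l)%:P) * ('X - (u ^+ 2 / z2 l)%:P) *
  ('X - (z3 l)%:P) * ('X - (u ^+ 2 / z4 l)%:P) *
  ('X - (z5 l)%:P) * ('X - (u ^+ 2 / z6 l)%:P).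

Definition Qpol l : {poly F} :=
  ((z1 l * z3 l * z5 l) / (z2 l * z4 l * z6 l)) *:
  (('X - (u ^+ 2 / z1 l)%:P) * ('X - (z2 l)%:P) *
   ('X - (u ^+ 2 / z3 l)%:P) * ('X - (z4 l)%:P) *
   ('X - (u ^+ 2 / z5 l)%:P) * ('X - (z6 l)%:P)).

Definition conn_mx l (b11 b12 b21 b22 : {poly F}) : 'M[ratfun F]_2 :=
  (of_poly (Ppol l))^-1 *:
  mx2 (of_poly b11) (of_poly b12 / var) (of_poly b21) (of_poly b22).

Definition polynomial_form l A : Prop :=
  exists b11 b12 b21 b22 : {poly F},
    [/\ [/\ (size b11 <= 7)%N, (size b12 <= 9)%N, (size b21 <= 6)%N
          & (size b22 <= 7)%N],
        b21.[0] = 0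
      & A = conn_mx l b11 b12 b21 b22].

Definition Smx (w : ratfun F) : 'M[ratfun F]_2 := mx2 1 0 0 w.

(* The limit exists and is similar to diag(d_1, d_2), {d_1, d_2} =
   {-rho_1, -rho_2}.  Equality of the limit with diag(d_1, d_2) is not
   intended: it is not invariant under the gauge group below, and the entry
   (2,1) of the limit is nonzero as soon as b21 has degree 5. *)
Definition asymptotic_condition l A : Prop :=
  exists M G : 'M[F]_2,
    [/\ mx_has_limit (Smx sigma_zq *m A *m invmx (Smx sigma_z)) M,
        G \in unitmx
      & G *m M *m invmx G = mx2 (minus_rho1 l) 0 0 (minus_rho2 l)].

(* The normalization is imposed at both fixed points u and -u of z |-> u^2/z.
   The equation A(u^2/z) = A(z)^-1 and the degree bounds leave A(-u) = 1 or
   A(-u) = -1; the two signs give two families on which (x, y) takes the same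
   values, and the coordinates (f, g) below belong to the sign +. *)
Definition involution_condition A : Prop :=
  [/\ subst_mx (of_const (u ^+ 2) / var) A = invmx A,
      mx_has_value A u 1%:M
    & mx_has_value A (- u) 1%:M].

Definition is_connection l A : Prop :=
  [/\ polynomial_form l A,
      \det A = of_poly (Qpol l) / of_poly (Ppol l),
      asymptotic_condition l A
    & involution_condition A].

(* R(sigma(z/q)) A(z) R(sigma(z))^-1; var is the variable x in R(x). *)
Definition gauge (R A : 'M[ratfun F]_2) : 'M[ratfun F]_2 :=
  subst_mx sigma_zq R *m A *m invmx (subst_mx sigma_z R).

Definition gauge_equiv A A' : Prop :=
  exists (r11 r22 : F) (r12 : {poly F}),
    [/\ r11 != 0, r22 != 0, (size r12 <= 2)%N
      & A' = gauge (mx2 (of_const r11) (of_poly r12) 0 (of_const r22)) A].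

Definition modification A A' : Prop :=
  exists2 R : 'M[ratfun F]_2, R \in unitmx & A' = gauge R A.

Definition isomonodromic l A A' : Prop :=
  [/\ is_connection (evolve l) A',
      modification A A'
    & forall A'', is_connection (evolve l) A'' -> modification A A'' ->
        gauge_equiv A' A''].

Definition has_coords l A (x y : F) : Prop :=
  exists (b11 b12 b21 b22 : {poly F}) (t : F),
    let p := b11.[t] / (Ppol l).[t] in
    [/\ gauge_equiv A (conn_mx l b11 b12 b21 b22),
        t != 0 /\
        b21 = 'X * ('X^2 - (u ^+ 2)%:P) * ('X - t%:P) * ('X - (u ^+ 2 / t)%:P),
        (Ppol l).[t] != 0 /\ p * u - t != 0,
        x = t + u ^+ 2 / t
      & y = (p * t - u) / (p * u - t)].

End Connections.

Section Painleve.
Variable F : fieldType.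

(* nu i is nu_i for 1 <= i <= 8; its other values are irrelevant. *)
Record qP_param := QPParam { kappa1 : F; kappa2 : F; nu : nat -> F }.
Implicit Type k : qP_param.

Definition qP_evolve (q : F) k : qP_param :=
  QPParam (kappa1 k / q) (q * kappa2 k) (nu k).

(* fn is the next f, gp is the previous g. *)
Definition qP_eq1 (q : F) k (f g fn : F) : Prop :=
  [/\ (f * g - 1) * (fn * g - 1) != 0,
      \prod_(1 <= i < 5) (g - (nu k i)^-1) != 0
    & (f * g - kappa1 k / kappa2 k) * (fn * g - kappa1 k / (q * kappa2 k)) /
        ((f * g - 1) * (fn * g - 1))
      = (\prod_(5 <= i < 9) (g - nu k i / kappa2 k)) /
        (\prod_(1 <= i < 5) (g - (nu k i)^-1))].

Definition qP_eq2 (q : F) k (f g gp : F) : Prop :=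
  [/\ (f * g - 1) * (f * gp - 1) != 0,
      \prod_(1 <= i < 5) (f - nu k i) != 0
    & (f * g - kappa1 k / kappa2 k) * (f * gp - q * kappa1 k / kappa2 k) /
        ((f * g - 1) * (f * gp - 1))
      = (\prod_(5 <= i < 9) (f - kappa1 k / nu k i)) /
        (\prod_(1 <= i < 5) (f - nu k i))].

(* One step (f, g) -> (fn, gn), k being the parameters at (f, g). *)
Definition qP_step (q : F) k (f g fn gn : F) : Prop :=
  qP_eq1 q k f g fn /\ qP_eq2 q (qP_evolve q k) fn gn g.

End Painleve.

Section ChangeOfCoordinates.
Variables (F : fieldType) (u q : F).
Implicit Types (l : param F) (k : qP_param F).

Definition matching l : qP_param F :=
  QPParam (u / z2 l) (z4 l / u)
    (fun i => match i with
              | 1 => (z6 l)^-1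
              | 2 => (z1 l)^-1
              | 3 => (z3 l)^-1
              | 4 => (z5 l)^-1
              | 5 => u * z4 l / z2 l
              | 6 => u
              | 7 => minus_rho1 l * z4 l * z6 l / u
              | 8 => minus_rho2 q l * z4 l * z6 l / u
              | _ => 0
              end).

Definition sigma1 l : F := z2 l + z4 l + z6 l.
Definition sigma2 l : F := z2 l * z4 l + z4 l * z6 l + z6 l * z2 l.
Definition sigma3 l : F := z2 l * z4 l * z6 l.

Definition f_num l (x y : F) : F :=
  sigma3 l * (x * y + u * (y - 1))
  - u ^+ 2 * (x ^+ 2 - sigma1 l * x + sigma2 l * (y + 1))
  + u ^+ 3 * (1 - y) * (sigma1 l - x) + u ^+ 4 * (1 + y).

Definition f_den l (x y : F) : F :=
  sigma3 l * x * (x * y + u * (y - 1))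
  - u ^+ 2 * (sigma2 l * x * y + sigma3 l * (y + 1))
  + u ^+ 3 * sigma2 l * (1 - y)
  + u ^+ 4 * (sigma1 l * (1 + y) - x) + u ^+ 5 * (y - 1).

Definition g_num l (x y : F) : F :=
  x * y * z6 l + u * z6 l * (y - 1) - u ^+ 2 * (1 + y).

Definition g_den l (x y : F) : F := z6 l * (1 + y) - x - u * (1 - y).

Definition f_of l (x y : F) : F := f_num l x y / f_den l x y.
Definition g_of l (x y : F) : F := g_num l x y / g_den l x y.

Definition x_num k (f g : F) : F :=
  (kappa1 k - kappa2 k) * g
  + nu k 6 * (1 + kappa1 k * kappa2 k) * (1 - f * g)
  + (nu k 6) ^+ 2 * (kappa1 k - kappa2 k) * f.

Definition x_den k (f g : F) : F := kappa1 k - kappa2 k * f * g.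

Definition y_num k (f g : F) : F :=
  nu k 1 * nu k 6 * (1 - f * g)
    * (nu k 6 * kappa1 k - (1 + kappa1 k * kappa2 k) * g)
  + kappa2 k * f * g * ((nu k 1 * nu k 6 - 1) * g - nu k 6)
  + nu k 1 * kappa2 k * g ^+ 2
  + kappa1 k * (1 - nu k 1 * g) * (g + nu k 6).

Definition y_den k (f g : F) : F :=
  (1 - f * g) * (nu k 6 - kappa2 k * (g - nu k 6 * kappa1 k))
  - nu k 6 * ((g + nu k 6) * (kappa1 k * nu k 1
                              + kappa2 k * f * (1 - g * nu k 1))
              - kappa1 k * (1 + nu k 6 * f)).

Definition x_of k (f g : F) : F := x_num k f g / x_den k f g.
Definition y_of k (f g : F) : F := y_num k f g / y_den k f g.

Definition fg_defined l (x y : F) : Prop :=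
  f_den l x y != 0 /\ g_den l x y != 0.
Definition xy_defined k (f g : F) : Prop :=
  x_den k f g != 0 /\ y_den k f g != 0.

Definition inverse_coordinates l : Prop :=
  generic (fun v : 'I_2 -> F =>
    let x := v ord0 in let y := v ord_max in
    let f := f_of l x y in let g := g_of l x y in
    [/\ fg_defined l x y, xy_defined (matching l) f g,
        x_of (matching l) f g = x & y_of (matching l) f g = y])
  /\
  generic (fun v : 'I_2 -> F =>
    let f := v ord0 in let g := v ord_max in
    let x := x_of (matching l) f g in let y := y_of (matching l) f g in
    [/\ xy_defined (matching l) f g, fg_defined l x y,
        f_of l x y = f & g_of l x y = g]).

Definition matching_compatible l : Prop :=
  let k := matching l in
  let k' := matching (evolve q l) in
  [/\ q = ((kappa1 k) ^+ 2 * (kappa2 k) ^+ 2) / \prod_(1 <= i < 9) nu k i,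
      kappa1 k' = kappa1 k / q,
      kappa2 k' = q * kappa2 k
    & forall i, (1 <= i <= 8)%N -> nu k' i = nu k i].

(* Equality of two partially defined maps, hence at generic points only: the
   first two clauses say that (x, y) are coordinates on the space of classes, and
   the last one that f, g computed at the image with the evolved parameters are
   the unique q-P image of f, g. *)
Definition equivalent_dynamics l : Prop :=
  generic (fun v : 'I_2 -> F =>
    let x := v ord0 in let y := v ord_max in
    [/\ exists2 A, is_connection u q l A & has_coords u q l A x y,
        forall A A', is_connection u q l A -> has_coords u q l A x y ->
          is_connection u q l A' -> has_coords u q l A' x y ->
          gauge_equiv u q A A'
      & forall A, is_connection u q l A -> has_coords u q l A x y ->
          exists (A' : 'M[ratfun F]_2) (x' y' : F),
            [/\ isomonodromic u q l A A',
                has_coords u q (evolve q l) A' x' y',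
                fg_defined l x y,
                fg_defined (evolve q l) x' y'
              & forall fn gn : F,
                  qP_step q (matching l) (f_of l x y) (g_of l x y) fn gn <->
                  fn = f_of (evolve q l) x' y' /\
                  gn = g_of (evolve q l) x' y']]).

End ChangeOfCoordinates.

(* Main.v *)
(* Put e = u^2/(q z2 z4), Phi(w) = (w + z6 rho1)(w + z6 rho2) and
   P3(z) = (z - z1)(z - z3)(z - z5).  In each gauge class one may take
   b11 = (z - u^2/z2)(z - u^2/z4) h with deg h = 4, and then, for g = g(x, y),
     z6 h(z) (g - z) = P3(z) (z6 - z) (g z - u^2)
                         + (z^2 - u^2) (z^2 - x z + u^2) (al z + be),
   where al, be are given by P3(g) (g - z6) = (g^2 - x g + u^2) (al g + be) and
   Phi(g) = al g + e be.  The right-hand side and its reflection under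
   z |-> u^2/z satisfy a polynomial identity of degree 6 (core_identity), checked
   at the six points u, -u, g, u^2/g, ze, u^2/ze, where ze = - be/al.  It says that
   b12 is a multiple of (z^2 - u^2) (z^2 - x' z + u^2) times the four linear factors
   at z2, z4, u^2/z2, u^2/z4, and gauging by an antidiagonal matrix then gives the
   modified connection, with coordinate x' and f' = 1/ze.  Both q-P equations are
   one biquadratic relation between x, f and g, read at z = g before the step and at
   z = ze after it.

   A modification is unique because a pole of R propagates along a q-orbit until it
   meets some z_i or u^2/z_i, which nonresonance permits only once; so R is
   polynomial, and its leading coefficient at infinity intertwines matrices with
   eigenvalues q^-n d_i and d_j, hence vanishes unless n = 0.

   Nonvanishing conditions are transported along the chain
   (x, y) -> (x, g) -> (g, ze) -> (ze, x') -> (x', y'), each arrow of which is a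
   Moebius transformation of one coordinate with the other one fixed. *)
From HB Require Import structures.
Require Import Defs.
From mathcomp Require Import all_boot all_order all_algebra.
From mathcomp Require Import generic_quotient.
From mathcomp Require Import boolp reals complex.
From mathcomp Require Import mpoly ring.
Set Implicit Arguments.
Unset Strict Implicit.
Unset Printing Implicit Defensive.
Import Order.TTheory GRing.Theory Num.Theory.
Local Open Scope ring_scope.
Local Open Scope quotient_scope.
Local Open Scope complex_scope.

(** * Genericity *)

Section RationalMaps.
Variable F : fieldType.

(** The shape of [b11] is no restriction: a gauge adds to [b11] a multiple of [b21] with two free
    parameters, enough to place zeros at u^2/z2 and u^2/z4. The formula for h is interpolation. At z
    = u and z = -u one has g z - u^2 = z (g - z), which gives the normalization of A there; at a
    zero t of b21 the fraction (z6 - z)(g z - u^2)/(g - z) takes the value prescribed by p, because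
    g is a Moebius transform of p. Of the two conditions on al and be, one makes the quotient by g -
    z a polynomial and the other is the trace at infinity. No given connection is ever brought to
    this form. Explicit connections A and A' are built from generic coordinates, and every
    connection with the same (x, y) is shown to be gauge equivalent to A. Uniqueness of the
    modification compares two connections of the evolved type, so nonresonance is asked of the
    evolved parameters only. *)

Definition polyfun n (f : ('I_n -> F) -> F) : Prop :=
  exists N : {mpoly F[n]}, forall v, f v = meval v N.

(** Agreement is asked only off a hypersurface, because [f] is a total function with conventional
    values where it divides by zero. *)
Definition rational n (f : ('I_n -> F) -> F) : Prop :=
  exists N D : {mpoly F[n]},
    D != 0 /\ forall v, meval v D != 0 -> f v = meval v N / meval v D.

Section Closure.
Variable n : nat.
Implicit Types (f g : ('I_n -> F) -> F) (P Q : ('I_n -> F) -> Prop).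

Lemma polyfun_var i : polyfun (fun v : 'I_n -> F => v i).
Proof. by exists 'X_i => v; rewrite mevalXU. Qed.

Lemma polyfun_const c : polyfun (fun _ : 'I_n -> F => c).
Proof. by exists c%:MP => v; rewrite mevalC. Qed.

Lemma polyfunD f g : polyfun f -> polyfun g -> polyfun (fun v => f v + g v).
Proof. by move=> [M hM] [N hN]; exists (M + N) => v; rewrite mevalD hM hN. Qed.

Lemma polyfunM f g : polyfun f -> polyfun g -> polyfun (fun v => f v * g v).
Proof. by move=> [M hM] [N hN]; exists (M * N) => v; rewrite mevalM hM hN. Qed.

Lemma polyfunN f : polyfun f -> polyfun (fun v => - f v).
Proof. by move=> [M hM]; exists (- M) => v; rewrite mevalN hM. Qed.

Lemma polyfunX f k : polyfun f -> polyfun (fun v => f v ^+ k).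
Proof.
by move=> [M hM]; exists (M ^+ k) => v; rewrite hM rmorphXn.
Qed.

Lemma polyfun_rational f : polyfun f -> rational f.
Proof.
move=> [M hM]; exists M, 1; rewrite oner_neq0; split=> // v _.
by rewrite meval1 divr1.
Qed.

Lemma rational_var i : rational (fun v : 'I_n -> F => v i).
Proof. exact/polyfun_rational/polyfun_var. Qed.

Lemma rational_const c : rational (fun _ : 'I_n -> F => c).
Proof. exact/polyfun_rational/polyfun_const. Qed.

Lemma rationalD f g : rational f -> rational g -> rational (fun v => f v + g v).
Proof.
move=> [N1 [D1 [D1n h1]]] [N2 [D2 [D2n h2]]].
exists (N1 * D2 + N2 * D1), (D1 * D2); split; first by rewrite mulf_neq0.
move=> v; rewrite mevalM mulf_eq0 negb_or => /andP[n1 n2].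
by rewrite h1 // h2 // mevalD !mevalM addf_div.
Qed.

Lemma rationalM f g : rational f -> rational g -> rational (fun v => f v * g v).
Proof.
move=> [N1 [D1 [D1n h1]]] [N2 [D2 [D2n h2]]].
exists (N1 * N2), (D1 * D2); split; first by rewrite mulf_neq0.
move=> v; rewrite mevalM mulf_eq0 negb_or => /andP[n1 n2].
by rewrite h1 // h2 // !mevalM mulf_div.
Qed.

Lemma rationalN f : rational f -> rational (fun v => - f v).
Proof.
move=> [N [D [Dn h]]]; exists (- N), D; split=> // v hv.
by rewrite h // mevalN mulNr.
Qed.

Lemma eq_rational f g : f =1 g -> rational f -> rational g.
Proof.
by move=> fg [N [D [Dn h]]]; exists N, D; split=> // v hv; rewrite -fg h.
Qed.

Lemma rationalX f k : rational f -> rational (fun v => f v ^+ k).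
Proof.
move=> hf; elim: k => [|k IHk]; first exact: rational_const.
by apply: eq_rational (rationalM hf IHk) => v; rewrite exprS.
Qed.

Lemma rationalV f : rational f -> rational (fun v => (f v)^-1).
Proof.
(* If N = 0 then [f] vanishes off D = 0, and so does its inverse by the convention 0^-1 = 0. *)
move=> [N [D [Dn h]]]; have [N0|Nn] := eqVneq N 0.
  by exists 0, D; split=> // v hv; rewrite h // N0 meval0 !mul0r invr0.
(* The extra factor D makes the denominator vanish wherever D does, so that the formula for [f] is
   available off its zeros. *)
exists (D * D), (N * D); split=> [|v]; first exact: mulf_neq0.
rewrite mevalM mulf_eq0 negb_or => /andP[nN nD].
by rewrite h // mevalM invf_div -mulf_div divff // mulr1.
Qed.

Lemma rational_sum (I : Type) (r : seq I) (f : I -> ('I_n -> F) -> F) :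
  (forall i, rational (f i)) -> rational (fun v => \sum_(i <- r) f i v).
Proof.
move=> hf; elim: r => [|i r IHr].
  by apply: eq_rational (rational_const 0) => v; rewrite big_nil.
by apply: eq_rational (rationalD (hf i) IHr) => v; rewrite big_cons.
Qed.

Lemma rational_prod (I : Type) (r : seq I) (f : I -> ('I_n -> F) -> F) :
  (forall i, rational (f i)) -> rational (fun v => \prod_(i <- r) f i v).
Proof.
move=> hf; elim: r => [|i r IHr].
  by apply: eq_rational (rational_const 1) => v; rewrite big_nil.
by apply: eq_rational (rationalM (hf i) IHr) => v; rewrite big_cons.
Qed.

Lemma generic_imp P Q : (forall v, P v -> Q v) -> generic P -> generic Q.
Proof. by move=> PQ [N Nn h]; exists N => // v /h /PQ. Qed.

Lemma generic_and P Q : generic P -> generic Q -> generic (fun v => P v /\ Q v).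
Proof.
move=> [M Mn hM] [N Nn hN]; exists (M * N); first exact: mulf_neq0.
by move=> v; rewrite mevalM mulf_eq0 negb_or => /andP[/hM ? /hN ?].
Qed.

Lemma generic_polyfun f v0 :
  polyfun f -> f v0 != 0 -> generic (fun v => f v != 0).
Proof.
move=> [N hN] h0; exists N => [|v]; last by rewrite hN.
by apply: contraNneq h0 => N0; rewrite hN N0 meval0.
Qed.

End Closure.

Lemma rational_comp m n (N : {mpoly F[n]}) (phi : ('I_m -> F) -> 'I_n -> F) :
  (forall i, rational (fun v => phi v i)) ->
  rational (fun v => meval (phi v) N).
Proof.
move=> hphi; apply: eq_rational (fun v => esym (mevalE (phi v) N)) _.
apply: rational_sum => k; apply: rationalM; first exact: rational_const.
by apply: rational_prod => i; apply: rationalX.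
Qed.

(** The second hypothesis is dominance of [phi]. It is tested off the zeros of an arbitrary D, since
    N composed with [phi] is a quotient of polynomials only off its denominator. *)
Lemma generic_pullback m n (phi : ('I_m -> F) -> 'I_n -> F) Q :
  (forall i, rational (fun v => phi v i)) ->
  (forall N D, N != 0 -> D != 0 ->
     exists2 v, meval v D != 0 & meval (phi v) N != 0) ->
  generic Q -> generic (fun v => Q (phi v)).
Proof.
move=> hphi dom [N Nn hQ]; have [M [D [Dn hM]]] := rational_comp N hphi.
have Mn : M != 0.
  have [v vD] := dom _ _ Nn Dn; rewrite hM //.
  by apply: contraNneq => ->; rewrite meval0 mul0r.
exists (M * D); first exact: mulf_neq0.
move=> v; rewrite mevalM mulf_eq0 negb_or => /andP[vM vD].
by apply: hQ; rewrite hM // mulf_neq0 ?invr_eq0.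
Qed.

End RationalMaps.

(** * Properties of one variable that fail at finitely many points *)

Section Cofinite.
Variable F : closedFieldType.
Implicit Types (P Q : F -> Prop) (p : {poly F}).

Definition cofinite P : Prop :=
  exists2 p, p != 0 & forall a, p.[a] != 0 -> P a.

Lemma cofinite_imp P Q : (forall a, P a -> Q a) -> cofinite P -> cofinite Q.
Proof. by move=> PQ [p pn h]; exists p => // v /h /PQ. Qed.

Lemma cofinite_and P Q :
  cofinite P -> cofinite Q -> cofinite (fun a => P a /\ Q a).
Proof.
move=> [p pn hp] [r rn hr]; exists (p * r); first exact: mulf_neq0.
by move=> v; rewrite hornerM mulf_eq0 negb_or => /andP[/hp ? /hr ?].
Qed.

Lemma cofinite_exists P : cofinite P -> exists a, P a.
Proof. by move=> [p /closed_nonrootP[a pa] h]; exists a; apply: h. Qed.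

Lemma cofinite_neq (c : F) : cofinite (fun a => a != c).
Proof.
exists ('X - c%:P); first by rewrite polyXsubC_eq0.
by move=> a; rewrite hornerXsubC subr_eq0.
Qed.

Lemma cofinite_affine (a b : F) :
  (a != 0) || (b != 0) -> cofinite (fun y => a * y + b != 0).
Proof.
move=> hab; exists (a *: 'X + b%:P) => [|y]; last by rewrite !hornerE.
apply: contraTneq hab => h.
have := congr1 (fun p : {poly F} => p`_0) h.
have := congr1 (fun p : {poly F} => p`_1) h.
by rewrite !coefE /= mulr1 mulr0 addr0 add0r => -> ->; rewrite eqxx.
Qed.

(** Over an algebraically closed field p splits, and the preimage of a root z is the zero of (a - z
    c) y + (b - z d), which is not identically zero because the determinant is nonzero. *)
Lemma cofinite_moebius (a b c d : F) p : a * d - b * c != 0 -> p != 0 ->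
  cofinite (fun y => c * y + d != 0 /\ p.[(a * y + b) / (c * y + d)] != 0).
Proof.
move=> hdet pn; have [r hr] := closed_field_poly_normal p.
apply: cofinite_and.
  apply: cofinite_affine; rewrite -negb_and.
  by apply: contraNN hdet => /andP[/eqP-> /eqP->]; rewrite !mulr0 subrr.
have : cofinite (fun y => c * y + d != 0 /\
          forall z, z \in r -> a * y + b - z * (c * y + d) != 0).
  apply: cofinite_and.
    apply: cofinite_affine; rewrite -negb_and.
    by apply: contraNN hdet => /andP[/eqP-> /eqP->]; rewrite !mulr0 subrr.
  elim: {hr} r => [|z r IHr]; first by exists 1; rewrite ?oner_neq0.
  have hz : cofinite (fun y => (a - z * c) * y + (b - z * d) != 0).
    apply: cofinite_affine; rewrite -negb_and.
    apply: contraNN hdet => /andP[/eqP h1 /eqP h2].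
    have -> : a = z * c by apply/eqP; rewrite -subr_eq0 h1.
    have -> : b = z * d by apply/eqP; rewrite -subr_eq0 h2.
    by apply/eqP; ring.
  apply: cofinite_imp (cofinite_and hz IHr) => y [h1 h2] w.
  rewrite inE => /orP[/eqP->|/h2//].
  by apply: contraNneq h1 => h1; rewrite -h1; apply/eqP; ring.
apply: cofinite_imp => y [h1 h2].
rewrite hr hornerZ mulf_neq0 ?lead_coef_eq0 //.
rewrite horner_prod prodf_seq_neq0; apply/allP => z /h2 h /=.
rewrite hornerXsubC subr_eq0; apply: contraNneq h => <-.
by rewrite divfK // subrr.
Qed.

End Cofinite.

(** * Generic points of the plane, studied fibre by fibre *)

Section Plane.
Variable F : closedFieldType.
Implicit Types (P Q : F -> F -> Prop).

Definition point (x y : F) : 'I_2 -> F := fun i => if i == ord0 then x else y.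

Definition generic2 P : Prop :=
  generic (fun v : 'I_2 -> F => P (v ord0) (v ord_max)).

Definition rational2 (f : F -> F -> F) : Prop :=
  rational (fun v : 'I_2 -> F => f (v ord0) (v ord_max)).

Lemma meval_point (N : {mpoly F[2]}) x y :
  meval (point x y) N =
  \sum_(m <- msupp N) N@_m * (x ^+ m ord0 * y ^+ m ord_max).
Proof.
rewrite mevalE; apply: eq_bigr => m _; congr (_ * _).
rewrite !big_ord_recl big_ord0 mulr1 /point /=.
by congr (_ ^+ _ * _ ^+ _); congr (fun_of_multinom m _); apply: val_inj.
Qed.

(** N is read as a polynomial in the second variable over polynomials in the first. One of its
    coefficients is nonzero, and every x off the zeros of that coefficient leaves a nonzero
    polynomial in y. *)
Lemma cofinite_meval_point (N : {mpoly F[2]}) : N != 0 ->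
  cofinite (fun x => cofinite (fun y => meval (point x y) N != 0)).
Proof.
move=> Nn.
pose B : {poly {poly F}} :=
  \sum_(m <- msupp N) (N@_m *: 'X^(m ord0)) *: 'X^(m ord_max).
have [m hm] : exists m, m \in msupp N.
  case E: (msupp N) => [|m s]; last by exists m; rewrite inE eqxx.
  by move: Nn; rewrite -msupp_eq0 E eqxx.
have Bm : B`_(m ord_max)`_(m ord0) = N@_m.
  rewrite coef_sum coef_sum (bigD1_seq m) ?msupp_uniq //= big1 => [|k km].
    by rewrite !(coefZ, coefXn) !eqxx !mulr1 coefZ coefXn eqxx mulr1 addr0.
  rewrite coefZ coefXn; case: eqP => [e1|_]; last by rewrite mulr0 coef0.
  rewrite mulr1 coefZ coefXn; case: eqP => [e0|_]; last by rewrite mulr0.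
  case/eqP: km; apply/mnmP => i.
  by case: i => [[|[|//]] hi]; [move: e0|move: e1] => e;
     congr (_ = _) : (esym e); congr (fun_of_multinom _ _); apply: val_inj.
exists B`_(m ord_max).
  by apply: contraTneq hm => h; rewrite -mcoeff_eq0 -Bm h coef0 eqxx.
move=> x hx; exists (map_poly (horner_eval x) B).
  apply: contraNneq hx => /(congr1 (fun p : {poly F} => p`_(m ord_max))).
  by rewrite coef_map coef0 /= /horner_eval => ->.
move=> y; congr (_ != 0).
rewrite meval_point rmorph_sum horner_sum; apply: eq_bigr => k _ /=.
rewrite map_polyZ map_polyXn /= hornerZ hornerXn /horner_eval hornerZ hornerXn.
by rewrite mulrA.
Qed.

Lemma generic2_imp P Q : (forall x y, P x y -> Q x y) -> generic2 P -> generic2 Q.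
Proof. by move=> h; apply: generic_imp => v; apply: h. Qed.

Lemma generic2_and P Q :
  generic2 P -> generic2 Q -> generic2 (fun x y => P x y /\ Q x y).
Proof. exact: generic_and. Qed.

Lemma generic2_poly1 (P : F -> Prop) : cofinite P -> generic2 (fun x _ => P x).
Proof.
move=> [p /closed_nonrootP[a pa] h].
suff: generic (fun v : 'I_2 -> F => p.[v ord0] != 0).
  by apply: generic_imp => v /h.
apply: (generic_polyfun (v0 := point a a)) => //.
exists (\sum_(i < size p) p`_i *: 'X_ord0 ^+ i) => v.
rewrite horner_coef rmorph_sum; apply: eq_bigr => i _ /=.
by rewrite mevalZ rmorphXn /= mevalXU.
Qed.

Lemma generic2_swap P : generic2 P -> generic2 (fun x y => P y x).
Proof.
move=> [N Nn hN].
pose M : {mpoly F[2]} := N \mPo [tuple 'X_ord_max; 'X_ord0].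
have hM v : meval v M = meval (point (v ord_max) (v ord0)) N.
  rewrite comp_mpoly_meval; apply: meval_eq => i; rewrite (tnth_nth 0).
  by case: i => [[|[|//]] hi]; rewrite /point /= mevalXU.
have /cofinite_exists[x /cofinite_exists[y h]] := cofinite_meval_point Nn.
exists M => [|v]; last by rewrite hM => /hN.
apply: contraNneq h => M0.
by have := hM (point y x); rewrite M0 meval0 => <-.
Qed.

(** Dominance of (x, y) -> (x, m x y) is checked on fibres: at all but finitely many x the equation
    of the exceptional set is a nonzero polynomial in one variable, and the hypothesis on [m] yields
    a y that avoids its roots. *)
Lemma generic2_fibered (m : F -> F -> F) P :
  rational2 m ->
  cofinite (fun x => forall p, p != 0 -> cofinite (fun y => p.[m x y] != 0)) ->
  generic2 P -> generic2 (fun x y => P x (m x y)).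
Proof.
move=> hm fib hP; pose phi (v : 'I_2 -> F) := point (v ord0) (m (v ord0) (v ord_max)).
have := @generic_pullback F 2 2 phi
  (fun v => P (v ord0) (v ord_max)) _ _ hP.
apply=> [i|N D Nn Dn].
  by rewrite /phi /point; case: (i == ord0); [apply: rational_var|apply: hm].
have /cofinite_exists[x [fx [[p pn hp] Dx]]] :=
  cofinite_and fib (cofinite_and (cofinite_meval_point Nn) (cofinite_meval_point Dn)).
have /cofinite_exists[y [py Dy]] := cofinite_and (fx p pn) Dx.
by exists (point x y) => //; apply: hp.
Qed.

End Plane.

Lemma subf_div (K : fieldType) (a b c d : K) : b != 0 -> d != 0 ->
  a / b - c / d = (a * d - c * b) / (b * d).
Proof. by move=> bn dn; rewrite -mulNr addf_div // mulNr. Qed.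

(** * Rational functions *)

Section Substitution.
Variable F : fieldType.
Implicit Types (p d : {poly F}) (r s : ratfun F) (a c : F).

HB.instance Definition _ :=
  GRing.RMorphism.copy (@of_poly F) (@FracField.tofrac {poly F}).
HB.instance Definition _ :=
  GRing.RMorphism.copy (@of_const F) (@of_poly F \o @polyC F).

Lemma of_polyM : {morph @of_poly F : p d / p * d}.
Proof. exact: rmorphM. Qed.

Lemma of_polyD : {morph @of_poly F : p d / p + d}.
Proof. exact: rmorphD. Qed.

Lemma of_polyN : {morph @of_poly F : p / - p}.
Proof. exact: rmorphN. Qed.

Lemma of_polyB : {morph @of_poly F : p d / p - d}.
Proof. exact: rmorphB. Qed.

Lemma of_poly1 : of_poly 1 = 1 :> ratfun F.
Proof. exact: rmorph1. Qed.

Lemma of_poly0 : of_poly 0 = 0 :> ratfun F.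
Proof. exact: rmorph0. Qed.

Lemma of_poly_inj : injective (@of_poly F).
Proof. by move=> p d /eqP; rewrite /of_poly tofrac_eq => /eqP. Qed.

Lemma of_poly_eq0 p : (of_poly p == 0) = (p == 0).
Proof. exact: tofrac_eq0. Qed.

Lemma of_constE c : of_const c = of_poly c%:P.
Proof. by []. Qed.

(** [subst] is defined through the representative [repr r]; this ties its numerator and denominator
    to the field operations. *)
Lemma ratfun_numden r :
  r = of_poly \n_(repr r) / of_poly \d_(repr r).
Proof.
have H (x : {ratio {poly F}}) : FracField.mul
    (\pi_({fraction {poly F}}) x) (FracField.tofrac \d_x) = FracField.tofrac \n_x.
  rewrite !piE; apply/eqmodP.
  rewrite /= FracField.equivfE /FracField.mulf !numden_Ratio ?mulr1;
    by rewrite ?oner_eq0 ?denom_ratioP // mulrC.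
have dn : of_poly \d_(repr r) != 0 by rewrite of_poly_eq0 denom_ratioP.
by apply: (canRL (mulfK dn)); rewrite -{1}[r]reprK; apply: H.
Qed.

Lemma ratfun_coprime r : exists p d : {poly F},
  [/\ d != 0, coprimep p d & r = of_poly p / of_poly d].
Proof.
set n := \n_(repr r); set d := \d_(repr r).
have dn : d != 0 := denom_ratioP _.
have gn : gcdp n d != 0 by rewrite gcdp_eq0 negb_and dn orbT.
have dE := divpK (dvdp_gcdr n d); have nE := divpK (dvdp_gcdl n d).
exists (n %/ gcdp n d), (d %/ gcdp n d); split.
- by rewrite dvdp_div_eq0 ?dvdp_gcdr.
- by apply: coprimep_div_gcd; rewrite dn orbT.
rewrite (ratfun_numden r) -/n -/d.
have -> : of_poly n = of_poly (n %/ gcdp n d) * of_poly (gcdp n d).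
  by rewrite -rmorphM nE.
have -> : of_poly d = of_poly (d %/ gcdp n d) * of_poly (gcdp n d).
  by rewrite -rmorphM dE.
have cancel (a b c : ratfun F) : c != 0 -> a * c / (b * c) = a / b.
  by move=> cn; rewrite -mulf_div divff // mulr1.
by apply: cancel; rewrite of_poly_eq0.
Qed.

Definition polyat s p : ratfun F := (map_poly (@of_const F) p).[s].

Lemma polyatD s p d : polyat s (p + d) = polyat s p + polyat s d.
Proof. by rewrite /polyat rmorphD hornerD. Qed.

Lemma polyatN s p : polyat s (- p) = - polyat s p.
Proof. by rewrite /polyat rmorphN hornerN. Qed.

Lemma polyatM s p d : polyat s (p * d) = polyat s p * polyat s d.
Proof. by rewrite /polyat rmorphM hornerM. Qed.

Lemma polyatC s c : polyat s c%:P = of_const c.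
Proof. by rewrite /polyat map_polyC hornerC. Qed.

Lemma polyatX s : polyat s 'X = s.
Proof. by rewrite /polyat map_polyX hornerX. Qed.

Lemma polyat1 s : polyat s 1 = 1.
Proof. by rewrite /polyat rmorph1 hornerC. Qed.

Lemma polyatE s p n : (size p <= n)%N ->
  polyat s p = \sum_(i < n) of_const p`_i * s ^+ i.
Proof.
move=> hp; rewrite /polyat (@horner_coef_wide _ n) => [|]; last first.
  exact: leq_trans (size_poly _ _) hp.
by apply: eq_bigr => i _; rewrite coef_map.
Qed.

Lemma polyat_var p : polyat var p = of_poly p.
Proof.
elim/poly_ind: p => [|p c IHp]; first by rewrite -polyC0 polyatC.
by rewrite polyatD polyatM polyatX IHp polyatC rmorphD rmorphM.
Qed.

(** Under this condition no denominator vanishes after substitution, so that [subst s] is a ring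
    morphism. *)
Definition transcendental s := forall p, p != 0 -> polyat s p != 0.

Section Morphism.
Variable s : ratfun F.
Hypothesis hs : transcendental s.

Lemma subst_div p d : d != 0 ->
  subst s (of_poly p / of_poly d) = polyat s p / polyat s d.
Proof.
move=> dn; set r := _ / _ : ratfun F.
have d'n : \d_(repr r) != 0 := denom_ratioP _.
rewrite /subst -!/(polyat _ _); apply/eqP; rewrite eqr_div ?hs //.
rewrite -!polyatM; apply/eqP; congr polyat; apply: of_poly_inj.
have := ratfun_numden r; rewrite {1}/r => /eqP.
by rewrite eqr_div ?of_poly_eq0 // -!of_polyM => /eqP /of_poly_inj ->.
Qed.

Lemma subst_poly p : subst s (of_poly p) = polyat s p.
Proof.
rewrite -[of_poly p]divr1 -(rmorph1 (@of_poly F)) subst_div ?oner_eq0 //.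
by rewrite polyat1 divr1.
Qed.

Lemma subst_const c : subst s (of_const c) = of_const c.
Proof. by rewrite of_constE subst_poly polyatC. Qed.

Lemma subst_var : subst s var = s.
Proof. by rewrite subst_poly polyatX. Qed.

Lemma ratfunP r : exists p d, d != 0 /\ r = of_poly p / of_poly d.
Proof.
exists \n_(repr r), \d_(repr r); split; last exact: ratfun_numden.
exact: denom_ratioP.
Qed.

Lemma subst_is_zmod_morphism : zmod_morphism (subst s).
Proof.
move=> r r'; have [p [d [dn ->]]] := ratfunP r.
have [p' [d' [dn' ->]]] := ratfunP r'.
have Pn : of_poly d != 0 by rewrite of_poly_eq0.
have Pn' : of_poly d' != 0 by rewrite of_poly_eq0.
have -> : of_poly p / of_poly d - of_poly p' / of_poly d' =
    of_poly (p * d' - p' * d) / of_poly (d * d').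
  rewrite of_polyB !of_polyM; exact: (subf_div (of_poly p) (of_poly p') Pn Pn').
rewrite !subst_div ?mulf_neq0 //.
rewrite polyatD polyatN !polyatM; apply: esym.
by apply: subf_div; apply: hs.
Qed.

Lemma subst_is_monoid_morphism : monoid_morphism (subst s).
Proof.
split=> [|r r'].
  by rewrite -(rmorph1 (@of_poly F)) subst_poly polyat1.
have [p [d [dn ->]]] := ratfunP r.
have [p' [d' [dn' ->]]] := ratfunP r'.
have -> : of_poly p / of_poly d * (of_poly p' / of_poly d') =
    of_poly (p * p') / of_poly (d * d').
  by rewrite !of_polyM; apply: mulf_div.
rewrite !subst_div ?mulf_neq0 // !polyatM; apply: esym.
exact: mulf_div.
Qed.

(** The proof of transcendence is carried as an argument, so that the morphism structure can be
    attached to the resulting term. *)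
Definition subst_morph of transcendental s := subst s.
HB.instance Definition _ := GRing.isZmodMorphism.Build _ _ (subst_morph hs)
  subst_is_zmod_morphism.
HB.instance Definition _ := GRing.isMonoidMorphism.Build _ _ (subst_morph hs)
  subst_is_monoid_morphism.

Lemma substE : subst s = subst_morph hs. Proof. by []. Qed.

Lemma substV : {morph subst s : r / r^-1}.
Proof. exact: (fmorphV (subst_morph hs)). Qed.

End Morphism.

End Substitution.

(* Unification must not unfold the operations of the fraction field. *)
#[global] Opaque subst polyat of_poly.

(** * Values, poles and limits at infinity *)

Section Values.
Variable F : fieldType.
Implicit Types (p d : {poly F}) (r s : ratfun F) (a c : F).

Lemma has_value_poly p a : has_value (of_poly p) a p.[a].
Proof.
exists p, 1; rewrite hornerC oner_neq0; split=> //.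
  by rewrite of_poly1 divr1.
by rewrite divr1.
Qed.

Lemma has_value_const c a : has_value (of_const c) a c.
Proof. by have := has_value_poly c%:P a; rewrite hornerC. Qed.

Lemma has_value_var a : has_value var a a.
Proof. by have := has_value_poly 'X a; rewrite hornerX. Qed.

Lemma has_value0 a : has_value (0 : ratfun F) a 0.
Proof. by have := has_value_const 0 a; rewrite /of_const polyC0 of_poly0. Qed.

Lemma has_value1 a : has_value (1 : ratfun F) a 1.
Proof. by have := has_value_const 1 a; rewrite /of_const polyC1 of_poly1. Qed.

Lemma horner_neq0 p a : p.[a] != 0 -> p != 0.
Proof. by apply: contraNneq => ->; rewrite horner0. Qed.

Lemma has_valueD r r' a c c' :
  has_value r a c -> has_value r' a c' -> has_value (r + r') a (c + c').
Proof.
move=> [p [d [da -> <-]]] [p' [d' [da' -> <-]]].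
have dn : of_poly d != 0 by rewrite of_poly_eq0 (horner_neq0 da).
have dn' : of_poly d' != 0 by rewrite of_poly_eq0 (horner_neq0 da').
exists (p * d' + p' * d), (d * d'); split.
- by rewrite hornerM mulf_neq0.
- by rewrite of_polyD !of_polyM; exact: (addf_div (of_poly p) (of_poly p') dn dn').
- by rewrite hornerD !hornerM; exact: esym (addf_div _ _ da da').
Qed.

Lemma has_valueN r a c : has_value r a c -> has_value (- r) a (- c).
Proof.
move=> [p [d [da -> <-]]]; exists (- p), d; split=> //.
  by rewrite of_polyN; exact: esym (mulNr _ _).
by rewrite hornerN mulNr.
Qed.

Lemma has_valueM r r' a c c' :
  has_value r a c -> has_value r' a c' -> has_value (r * r') a (c * c').
Proof.
move=> [p [d [da -> <-]]] [p' [d' [da' -> <-]]].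
exists (p * p'), (d * d'); split.
- by rewrite hornerM mulf_neq0.
- by rewrite !of_polyM; exact: (mulf_div (of_poly p) (of_poly d) _ _).
- by rewrite !hornerM; exact: esym (mulf_div _ _ _ _).
Qed.

Lemma has_valueV r a c : c != 0 -> has_value r a c -> has_value r^-1 a c^-1.
Proof.
move=> cn [p [d [da -> E]]]; exists d, p; split.
- by apply: contraNneq cn => p0; rewrite -E p0 mul0r.
- exact: invf_div.
- by rewrite -E invf_div.
Qed.

Lemma has_value_div r r' a c c' : c' != 0 ->
  has_value r a c -> has_value r' a c' -> has_value (r / r') a (c / c').
Proof. by move=> cn h h'; apply: has_valueM => //; apply: has_valueV. Qed.

Lemma has_value_exp r a c n : has_value r a c -> has_value (r ^+ n) a (c ^+ n).
Proof.
move=> h; elim: n => [|n IHn]; first exact: has_value1.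
by rewrite !exprS; apply: has_valueM.
Qed.

Lemma has_value_sum n (f : 'I_n -> ratfun F) (g : 'I_n -> F) a :
  (forall i, has_value (f i) a (g i)) ->
  has_value (\sum_(i < n) f i) a (\sum_(i < n) g i).
Proof.
move=> h; apply: (big_ind2 (fun r c => has_value r a c)) => [|r r' c c'|i _].
- exact: has_value0.
- by move=> h1 h2; apply: has_valueD.
- exact: h.
Qed.

Lemma has_value_unique r a c c' : has_value r a c -> has_value r a c' -> c = c'.
Proof.
move=> [p [d [da -> <-]]] [p' [d' [da' E <-]]].
have dn : of_poly d != 0 by rewrite of_poly_eq0 (horner_neq0 da).
have dn' : of_poly d' != 0 by rewrite of_poly_eq0 (horner_neq0 da').
have : of_poly p * of_poly d' = of_poly p' * of_poly d.
  by apply/eqP; rewrite -(eqr_div _ _ dn dn') E.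
rewrite -!of_polyM => /of_poly_inj /(congr1 (fun p => p.[a])).
by rewrite !hornerM => /eqP; rewrite -eqr_div // => /eqP.
Qed.

Definition regular r a := exists c, has_value r a c.

Lemma regularD r r' a : regular r a -> regular r' a -> regular (r + r') a.
Proof. by move=> [c h] [c' h']; exists (c + c'); apply: has_valueD. Qed.

Lemma regularM r r' a : regular r a -> regular r' a -> regular (r * r') a.
Proof. by move=> [c h] [c' h']; exists (c * c'); apply: has_valueM. Qed.

Lemma regular_div p d a : d.[a] != 0 -> regular (of_poly p / of_poly d) a.
Proof. by move=> da; exists (p.[a] / d.[a]), p, d. Qed.

(** In lowest terms the numerator and the denominator have no common zero. *)
Lemma regular_or_pole r a : regular r a \/ has_value r^-1 a 0.
Proof.
have [p [d [dn cop ->]]] := ratfun_coprime r.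
have [d0|da] := eqVneq d.[a] 0; last by left; apply: regular_div.
right; exists d, p; split; rewrite ?d0 ?mul0r //; last exact: invf_div.
by apply: (@coprimep_root _ d); rewrite ?rootE ?d0 // coprimep_sym.
Qed.

Lemma has_value_polyat s p a b : has_value s b a -> has_value (polyat s p) b p.[a].
Proof.
move=> hs; rewrite (polyatE s (leqnn (size p))) horner_coef.
apply: has_value_sum => i; apply: has_valueM; first exact: has_value_const.
exact: has_value_exp.
Qed.

Lemma has_value_subst s r a b c : transcendental s ->
  has_value s b a -> has_value r a c -> has_value (subst s r) b c.
Proof.
move=> ts hs [p [d [da -> <-]]].
rewrite (subst_div ts) ?(horner_neq0 da) //.
by apply: has_value_div => //; apply: has_value_polyat.
Qed.

(** Poles are preserved in both directions: if r has a pole at a, then r^-1 composed with s vanishes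
    at b, so the product of the two composites would have the values 1 and 0 there. *)
Lemma regular_subst s r a b : transcendental s -> has_value s b a ->
  regular (subst s r) b <-> regular r a.
Proof.
move=> ts hs; split=> [[c hc]|[c hc]]; last first.
  by exists c; apply: has_value_subst hc.
have [//|pole] := regular_or_pole r a.
have [->|rn] := eqVneq r 0; first by exists 0; apply: has_value0.
have := has_valueM hc (has_value_subst ts hs pole).
rewrite (substE ts) fmorphV divff ?fmorph_eq0 // mulr0 => h.
by have /eqP := has_value_unique (has_value1 b) h; rewrite oner_eq0.
Qed.

Lemma irregular_finite r : exists2 d : {poly F}, d != 0 &
  forall a, ~ regular r a -> root d a.
Proof.
have [p [d [dn ->]]] := ratfunP r; exists d => // a h.
by apply: contraPT h => da nr; apply: nr; apply: regular_div.
Qed.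

Definition mx_regular m n (A : 'M[ratfun F]_(m, n)) a := forall i j, regular (A i j) a.

Lemma regular_sum n (f : 'I_n -> ratfun F) a :
  (forall i, regular (f i) a) -> regular (\sum_(i < n) f i) a.
Proof.
move=> h; apply: (big_ind (fun r => regular r a)) => [|r r'|i _].
- by exists 0; apply: has_value0.
- exact: regularD.
- exact: h.
Qed.

Lemma mx_regularM m n k (A : 'M[ratfun F]_(m, n)) (B : 'M[ratfun F]_(n, k)) a :
  mx_regular A a -> mx_regular B a -> mx_regular (A *m B) a.
Proof.
by move=> hA hB i j; rewrite mxE; apply: regular_sum => l; apply: regularM.
Qed.

Definition winv : ratfun F := var^-1.

Lemma has_limitE r c : has_limit r c = has_value (subst winv r) 0 c.
Proof. by []. Qed.

Hypothesis tw : transcendental winv.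

Lemma has_limit_const c : has_limit (of_const c) c.
Proof. by rewrite has_limitE (subst_const tw); apply: has_value_const. Qed.

Lemma has_limit0 : has_limit (0 : ratfun F) 0.
Proof. by rewrite has_limitE (substE tw) rmorph0; apply: has_value0. Qed.

Lemma has_limit1 : has_limit (1 : ratfun F) 1.
Proof. by rewrite has_limitE (substE tw) rmorph1; apply: has_value1. Qed.

Lemma has_limitD r r' c c' :
  has_limit r c -> has_limit r' c' -> has_limit (r + r') (c + c').
Proof. by rewrite !has_limitE (substE tw) rmorphD; apply: has_valueD. Qed.

Lemma has_limitM r r' c c' :
  has_limit r c -> has_limit r' c' -> has_limit (r * r') (c * c').
Proof. by rewrite !has_limitE (substE tw) rmorphM; apply: has_valueM. Qed.

Lemma has_limitV r c : c != 0 -> has_limit r c -> has_limit r^-1 c^-1.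
Proof. by move=> cn; rewrite !has_limitE (substE tw) fmorphV; apply: has_valueV. Qed.

Lemma has_limit_div r r' c c' : c' != 0 ->
  has_limit r c -> has_limit r' c' -> has_limit (r / r') (c / c').
Proof. by move=> cn h h'; apply: has_limitM => //; apply: has_limitV. Qed.

Lemma has_limitX r c n : has_limit r c -> has_limit (r ^+ n) (c ^+ n).
Proof. by rewrite !has_limitE (substE tw) rmorphXn; apply: has_value_exp. Qed.

Lemma has_limit_unique r c c' : has_limit r c -> has_limit r c' -> c = c'.
Proof. exact: has_value_unique. Qed.

Lemma has_limit_sum n (f : 'I_n -> ratfun F) (g : 'I_n -> F) :
  (forall i, has_limit (f i) (g i)) ->
  has_limit (\sum_(i < n) f i) (\sum_(i < n) g i).
Proof.
move=> h; apply: (big_ind2 (fun r c => has_limit r c)) => [|r r' c c'|i _].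
- exact: has_limit0.
- by move=> h1 h2; apply: has_limitD.
- exact: h.
Qed.

Lemma mx_has_limitM (A B : 'M[ratfun F]_2) (M N : 'M[F]_2) :
  mx_has_limit A M -> mx_has_limit B N -> mx_has_limit (A *m B) (M *m N).
Proof.
move=> hA hB i j; rewrite !mxE; apply: has_limit_sum => k.
exact: has_limitM.
Qed.

Lemma mx_has_limitZ (r : ratfun F) c (A : 'M[ratfun F]_2) (M : 'M[F]_2) :
  has_limit r c -> mx_has_limit A M -> mx_has_limit (r *: A) (c *: M).
Proof. by move=> h hA i j; rewrite !mxE; apply: has_limitM. Qed.

Lemma mx_has_limit_unique (A : 'M[ratfun F]_2) (M N : 'M[F]_2) :
  mx_has_limit A M -> mx_has_limit A N -> M = N.
Proof. by move=> h h'; apply/matrixP=> i j; apply: has_limit_unique (h i j) (h' i j). Qed.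

Lemma has_limit_var_inv : has_limit (var^-1 : ratfun F) 0.
Proof.
rewrite has_limitE (substV tw) (subst_var tw) invrK.
exact: has_value_var.
Qed.

Lemma has_limit_polyat s p n : s != 0 -> has_limit s^-1 0 -> (size p <= n.+1)%N ->
  has_limit (polyat s p / s ^+ n) p`_n.
Proof.
move=> sn hs hp; rewrite (polyatE s hp) mulr_suml.
(* Each term p_i s^(i - n) tends to p_i 0^(n - i); as 0^0 = 1, only the term i = n survives. *)
have -> : p`_n = \sum_(i < n.+1) p`_i * 0 ^+ (n - i).
  rewrite big_ord_recr /= subnn expr0 mulr1 big1 ?add0r // => i _.
  by rewrite expr0n subn_eq0 leqNgt ltn_ord mulr0.
apply: has_limit_sum => i; rewrite -mulrA.
apply: has_limitM; first exact: has_limit_const.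
have -> : s ^+ i / s ^+ n = s^-1 ^+ (n - i).
  have := ltnSE (ltn_ord i); move: (nat_of_ord i) => k kn.
  apply: (mulIf (expf_neq0 n sn)); rewrite divfK ?expf_neq0 //.
  by rewrite exprVn -{2}(subnK kn) exprD mulKf ?expf_neq0.
exact: has_limitX.
Qed.

End Values.

Section Transcendental.
Variable F : closedFieldType.
Implicit Types (p : {poly F}) (s : ratfun F).

(** Over an algebraically closed field p splits, and p(s) is a nonzero constant times factors s - z,
    none of which is zero. *)
Lemma transcendental_nonconst s : (forall c, s != of_const c) -> transcendental s.
Proof.
move=> hs p pn; have [r ->] := closed_field_poly_normal p.
rewrite -mul_polyC polyatM polyatC mulf_neq0 //.
  by rewrite of_poly_eq0 polyC_eq0 lead_coef_eq0.
elim: r => [|z r IHr].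
  by rewrite big_nil polyat1 oner_neq0.
rewrite big_cons polyatM; apply: mulf_neq0; last exact: IHr.
rewrite polyatD. rewrite polyatN. rewrite polyatC. rewrite polyatX. rewrite subr_eq0. exact: hs.
Qed.

Lemma everywhere_regular_poly (r : ratfun F) :
  (forall a, regular r a) -> exists p, r = of_poly p.
Proof.
have [p [d [dn cop ->]]] := ratfun_coprime r => h.
have sd : size d == 1.
  apply: contraT => /closed_rootP[a da]; have [c hc] := h a.
  have pa : p.[a] != 0 by apply: coprimep_root da; rewrite coprimep_sym.
  have dn' : of_poly d != 0 by rewrite of_poly_eq0.
  have := has_valueM hc (has_value_poly d a); rewrite divfK //.
  rewrite (rootP da) mulr0 => /has_value_unique -/(_ _ (has_value_poly p a)) E.
  by rewrite -E eqxx in pa.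
have /size_poly1P[c cn dE] := sd; exists (c^-1 *: p).
have dn' : of_poly d != 0 by rewrite of_poly_eq0.
have -> : of_poly p = of_poly (c^-1 *: p) * of_poly d.
  by rewrite -of_polyM dE mulrC mul_polyC scalerA divff // scale1r.
exact: mulfK.
Qed.

End Transcendental.

(** * Two by two matrices *)

Section Mx2.
Variable K : fieldType.
Implicit Types (a b c d : K) (A : 'M[K]_2).

Lemma mx2_eta A : A = mx2 (A 0 0) (A 0 1) (A 1 0) (A 1 1).
Proof.
apply/matrixP=> i j; rewrite mxE.
by case: i => [[|[|//]] hi]; case: j => [[|[|//]] hj] /=; congr (A _ _); apply: val_inj.
Qed.

Lemma mx2P (P : 'I_2 -> 'I_2 -> Prop) :
  P 0 0 -> P 0 1 -> P 1 0 -> P 1 1 -> forall i j, P i j.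
Proof.
move=> h00 h01 h10 h11 i j.
have E (k : 'I_2) : k = 0 \/ k = 1.
  by case: k => [[|[|//]] hk]; [left|right]; apply: val_inj.
by case: (E i) => ->; case: (E j) => ->.
Qed.

Lemma mul_mx2 a b c d a' b' c' d' :
  mx2 a b c d *m mx2 a' b' c' d' =
  mx2 (a * a' + b * c') (a * b' + b * d') (c * a' + d * c') (c * b' + d * d').
Proof.
by apply/matrixP; apply: mx2P; rewrite !mxE big_ord_recl big_ord1 !mxE.
Qed.

Lemma scale_mx2 k a b c d : k *: mx2 a b c d = mx2 (k * a) (k * b) (k * c) (k * d).
Proof. by apply/matrixP; apply: mx2P; rewrite !mxE. Qed.

Lemma det_mx2 a b c d : \det (mx2 a b c d) = a * d - b * c.
Proof. rewrite (expand_det_row _ 0) big_ord_recl big_ord1 /cofactor !det_mx11 !mxE /=.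
by rewrite /bump /= expr0 expr1 mul1r mulN1r mulrN. Qed.

Lemma mx2_scalar a : a%:M = mx2 a 0 0 a.
Proof. by apply/matrixP; apply: mx2P; rewrite !mxE. Qed.

Lemma unit_mx2 a b c d : (mx2 a b c d \in unitmx) = (a * d - b * c != 0).
Proof. by rewrite unitmxE det_mx2 unitfE. Qed.

Lemma invmx_unique (A B : 'M[K]_2) : A *m B = 1%:M -> invmx A = B.
Proof.
move=> AB; have /andP[uA _] : (A \in unitmx) && (B \in unitmx).
  by have := unitmx1 K 2; rewrite -AB unitmx_mul.
by rewrite -[LHS]mulmx1 -AB mulKmx.
Qed.

Lemma invmx_mx2 a b c d : a * d - b * c != 0 ->
  invmx (mx2 a b c d) = (a * d - b * c)^-1 *: mx2 d (- b) (- c) a.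
Proof.
move=> h; apply: invmx_unique; rewrite scale_mx2 mul_mx2 mx2_scalar.
by congr mx2; field.
Qed.

Lemma mx2_inj a b c d a' b' c' d' : mx2 a b c d = mx2 a' b' c' d' ->
  [/\ a = a', b = b', c = c' & d = d'].
Proof.
move=> /matrixP h; move: (h 0 0) (h 0 1) (h 1 0) (h 1 1).
by rewrite !mxE.
Qed.

End Mx2.

Lemma map_mx2 (K L : Type) (f : K -> L) a b c d :
  map_mx f (mx2 a b c d) = mx2 (f a) (f b) (f c) (f d).
Proof. by apply/matrixP; apply: mx2P; rewrite !mxE. Qed.

(** * Reversal of polynomials under z -> u^2/z *)

Section Reciprocal.
Variable F : closedFieldType.
Variable u : F.
Implicit Types (p : {poly F}).

Lemma poly_eq_cofinite p p' : cofinite (fun z => p.[z] = p'.[z]) -> p = p'.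
Proof.
move=> [d dn h]; apply/eqP; rewrite -subr_eq0; apply: contraNT dn => pn.
have : d * (p - p') == 0.
  apply: contraT => /closed_nonrootP[z]; rewrite rootE hornerM mulf_eq0 negb_or.
  by move=> /andP[/h e]; rewrite !hornerE e subrr eqxx.
by rewrite mulf_eq0 (negbTE pn) orbF.
Qed.

(** This is z^n p(u^2/z). The involution condition turns into linear equations between such
    reversals. *)
Definition recip n p : {poly F} := \poly_(i < n.+1) (p`_(n - i) * u ^+ (2 * (n - i))).

Lemma recipE n p z : (size p <= n.+1)%N -> z != 0 ->
  (recip n p).[z] = z ^+ n * p.[u ^+ 2 / z].
Proof.
move=> hp zn; rewrite horner_poly (horner_coef_wide _ hp) mulr_sumr.
rewrite (reindex_inj rev_ord_inj) /=; apply: eq_bigr => i _.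
rewrite subSS (subKn (ltnSE (ltn_ord i))) exprMn exprM -!mulrA [RHS]mulrCA; congr (_ * _).
rewrite [RHS]mulrCA; congr (_ * _); have := ltnSE (ltn_ord i).
move: (nat_of_ord i) => k kn; by rewrite -{2}(subnK kn) exprD exprVn mulfK // expf_neq0.
Qed.

Lemma recip_eq n p p' : (size p <= n.+1)%N ->
  cofinite (fun z => z ^+ n * p.[u ^+ 2 / z] = p'.[z]) -> recip n p = p'.
Proof.
move=> hp h; apply: poly_eq_cofinite.
apply: cofinite_imp (cofinite_and (cofinite_neq 0) h) => z [zn <-].
exact: recipE.
Qed.

End Reciprocal.

(** * The substitutions sigma(z), sigma(z/q) and u^2/z *)

Section Sigma.
Variable F : closedFieldType.
Implicit Types (p : {poly F}) (r s : ratfun F).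

(** Identities of rational functions are reduced to identities between their values at all but
    finitely many points, which are computations in [F]. *)
Lemma ratfun_eq_values r r' :
  cofinite (fun a => exists2 c, has_value r a c & has_value r' a c) -> r = r'.
Proof.
move=> h; have [p [d [dn rE]]] := ratfunP r; have [p' [d' [dn' rE']]] := ratfunP r'.
have dn1 : of_poly d != 0 by rewrite of_poly_eq0.
have dn1' : of_poly d' != 0 by rewrite of_poly_eq0.
suff E : p * d' = p' * d.
  apply/eqP; rewrite rE rE' (eqr_div _ _ dn1 dn1') -!of_polyM.
  by apply/eqP; congr of_poly.
apply: poly_eq_cofinite; case: h => e en he.
exists (e * (d * d')) => [|z]; first by rewrite !mulf_neq0.
rewrite !hornerM !mulf_eq0 !negb_or => /and3P[/he[c h h'] dz dz'].
have hc : has_value r z (p.[z] / d.[z]) by exists p, d.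
have hc' : has_value r' z (p'.[z] / d'.[z]) by exists p', d'.
apply/eqP; rewrite -eqr_div //; apply/eqP.
by rewrite -(has_value_unique h hc) -(has_value_unique h' hc').
Qed.

Lemma transcendental_values s a b va vb :
  has_value s a va -> has_value s b vb -> va != vb -> transcendental s.
Proof.
move=> ha hb ab; apply: transcendental_nonconst => c.
apply: contraNneq ab => E; rewrite E in ha hb.
rewrite (has_value_unique ha (has_value_const c a)).
by rewrite (has_value_unique hb (has_value_const c b)).
Qed.

Lemma exists_neq (s : seq F) : exists x, x \notin s.
Proof.
apply: cofinite_exists; elim: s => [|a s IHs].
  by exists 1 => //; apply: oner_neq0.
apply: cofinite_imp (cofinite_and (cofinite_neq a) IHs) => x [xa xs].
by rewrite inE negb_or xa.
Qed.

Lemma has_value_winv (a : F) : a != 0 -> has_value (winv F) a a^-1.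
Proof. by move=> an; apply: has_valueV => //; apply: has_value_var. Qed.

Lemma transcendental_winv : transcendental (winv F).
Proof.
have [x] := exists_neq [:: 0; 1]; rewrite !inE negb_or => /andP[x0 x1].
apply: (transcendental_values (has_value_winv x0) (has_value_winv (oner_neq0 F))).
by rewrite invr1 invr_eq1.
Qed.

Variables u q : F.
Hypothesis un : u != 0.
Hypothesis qn : q != 0.

Definition uinv : ratfun F := of_const (u ^+ 2) / var.
Definition sig (w : F) : F := w + u ^+ 2 / (q * w).

Lemma has_value_uinv (a : F) : a != 0 -> has_value uinv a (u ^+ 2 / a).
Proof.
move=> an; apply: has_value_div => //; first exact: has_value_const.
exact: has_value_var.
Qed.

Lemma has_value_sigma_z a : a != 0 -> has_value (sigma_z u q) a (sig a).
Proof.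
move=> an; apply: has_valueD; first exact: has_value_var.
apply: has_value_div; [exact: mulf_neq0|exact: has_value_const|].
by apply: has_valueM; [exact: has_value_const|exact: has_value_var].
Qed.

Lemma has_value_sigma_zq a : a != 0 -> has_value (sigma_zq u q) a (sig (a / q)).
Proof.
move=> an; have h : has_value (var / of_const q) a (a / q).
  by apply: has_value_div => //; [exact: has_value_var|exact: has_value_const].
apply: has_valueD; first exact: h.
apply: has_value_div; last by apply: has_valueM h; exact: has_value_const.
  by rewrite !mulf_neq0 ?invr_eq0.
exact: has_value_const.
Qed.

(** [sig] is two-to-one; its fibres are the orbits of w -> u^2/(q w). *)
Lemma sig_eq v w : v != 0 -> w != 0 ->
  (sig v == sig w) = (v == w) || (v == u ^+ 2 / (q * w)).
Proof.
move=> vn wn; rewrite -subr_eq0.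
have -> : sig v - sig w = (v - w) * (v - u ^+ 2 / (q * w)) / v.
  by rewrite /sig; field; rewrite vn wn qn.
by rewrite !mulf_eq0 !subr_eq0 invr_eq0 (negbTE vn) orbF.
Qed.

Lemma transcendental_uinv : transcendental uinv.
Proof.
have [x] := exists_neq [:: 0; 1]; rewrite !inE negb_or => /andP[x0 x1].
apply: (transcendental_values (has_value_uinv x0) (has_value_uinv (oner_neq0 F))).
rewrite divr1; apply: contraNneq x1 => E.
by rewrite -(divff (expf_neq0 2 un)) -{2}E; apply/eqP; field; rewrite un x0.
Qed.

Lemma transcendental_sigma_z : transcendental (sigma_z u q).
Proof.
have [x] := exists_neq [:: 0; 1; u ^+ 2 / (q * 1)].
rewrite !inE !negb_or => /and3P[x0 x1 x2].
apply: (transcendental_values (has_value_sigma_z x0)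
                              (has_value_sigma_z (oner_neq0 F))).
by rewrite sig_eq ?oner_neq0 // negb_or x1.
Qed.

Lemma transcendental_sigma_zq : transcendental (sigma_zq u q).
Proof.
have [x] := exists_neq [:: 0; q; u ^+ 2].
rewrite !inE !negb_or => /and3P[x0 x1 x2].
apply: (transcendental_values (has_value_sigma_zq x0) (has_value_sigma_zq qn)).
rewrite sig_eq ?mulf_neq0 ?invr_eq0 // divff // mulr1 negb_or.
rewrite -(inj_eq (mulIf qn)) divfK // mul1r x1 /=.
by rewrite -(inj_eq (mulIf qn)) !divfK.
Qed.

Let tw := transcendental_winv.

Lemma var_neq0 : (var : ratfun F) != 0.
Proof. by rewrite of_poly_eq0 polyX_eq0. Qed.

Lemma of_const_neq0 (c : F) : c != 0 -> of_const c != 0.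
Proof. by move=> cn; rewrite of_poly_eq0 polyC_eq0. Qed.

Lemma has_limit_sigma_z_var : has_limit (sigma_z u q / var) 1.
Proof.
have E (K : fieldType) (a b c : K) : a != 0 -> c != 0 ->
  (a + b / (c * a)) / a = 1 + b / c * (a^-1 * a^-1).
  by move=> an cn; field; rewrite an cn.
rewrite (E _ var (of_const (u ^+ 2)) (of_const q) var_neq0 (of_const_neq0 qn)).
have E1 : 1 + u ^+ 2 / q * (0 * 0) = 1 :> F by rewrite !mulr0 addr0.
rewrite -[X in has_limit _ X]E1.
apply: (has_limitD tw); first exact: (has_limit1 tw).
apply: (has_limitM tw).
  by apply: (has_limit_div tw) => //; exact: (has_limit_const tw).
by apply: (has_limitM tw); exact: (has_limit_var_inv tw).
Qed.

Lemma has_limit_sigma_zq_var : has_limit (sigma_zq u q / var) q^-1.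
Proof.
have E (K : fieldType) (a b c : K) : a != 0 -> c != 0 ->
  (a / c + b / (c * (a / c))) / a = c^-1 + b * (a^-1 * a^-1).
  by move=> an cn; field; rewrite an cn.
rewrite (E _ var (of_const (u ^+ 2)) (of_const q) var_neq0 (of_const_neq0 qn)).
have E1 : q^-1 + u ^+ 2 * (0 * 0) = q^-1 by rewrite !mulr0 addr0.
rewrite -[X in has_limit _ X]E1.
apply: (has_limitD tw).
  by apply: (has_limitV tw) => //; exact: (has_limit_const tw).
apply: (has_limitM tw); first exact: (has_limit_const tw).
by apply: (has_limitM tw); exact: (has_limit_var_inv tw).
Qed.

Lemma sigma_z_neq0 : sigma_z u q != 0.
Proof.
have := transcendental_sigma_z; move=> /(_ 'X); rewrite polyatX polyX_eq0; exact.
Qed.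

Lemma sigma_zq_neq0 : sigma_zq u q != 0.
Proof.
have := transcendental_sigma_zq; move=> /(_ 'X); rewrite polyatX polyX_eq0; exact.
Qed.

Lemma has_limit_sigma_ratio : has_limit (sigma_zq u q / sigma_z u q) q^-1.
Proof.
have E (K : fieldType) (a b c : K) : c != 0 -> a / b = (a / c) / (b / c).
  by move=> cn; rewrite -mulf_div divff ?invr_eq0 // mulr1.
rewrite (E _ _ _ _ var_neq0) -[q^-1]divr1.
apply: (has_limit_div tw (oner_neq0 F)).
  exact: has_limit_sigma_zq_var.
exact: has_limit_sigma_z_var.
Qed.

Lemma has_limit_sigma_z_inv : has_limit (sigma_z u q)^-1 0.
Proof.
have E (K : fieldType) (a b : K) : b != 0 -> a^-1 = b^-1 * (a / b)^-1.
  by move=> bn; rewrite invf_div mulrA mulVf // mul1r.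
rewrite (E _ _ _ var_neq0) -(mul0r (1^-1 : F)).
apply: (has_limitM tw); first exact: (has_limit_var_inv tw).
apply: (has_limitV tw (oner_neq0 F)); exact: has_limit_sigma_z_var.
Qed.

Lemma has_limit_sigma_zq_inv : has_limit (sigma_zq u q)^-1 0.
Proof.
have E (K : fieldType) (a b : K) : b != 0 -> a^-1 = b^-1 * (a / b)^-1.
  by move=> bn; rewrite invf_div mulrA mulVf // mul1r.
rewrite (E _ _ _ var_neq0) -(mul0r (q^-1^-1 : F)).
apply: (has_limitM tw); first exact: (has_limit_var_inv tw).
apply: (has_limitV tw); first by rewrite invr_eq0.
exact: has_limit_sigma_zq_var.
Qed.

End Sigma.

(** * Diagonalization from trace and determinant *)

Section Diagonalization.
Variable K : fieldType.

Lemma diagonalize_mx2 (a b c d k1 k2 : K) :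
  k1 != k2 -> a + d = k1 + k2 -> a * d - b * c = k1 * k2 ->
  exists2 G : 'M[K]_2, G \in unitmx & G *m mx2 a b c d *m invmx G = mx2 k1 0 0 k2.
Proof.
move=> k12 htr hdet.
suff [G uG GM] : exists2 G : 'M[K]_2, G \in unitmx &
    G *m mx2 a b c d = mx2 k1 0 0 k2 *m G.
  by exists G => //; rewrite GM mulmxK.
have dE : d = k1 + k2 - a by rewrite -htr addrAC subrr add0r.
have [c0|cn] := eqVneq c 0; last first.
  (* The rows are left eigenvectors: (c, k - a) belongs to the eigenvalue k. *)
  exists (mx2 c (k1 - a) c (k2 - a)).
    rewrite unit_mx2; have -> : c * (k2 - a) - (k1 - a) * c = c * (k2 - k1) by ring.
    by rewrite mulf_neq0 // subr_eq0 eq_sym.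
  have bE : b = (a * d - k1 * k2) / c.
    by rewrite -hdet opprB addrC subrK mulfK.
  by rewrite !mul_mx2 bE dE; congr mx2; field.
have : (a - k1) * (a - k2) = 0.
  have -> : (a - k1) * (a - k2) = k1 * k2 - a * d + b * c by rewrite dE c0; ring.
  by rewrite -hdet; ring.
have h12 : k1 - k2 != 0 by rewrite subr_eq0.
have h21 : k2 - k1 != 0 by rewrite subr_eq0 eq_sym.
move/eqP; rewrite mulf_eq0 !subr_eq0 => /orP[] /eqP aE.
  exists (mx2 1 (b / (k1 - k2)) 0 1).
    by rewrite unit_mx2 !mulr1 mulr0 subr0 oner_neq0.
  by rewrite !mul_mx2 dE aE c0; congr mx2; field.
exists (mx2 0 1 1 (b / (k2 - k1))).
  by rewrite unit_mx2 mul0r mulr1 sub0r oppr_eq0 oner_neq0.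
by rewrite !mul_mx2 dE aE c0; congr mx2; field.
Qed.

End Diagonalization.

(** * Connections as polynomial data *)

Section PolynomialConnections.
Variable F : closedFieldType.
Variables u q : F.
Hypothesis un : u != 0.
Hypothesis qn : q != 0.
Hypothesis u2n : u != - u.
Implicit Types (l : param F) (b c : {poly F}) (A : 'M[ratfun F]_2).

(* c is b21 / z. *)
Definition poly_conn l b11 b12 c b22 : Prop :=
  [/\ [/\ (size b11 <= 7)%N, (size b12 <= 9)%N, (size c <= 5)%N
        & (size b22 <= 7)%N],
      b11 * b22 - b12 * c = Ppol u l * Qpol u l,
      [/\ recip u 6 b11 = u ^+ 6 *: b22, recip u 4 c = - u ^+ 4 *: c
        & recip u 8 b12 = - u ^+ 8 *: b12],
      b11.[u] = (Ppol u l).[u] /\ b11.[- u] = (Ppol u l).[- u]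
    & b11`_6 + b22`_6 / q = minus_rho1 l + minus_rho2 q l].

Definition zs l : seq F := [:: z1 l; z2 l; z3 l; z4 l; z5 l; z6 l].

(** [adm_u] keeps the zeros of P away from the fixed points u and -u of the involution; [adm_d12]
    lets the limit at infinity be diagonalized knowing only its trace and determinant. *)
Record admissible l : Prop := Admissible {
  adm_z : all (fun z => z != 0) (zs l);
  adm_u : all (fun z => (z != u) && (z != - u)) (zs l);
  adm_d : dd l != 0;
  adm_d12 : minus_rho1 l != minus_rho2 q l }.

Section Fixed.
Variable l : param F.
Hypothesis hl : admissible l.

Lemma adm_zn : [/\ z1 l != 0, z2 l != 0, z3 l != 0 & [/\ z4 l != 0, z5 l != 0 & z6 l != 0]].
Proof.
by have := adm_z hl => /= /and5P[-> -> -> -> /and3P[-> ->]].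
Qed.

Lemma PpolE z : (Ppol u l).[z] =
  (z - z1 l) * (z - u ^+ 2 / z2 l) * (z - z3 l) * (z - u ^+ 2 / z4 l) *
  (z - z5 l) * (z - u ^+ 2 / z6 l).
Proof. by rewrite /Ppol !hornerM !hornerXsubC. Qed.

Lemma QpolE z : (Qpol u l).[z] =
  ((z1 l * z3 l * z5 l) / (z2 l * z4 l * z6 l)) *
  ((z - u ^+ 2 / z1 l) * (z - z2 l) * (z - u ^+ 2 / z3 l) * (z - z4 l) *
  (z - u ^+ 2 / z5 l) * (z - z6 l)).
Proof. by rewrite /Qpol hornerZ !hornerM !hornerXsubC. Qed.

(** The involution carries the zeros of P to those of Q, and the constants collected from the six
    factors give the leading coefficient of Q. *)
Lemma PQ_reflect z : z != 0 -> z ^+ 6 * (Ppol u l).[u ^+ 2 / z] = u ^+ 6 * (Qpol u l).[z].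
Proof.
move=> zn; have [n1 n2 n3 [n4 n5 n6]] := adm_zn.
have E a : a != 0 -> u ^+ 2 / z - a = - (a / z) * (z - u ^+ 2 / a).
  by move=> an; field; rewrite zn an.
have E' a : a != 0 -> u ^+ 2 / z - u ^+ 2 / a = - (u ^+ 2 / (a * z)) * (z - a).
  by move=> an; field; rewrite zn an.
rewrite PpolE QpolE (E (z1 l)) // (E (z3 l)) // (E (z5 l)) //.
rewrite (E' (z2 l)) // (E' (z4 l)) // (E' (z6 l)) //.
move: (z - _) (z - _) (z - _) (z - _) (z - _) (z - _) => a1 a2 a3 a4 a5 a6.
by field; rewrite zn n2 n4 n6.
Qed.

Lemma Ppol_neq0 : Ppol u l != 0.
Proof. by rewrite /Ppol !mulf_neq0 // polyXsubC_eq0. Qed.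

Lemma Qpol_neq0 : Qpol u l != 0.
Proof.
have [n1 n2 n3 [n4 n5 n6]] := adm_zn.
rewrite /Qpol -mul_polyC !mulf_neq0 ?polyXsubC_eq0 // polyC_eq0.
by rewrite !mulf_neq0 ?invr_eq0 ?mulf_neq0.
Qed.

Lemma Ppol_u_neq0 : (Ppol u l).[u] != 0 /\ (Ppol u l).[- u] != 0.
Proof.
have [n1 n2 n3 [n4 n5 n6]] := adm_zn.
have /= := adm_u hl => /and5P[/andP[a1 b1] /andP[a2 b2] /andP[a3 b3] /andP[a4 b4] /and3P[/andP[a5 b5] /andP[a6 b6] _]].
have E a : a != 0 -> a != u -> u - u ^+ 2 / a != 0.
  move=> an au; rewrite (_ : _ - _ = u / a * (a - u)); last by field.
  by rewrite !mulf_neq0 ?invr_eq0 // subr_eq0.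
have E' a : a != 0 -> a != - u -> - u - u ^+ 2 / a != 0.
  move=> an au; rewrite (_ : _ - _ = - u / a * (a - - u)); last by field.
  by rewrite !mulf_neq0 ?invr_eq0 ?oppr_eq0 // subr_eq0.
by split; rewrite PpolE !mulf_neq0 ?E ?E' // subr_eq0 eq_sym.
Qed.

Definition conn_at b11 b12 c b22 (z : F) : 'M[F]_2 :=
  (Ppol u l).[z]^-1 *: mx2 b11.[z] (b12.[z] / z) (z * c.[z]) b22.[z].

Lemma conn_mxE b11 b12 b21 b22 :
  conn_mx u l b11 b12 b21 b22 =
  mx2 ((of_poly (Ppol u l))^-1 * of_poly b11)
      ((of_poly (Ppol u l))^-1 * (of_poly b12 / var))
      ((of_poly (Ppol u l))^-1 * of_poly b21)
      ((of_poly (Ppol u l))^-1 * of_poly b22).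
Proof. exact: scale_mx2. Qed.

Lemma conn_value b11 b12 c b22 z : z != 0 -> (Ppol u l).[z] != 0 ->
  mx_has_value (conn_mx u l b11 b12 ('X * c) b22) z (conn_at b11 b12 c b22 z).
Proof.
move=> zn Pz; rewrite conn_mxE /conn_at scale_mx2.
have hP : has_value (of_poly (Ppol u l))^-1 z (Ppol u l).[z]^-1.
  by apply: has_valueV => //; exact: has_value_poly.
apply: mx2P; rewrite !mxE /=; apply: has_valueM => //.
- exact: has_value_poly.
- by apply: has_value_div => //; [exact: has_value_poly|exact: has_value_var].
- rewrite (_ : z * c.[z] = ('X * c).[z]); last by rewrite hornerM hornerX.
  exact: has_value_poly.
- exact: has_value_poly.
Qed.

Lemma cofinite_good :
  cofinite (fun z => [/\ z != 0, (Ppol u l).[z] != 0, (Qpol u l).[z] != 0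
                     & (Ppol u l).[u ^+ 2 / z] != 0]).
Proof.
exists ('X * (Ppol u l * Qpol u l)).
  by apply: mulf_neq0; [rewrite polyX_eq0|apply: mulf_neq0; [apply: Ppol_neq0|apply: Qpol_neq0]].
move=> z; rewrite hornerM hornerX mulf_eq0 negb_or => /andP[zn].
rewrite hornerM mulf_eq0 negb_or => /andP[Pz Qz]; split=> //.
apply/eqP => P0; have := PQ_reflect zn; rewrite P0 mulr0 => /esym/eqP.
by rewrite mulf_eq0 expf_eq0 (negbTE un) (negbTE Qz) andbF.
Qed.

Lemma has_value_mul_mx (A B : 'M[ratfun F]_2) (M N : 'M[F]_2) z :
  mx_has_value A z M -> mx_has_value B z N -> mx_has_value (A *m B) z (M *m N).
Proof.
by move=> hA hB i j; rewrite !mxE; apply: has_value_sum => k; apply: has_valueM.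
Qed.

Lemma has_value_det (A : 'M[ratfun F]_2) (M : 'M[F]_2) z :
  mx_has_value A z M -> has_value (\det A) z (\det M).
Proof.
move=> h; rewrite (mx2_eta A) (mx2_eta M) !det_mx2.
by apply: has_valueD; [|apply: has_valueN]; apply: has_valueM; apply: h.
Qed.

Lemma mx_has_value_unique (A : 'M[ratfun F]_2) (M N : 'M[F]_2) z :
  mx_has_value A z M -> mx_has_value A z N -> M = N.
Proof. by move=> h h'; apply/matrixP=> i j; apply: has_value_unique (h i j) (h' i j). Qed.

Lemma mx_eq_values (A B : 'M[ratfun F]_2) :
  cofinite (fun z => exists2 M, mx_has_value A z M & mx_has_value B z M) -> A = B.
Proof.
move=> h; apply/matrixP=> i j; apply: ratfun_eq_values.
by apply: cofinite_imp h => z [M hA hB]; exists (M i j).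
Qed.

Lemma mx_has_value_subst s (A : 'M[ratfun F]_2) (M : 'M[F]_2) z w :
  transcendental s -> has_value s z w -> mx_has_value A w M ->
  mx_has_value (subst_mx s A) z M.
Proof. by move=> hs sz h i j; rewrite mxE; apply: has_value_subst (h i j). Qed.

Lemma det_conn_at b11 b12 c b22 z : z != 0 -> (Ppol u l).[z] != 0 ->
  \det (conn_at b11 b12 c b22 z) =
  (b11 * b22 - b12 * c).[z] / ((Ppol u l).[z] * (Ppol u l).[z]).
Proof.
move=> zn; rewrite /conn_at; move: (Ppol u l).[z] => Pz Pzn.
rewrite scale_mx2 det_mx2 hornerD hornerN !hornerM.
by field; rewrite zn Pzn.
Qed.

Lemma det_conn_iff b11 b12 c b22 :
  \det (conn_mx u l b11 b12 ('X * c) b22) = of_poly (Qpol u l) / of_poly (Ppol u l)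
  <-> b11 * b22 - b12 * c = Ppol u l * Qpol u l.
Proof.
split=> E.
  apply: poly_eq_cofinite; apply: cofinite_imp cofinite_good => z [zn Pz _ _].
  have := has_value_det (conn_value b11 b12 c b22 zn Pz); rewrite E det_conn_at //.
  move=> h1; have h2 : has_value (of_poly (Qpol u l) / of_poly (Ppol u l)) z
      ((Qpol u l).[z] / (Ppol u l).[z]) by exists (Qpol u l), (Ppol u l).
  have /eqP := has_value_unique h1 h2.
  rewrite eqr_div ?mulf_neq0 // => /eqP E2.
  by apply: (mulIf Pz); rewrite E2 (hornerM (Ppol u l)); ring.
apply: ratfun_eq_values; apply: cofinite_imp cofinite_good => z [zn Pz _ _].
exists ((Qpol u l).[z] / (Ppol u l).[z]); last by exists (Qpol u l), (Ppol u l).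
have := has_value_det (conn_value b11 b12 c b22 zn Pz); rewrite det_conn_at // E.
by rewrite (hornerM (Ppol u l)) -mulf_div divff // mul1r.
Qed.

Section Involution.
Variables b11 b12 c b22 : {poly F}.
Hypothesis s11 : (size b11 <= 7)%N.
Hypothesis s12 : (size b12 <= 9)%N.
Hypothesis sc : (size c <= 5)%N.
Hypothesis s22 : (size b22 <= 7)%N.
Hypothesis hdet : b11 * b22 - b12 * c = Ppol u l * Qpol u l.
Let A := conn_mx u l b11 b12 ('X * c) b22.

Lemma invmx_conn_at z : z != 0 -> (Ppol u l).[z] != 0 -> (Qpol u l).[z] != 0 ->
  invmx (conn_at b11 b12 c b22 z) =
  (Qpol u l).[z]^-1 *: mx2 b22.[z] (- (b12.[z] / z)) (- (z * c.[z])) b11.[z].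
Proof.
have := congr1 (fun p => p.[z]) hdet.
rewrite (hornerM (Ppol u l)) /conn_at; move: (Ppol u l).[z] (Qpol u l).[z] => P Q.
rewrite hornerD hornerN !hornerM => E zn Pn Qn; apply: invmx_unique.
have E1 : (b11.[z] * b22.[z] - b12.[z] * c.[z]) / (P * Q) = 1.
  by rewrite E divff // mulf_neq0.
rewrite -scalemxAl -scalemxAr scalerA mul_mx2 scale_mx2 mx2_scalar; congr mx2.
- by rewrite -E1; field; rewrite ?zn Pn Qn.
- by field; rewrite ?zn Pn Qn.
- by field; rewrite ?zn Pn Qn.
- by rewrite -E1; field; rewrite ?zn Pn Qn.
Qed.

Lemma conn_at_reflect z : z != 0 -> (Ppol u l).[u ^+ 2 / z] != 0 ->
  conn_at b11 b12 c b22 (u ^+ 2 / z) =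
  (u ^+ 6 * (Qpol u l).[z])^-1 *: mx2 (z ^+ 6 * b11.[u ^+ 2 / z])
    (z ^+ 7 * b12.[u ^+ 2 / z] / u ^+ 2) (z ^+ 5 * u ^+ 2 * c.[u ^+ 2 / z])
    (z ^+ 6 * b22.[u ^+ 2 / z]).
Proof.
move=> zn; rewrite -PQ_reflect // /conn_at.
move: (Ppol u l).[_] => P Pn; rewrite !scale_mx2.
by congr mx2; field; rewrite ?zn ?Pn ?un.
Qed.

Lemma invmx_eq_mul (B : 'M[ratfun F]_2) : \det A = of_poly (Qpol u l) / of_poly (Ppol u l) ->
  B = invmx A <-> A *m B = 1%:M.
Proof.
move=> hA; have uA : A \in unitmx.
  rewrite unitmxE unitfE hA; apply: mulf_neq0.
    by rewrite of_poly_eq0; apply: Qpol_neq0.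
  by rewrite invr_eq0 of_poly_eq0; apply: Ppol_neq0.
by split=> [->|/invmx_unique->//]; rewrite mulmxV.
Qed.

Lemma subst_conn_value z : z != 0 -> (Ppol u l).[u ^+ 2 / z] != 0 ->
  mx_has_value (subst_mx (uinv u) A) z (conn_at b11 b12 c b22 (u ^+ 2 / z)).
Proof.
move=> zn Pz; apply: mx_has_value_subst.
- exact: transcendental_uinv.
- exact: has_value_uinv.
- by apply: conn_value => //; rewrite mulf_neq0 ?invr_eq0 ?expf_neq0.
Qed.

(** The adjugate exchanges the diagonal entries and negates the others, hence the signs. The
    relation for [b22] is that for [b11] read at u^2/z, so three equations suffice. *)
Lemma involution_iff : subst_mx (uinv u) A = invmx A <->
  [/\ recip u 6 b11 = u ^+ 6 *: b22, recip u 4 c = - u ^+ 4 *: c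
        & recip u 8 b12 = - u ^+ 8 *: b12].
Proof.
have hA : \det A = of_poly (Qpol u l) / of_poly (Ppol u l) by apply/det_conn_iff.
rewrite (invmx_eq_mul _ hA); split=> [E|[E1 E2 E3]].
  have H z : [/\ z != 0, (Ppol u l).[z] != 0, (Qpol u l).[z] != 0
                     & (Ppol u l).[u ^+ 2 / z] != 0] ->
    [/\ z ^+ 6 * b11.[u ^+ 2 / z] = u ^+ 6 * b22.[z],
        z ^+ 4 * c.[u ^+ 2 / z] = - u ^+ 4 * c.[z]
      & z ^+ 8 * b12.[u ^+ 2 / z] = - u ^+ 8 * b12.[z]].
    move=> [zn Pz Qz Pz'].
    have h1 := has_value_mul_mx (conn_value b11 b12 c b22 zn Pz) (subst_conn_value zn Pz').
    have h2 : mx_has_value (A *m subst_mx (uinv u) A) z 1%:M.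
      rewrite E => i j; rewrite !mxE; case: (i == j) => /=; first exact: has_value1.
      exact: has_value0.
    have := invmx_unique (mx_has_value_unique h1 h2).
    rewrite invmx_conn_at // conn_at_reflect //; move: (Qpol u l).[z] Qz => Q Qn.
    rewrite !scale_mx2 => /mx2_inj[e1 e2 e3 _].
    have Un : u ^+ 6 * Q != 0 by rewrite mulf_neq0 ?expf_neq0.
    split.
    - by apply: (mulfI (invr_neq0 Un)); rewrite -e1; field; rewrite un Qn.
    - have Vn : z * u ^+ 2 / (u ^+ 6 * Q) != 0 by rewrite !mulf_neq0 ?invr_eq0 ?expf_neq0.
      apply: (mulfI Vn); have -> : z * u ^+ 2 / (u ^+ 6 * Q) * (z ^+ 4 * c.[u ^+ 2 / z]) =
         (u ^+ 6 * Q)^-1 * (z ^+ 5 * u ^+ 2 * c.[u ^+ 2 / z]) by ring.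
      by rewrite -e3; field; rewrite un Qn.
    - have Vn : (z * u ^+ 2)^-1 / (u ^+ 6 * Q) != 0 by rewrite !mulf_neq0 ?invr_eq0 ?mulf_neq0 ?expf_neq0.
      apply: (mulfI Vn); have -> : (z * u ^+ 2)^-1 / (u ^+ 6 * Q) * (z ^+ 8 * b12.[u ^+ 2 / z]) =
         (u ^+ 6 * Q)^-1 * (z ^+ 7 * b12.[u ^+ 2 / z] / u ^+ 2).
        by field; rewrite zn un Qn.
      by rewrite -e2; field; rewrite un zn Qn.
  split; apply: recip_eq => //; apply: cofinite_imp cofinite_good => z /H[e1 e2 e3];
    by rewrite hornerZ.
apply: mx_eq_values; apply: cofinite_imp cofinite_good => z [zn Pz Qz Pz'].
exists 1%:M; last first.
  by move=> i j; rewrite !mxE; case: (i == j) => /=; [exact: has_value1|exact: has_value0].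
have h1 := has_value_mul_mx (conn_value b11 b12 c b22 zn Pz) (subst_conn_value zn Pz').
suff <- : conn_at b11 b12 c b22 z *m conn_at b11 b12 c b22 (u ^+ 2 / z) = 1%:M by [].
have -> : conn_at b11 b12 c b22 (u ^+ 2 / z) = invmx (conn_at b11 b12 c b22 z).
  rewrite invmx_conn_at // conn_at_reflect //.
  have wn : u ^+ 2 / z != 0 by rewrite mulf_neq0 ?invr_eq0 ?expf_neq0.
  have e1 := recipE u s11 zn; have e2 := recipE u sc zn; have e3 := recipE u s12 zn.
  have e4 := recipE u s11 wn; rewrite E1 E2 E3 !hornerZ in e1 e2 e3 e4.
  rewrite (_ : u ^+ 2 / (u ^+ 2 / z) = z) in e4; last by field; rewrite un zn.
  move: (Qpol u l).[z] Qz => Q Qn; rewrite !scale_mx2; congr mx2.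
  - by rewrite -e1; field; rewrite un Qn.
  - rewrite (_ : z ^+ 7 * _ / _ = z ^+ 8 * b12.[u ^+ 2 / z] / (z * u ^+ 2)); last by field; rewrite un zn.
    by rewrite -e3; field; rewrite un Qn zn.
  - rewrite (_ : z ^+ 5 * _ * _ = z * u ^+ 2 * (z ^+ 4 * c.[u ^+ 2 / z])); last by ring.
    by rewrite -e2; field; rewrite un Qn.
  - have -> : b22.[u ^+ 2 / z] = (u ^+ 2 / z) ^+ 6 * b11.[z] / u ^+ 6.
      by apply: (mulIf (expf_neq0 6 un)); rewrite divfK ?expf_neq0 // -e4 mulrC.
    by field; rewrite un Qn zn.
apply: mulmxV; rewrite unitmxE unitfE det_conn_at // hdet (hornerM (Ppol u l)).
by rewrite !mulf_neq0 ?invr_eq0 ?mulf_neq0.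
Qed.

End Involution.

End Fixed.
End PolynomialConnections.

(** * Connections characterized by polynomial identities *)

Section ConnectionP.
Variable F : closedFieldType.
Variables u q : F.
Hypothesis un : u != 0.
Hypothesis qn : q != 0.
Hypothesis u2n : u != - u.
Variable l : param F.
Hypothesis hl : admissible u q l.
Implicit Types (b c : {poly F}) (A : 'M[ratfun F]_2).

Lemma coefM_top (p r : {poly F}) m n : (size p <= m.+1)%N -> (size r <= n.+1)%N ->
  (p * r)`_(m + n) = p`_m * r`_n.
Proof.
move=> hp hr; rewrite coefM.
rewrite (bigD1 (inord m : 'I_(m + n).+1)) //= inordK ?ltnS ?leq_addr // addKn.
rewrite big1 ?addr0 // => i; rewrite -val_eqE /= inordK ?ltnS ?leq_addr //.
rewrite neq_ltn => /orP[im|mi]; last by rewrite nth_default ?mul0r // (leq_trans hp).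
by rewrite mulrC nth_default ?mul0r // (leq_trans hr) // ltn_subRL ltn_add2r.
Qed.

Lemma Ppol_size : size (Ppol u l) = 7.
Proof.
have -> : Ppol u l = \prod_(z <- [:: z1 l; u ^+ 2 / z2 l; z3 l; u ^+ 2 / z4 l; z5 l;
    u ^+ 2 / z6 l]) ('X - z%:P).
  by rewrite !big_cons big_nil mulr1 /Ppol !mulrA.
exact: size_prod_XsubC.
Qed.

Lemma Ppol_monic : Ppol u l \is monic.
Proof. by rewrite /Ppol !monicMl ?monicXsubC. Qed.

Lemma Ppol_coef6 : (Ppol u l)`_6 = 1.
Proof. by have /monicP := Ppol_monic; rewrite lead_coefE Ppol_size. Qed.

Lemma Qpol_size : (size (Qpol u l) <= 7)%N.
Proof.
rewrite /Qpol (leq_trans (size_scale_leq _ _)) //.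
have -> : ('X - (u ^+ 2 / z1 l)%:P) * ('X - (z2 l)%:P) *
   ('X - (u ^+ 2 / z3 l)%:P) * ('X - (z4 l)%:P) *
   ('X - (u ^+ 2 / z5 l)%:P) * ('X - (z6 l)%:P) =
  \prod_(z <- [:: u ^+ 2 / z1 l; z2 l; u ^+ 2 / z3 l; z4 l; u ^+ 2 / z5 l; z6 l])
    ('X - z%:P).
  by rewrite !big_cons big_nil mulr1 !mulrA.
by rewrite size_prod_XsubC.
Qed.

Lemma Qpol_coef6 : (Qpol u l)`_6 = z1 l * z3 l * z5 l / (z2 l * z4 l * z6 l).
Proof.
rewrite /Qpol coefZ.
have -> : ('X - (u ^+ 2 / z1 l)%:P) * ('X - (z2 l)%:P) *
   ('X - (u ^+ 2 / z3 l)%:P) * ('X - (z4 l)%:P) *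
   ('X - (u ^+ 2 / z5 l)%:P) * ('X - (z6 l)%:P) =
  \prod_(z <- [:: u ^+ 2 / z1 l; z2 l; u ^+ 2 / z3 l; z4 l; u ^+ 2 / z5 l; z6 l])
    ('X - z%:P).
  by rewrite !big_cons big_nil mulr1 !mulrA.
set p := \prod_(_ <- _) _; have /monicP : p \is monic by apply: monic_prod_XsubC.
by rewrite lead_coefE size_prod_XsubC /= => ->; rewrite mulr1.
Qed.

Lemma minus_rho_prod : minus_rho1 l * minus_rho2 q l =
  z1 l * z3 l * z5 l / (z2 l * z4 l * z6 l) / q.
Proof.
have [n1 n2 n3 [n4 n5 n6]] := adm_zn hl; have dn := adm_d hl.
by rewrite /minus_rho1 /minus_rho2; field; rewrite n2 n4 n6 dn qn.
Qed.

Let tw := @transcendental_winv F.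
Let vn := @var_neq0 F.

Lemma twisted_entries (K : fieldType) (s s' P a b v c d : K) :
  s != 0 -> v != 0 -> P != 0 ->
  mx2 1 0 0 s' *m (P^-1 *: mx2 a (b / v) c d) *m mx2 1 0 0 s^-1 =
  mx2 ((a / v ^+ 6) / (P / v ^+ 6)) ((b / v ^+ 8) / (P / v ^+ 6) / (s / v))
      ((s' / v) * ((c / v ^+ 5) / (P / v ^+ 6)))
      ((s' / s) * ((d / v ^+ 6) / (P / v ^+ 6))).
Proof.
move=> sn vn' Pn; rewrite scale_mx2 !mul_mx2.
by congr mx2; field; rewrite ?sn ?vn' ?Pn.
Qed.

Lemma has_limit_coef (p : {poly F}) n : (size p <= n.+1)%N ->
  has_limit (of_poly p / var ^+ n) p`_n.
Proof.
move=> hp; rewrite -polyat_var; apply: (has_limit_polyat tw) hp; first exact: vn.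
exact: has_limit_var_inv tw.
Qed.

Lemma invmx_diag1 (K : fieldType) (w : K) : w != 0 ->
  invmx (mx2 1 0 0 w) = mx2 1 0 0 w^-1.
Proof.
move=> wn; apply: invmx_unique; rewrite mul_mx2 mx2_scalar.
by congr mx2; field.
Qed.

Lemma invmx_Smx (w : ratfun F) : w != 0 -> invmx (Smx w) = mx2 1 0 0 w^-1.
Proof. exact: invmx_diag1. Qed.

(** The two factors q^-1 are the limits of sigma(z/q)/z and of sigma(z/q)/sigma(z). *)
Lemma conn_twisted_limit b11 b12 c b22 :
  (size b11 <= 7)%N -> (size b12 <= 9)%N -> (size c <= 5)%N -> (size b22 <= 7)%N ->
  mx_has_limit (Smx (sigma_zq u q) *m conn_mx u l b11 b12 ('X * c) b22
                *m invmx (Smx (sigma_z u q)))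
    (mx2 b11`_6 b12`_8 (c`_4 / q) (b22`_6 / q)).
Proof.
move=> h11 h12 hc h22.
have sn := sigma_z_neq0 u qn.
have Pn : of_poly (Ppol u l) != 0 by rewrite of_poly_eq0; apply: Ppol_neq0.
rewrite (invmx_Smx sn) /conn_mx /Smx (twisted_entries _ _ _ _ _ sn vn Pn).
have hP : has_limit (of_poly (Ppol u l) / var ^+ 6) 1.
  by rewrite -Ppol_coef6; apply: has_limit_coef; rewrite Ppol_size.
have hd (p : {poly F}) n : (size p <= n.+1)%N ->
    has_limit (of_poly p / var ^+ n / (of_poly (Ppol u l) / var ^+ 6)) p`_n.
  move=> hp; rewrite -[p`_n]divr1; apply: (has_limit_div tw (oner_neq0 F)) => //.
  exact: has_limit_coef.
have hXc : ('X * c)`_5 = c`_4 by rewrite coefXM.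
have hsX : (size ('X * c)%R <= 6)%N.
  have [->|cn] := eqVneq c 0; first by rewrite mulr0 size_poly0.
  by rewrite mulrC size_mulX.
apply: mx2P; rewrite !mxE /=.
- exact: hd.
- rewrite -[b12`_8]divr1; apply: (has_limit_div tw (oner_neq0 F)); first exact: hd.
  exact: has_limit_sigma_z_var.
- rewrite -hXc [X in has_limit _ X]mulrC; apply: (has_limitM tw); last exact: hd.
  exact: has_limit_sigma_zq_var.
- rewrite [X in has_limit _ X]mulrC; apply: (has_limitM tw); last exact: hd.
  exact: has_limit_sigma_ratio.
Qed.

(** At a fixed point of the involution the antisymmetric entries vanish, the characteristic not
    being 2, and [b22] equals [b11]. The normalization is thus a single equation on [b11]. *)
Lemma conn_at_fixed b11 b12 c b22 v :
  (size b11 <= 7)%N -> (size b12 <= 9)%N -> (size c <= 5)%N -> (size b22 <= 7)%N ->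
  [/\ recip u 6 b11 = u ^+ 6 *: b22, recip u 4 c = - u ^+ 4 *: c
    & recip u 8 b12 = - u ^+ 8 *: b12] ->
  v ^+ 2 = u ^+ 2 -> v != 0 -> (Ppol u l).[v] != 0 -> b11.[v] = (Ppol u l).[v] ->
  conn_at u l b11 b12 c b22 v = 1%:M.
Proof.
move=> h11 h12 hc h22 [e1 e2 e3] vu vn0 Pv bP.
have E1 := recipE u h11 vn0; have E2 := recipE u hc vn0; have E3 := recipE u h12 vn0.
have vv : u ^+ 2 / v = v by rewrite -vu expr2 mulfK.
have even n : v ^+ (2 * n) = u ^+ (2 * n) by rewrite !exprM vu.
rewrite e1 vv (even 3) hornerZ in E1; rewrite e2 vv (even 2) hornerZ in E2.
rewrite e3 vv (even 4) hornerZ in E3.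
have H n (x : F) : - u ^+ n * x = u ^+ n * x -> x = 0.
  move/eqP; rewrite -subr_eq0 mulNr -opprD oppr_eq0 -mulrDr mulf_eq0 expf_eq0.
  rewrite (negbTE un) andbF /= -mulr2n -mulr_natr mulf_eq0 => /orP[/eqP//|].
  have two : 2%:R != 0 :> F.
    by apply: contraNneq u2n => h; rewrite -subr_eq0 opprK -mulr2n -mulr_natr h mulr0.
  by rewrite (negbTE two).
rewrite /conn_at scale_mx2 (H _ _ E2) (H _ _ E3) mul0r mulr0.
have -> : b22.[v] = b11.[v] by apply: (mulfI (expf_neq0 6 un)).
by rewrite bP mx2_scalar !mulr0 mulVf.
Qed.

(** The asymptotic condition reduces to the trace of the limit: the determinant of the limit already
    follows from that of A, and the eigenvalues are distinct. *)
Lemma connectionP A : is_connection u q l A <->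
  exists b11 b12 c b22, poly_conn u q l b11 b12 c b22 /\
    A = conn_mx u l b11 b12 ('X * c) b22.
Proof.
split.
  move=> [[b11 [b12 [b21 [b22 [[h11 h12 h21 h22] b0 AE]]]]] hdet hasym [hinv hu hnu]].
  have [c cE] : exists c, b21 = 'X * c.
    have /factor_theorem[c ->] : root b21 0 by apply/rootP.
    by exists c; rewrite subr0 mulrC.
  have hc : (size c <= 5)%N.
    move: h21; rewrite cE; have [->|cn] := eqVneq c 0; first by rewrite size_poly0.
    by rewrite mulrC size_mulX.
  move: AE; rewrite cE => AE; exists b11, b12, c, b22; split=> //.
  have pdet : b11 * b22 - b12 * c = Ppol u l * Qpol u l.
    by apply/(det_conn_iff un hl); rewrite -AE.
  split=> //.
  - by apply/(involution_iff un hl h11 h12 hc pdet); rewrite -AE; exact: hinv.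
  - have [Pu Pnu] := Ppol_u_neq0 un hl.
    have H z : z != 0 -> (Ppol u l).[z] != 0 -> mx_has_value A z 1%:M ->
        b11.[z] = (Ppol u l).[z].
      move=> zn Pz hA; rewrite AE in hA.
      have := mx_has_value_unique hA (conn_value b11 b12 c b22 zn Pz).
      rewrite /conn_at scale_mx2 mx2_scalar => /mx2_inj[e _ _ _].
      by rewrite -[LHS](mulVKf Pz) -e mulr1.
    by split; apply: H; rewrite ?oppr_eq0.
  have [M [G [hM uG GM]]] := hasym; rewrite AE in hM.
  have ME := mx_has_limit_unique hM (conn_twisted_limit h11 h12 hc h22).
  have := congr1 mxtrace GM; rewrite mxtrace_mulC mulKmx // ME.
  by rewrite /mxtrace !big_ord_recl !big_ord0 !mxE /= !addr0.
move=> [b11 [b12 [c [b22 [[[h11 h12 hc h22] pdet hinv [hu hnu] htr] ->]]]]].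
have hdet := (det_conn_iff un hl b11 b12 c b22).2 pdet.
split=> //.
- exists b11, b12, ('X * c), b22; split=> //; last by rewrite hornerM hornerX mul0r.
  split=> //; have [->|cn] := eqVneq c 0; first by rewrite mulr0 size_poly0.
  by rewrite mulrC size_mulX.
- have [|||G uG GM] := @diagonalize_mx2 F b11`_6 b12`_8 (c`_4 / q) (b22`_6 / q)
     (minus_rho1 l) (minus_rho2 q l); [exact: adm_d12 hl|exact: htr| |].
    rewrite minus_rho_prod !mulrA -mulrBl; congr (_ / _).
    (* The coefficient of degree 12 = 6 + 6 = 8 + 4 in the determinant identity gives the
       determinant of the limit. *)
    have := congr1 (fun p : {poly F} => p`_(6 + 6)) pdet.
    rewrite coefB (coefM_top h11 h22) -[(6 + 6)%N]/(8 + 4)%N (coefM_top h12 hc) => ->.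
    by rewrite -[(8 + 4)%N]/(6 + 6)%N coefM_top ?Ppol_size ?Qpol_size // Ppol_coef6 mul1r Qpol_coef6.
  exists (mx2 b11`_6 b12`_8 (c`_4 / q) (b22`_6 / q)), G; split=> //.
  exact: conn_twisted_limit.
split.
- exact: (involution_iff un hl h11 h12 hc pdet).2 hinv.
- have [Pu _] := Ppol_u_neq0 un hl.
  have <- : conn_at u l b11 b12 c b22 u = 1%:M.
    by apply: (conn_at_fixed h11 h12 hc h22 hinv _ un Pu).
  exact: conn_value.
have [_ Pu] := Ppol_u_neq0 un hl.
have un' : - u != 0 by rewrite oppr_eq0.
have <- : conn_at u l b11 b12 c b22 (- u) = 1%:M.
  by apply: (conn_at_fixed h11 h12 hc h22 hinv _ un' Pu) => //; rewrite sqrrN.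
exact: conn_value.
Qed.

End ConnectionP.

Lemma mul_conj_comp (K : fieldType) n (S S' A R R' : 'M[K]_n) :
  R \in unitmx -> R' \in unitmx ->
  S *m (S' *m A *m invmx R') *m invmx R = S *m S' *m A *m invmx (R *m R').
Proof.
move=> uR uR'; have -> : invmx (R *m R') = invmx R' *m invmx R.
  have uRR : R *m R' \in unitmx by rewrite unitmx_mul uR.
  apply: (can_inj (mulKmx uRR)); rewrite mulmxV // mulmxA mulmxK //.
  by rewrite mulmxV.
by rewrite !mulmxA.
Qed.

(** * Gauge transformations *)

Section Gauge.
Variable F : closedFieldType.
Variables u q : F.
Hypothesis un : u != 0.
Hypothesis qn : q != 0.
Implicit Types (A R : 'M[ratfun F]_2).

Let ts := transcendental_sigma_z u qn.
Let tsq := transcendental_sigma_zq u qn.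

Section SubstMx.
Variables (s : ratfun F) (hs : transcendental s).

Lemma subst_mxM A R : subst_mx s (A *m R) = subst_mx s A *m subst_mx s R.
Proof. exact: (map_mxM (subst_morph hs)). Qed.

Lemma subst_mx_unit A : (subst_mx s A \in unitmx) = (A \in unitmx).
Proof. exact: (map_unitmx (subst_morph hs)). Qed.

Lemma subst_mx1 : subst_mx s (1%:M : 'M_2) = 1%:M.
Proof. exact: (map_mx1 (subst_morph hs)). Qed.

Lemma subst_mx2 a b c d :
  subst_mx s (mx2 a b c d) = mx2 (subst s a) (subst s b) (subst s c) (subst s d).
Proof. exact: map_mx2. Qed.

End SubstMx.

Lemma gauge_comp R R' A : R \in unitmx -> R' \in unitmx ->
  gauge u q R (gauge u q R' A) = gauge u q (R *m R') A.
Proof.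
move=> uR uR'; rewrite /gauge (subst_mxM tsq) (subst_mxM ts).
by apply: mul_conj_comp; rewrite subst_mx_unit.
Qed.

Lemma gauge1 A : gauge u q 1%:M A = A.
Proof. by rewrite /gauge (subst_mx1 ts) (subst_mx1 tsq) mul1mx invmx1 mulmx1. Qed.

Lemma gauge_inv R A : R \in unitmx -> gauge u q (invmx R) (gauge u q R A) = A.
Proof. by move=> uR; rewrite gauge_comp ?unitmx_inv // mulVmx // gauge1. Qed.

Definition tri (r11 r22 : F) (r12 : {poly F}) : 'M[ratfun F]_2 :=
  mx2 (of_const r11) (of_poly r12) 0 (of_const r22).

Lemma tri_unit r11 r22 r12 : r11 != 0 -> r22 != 0 -> tri r11 r22 r12 \in unitmx.
Proof.
move=> h1 h2; rewrite unitmxE unitfE det_mx2 mulr0 subr0.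
by apply: mulf_neq0; apply: of_const_neq0.
Qed.

Lemma of_constM (a b : F) : of_const (a * b) = of_const a * of_const b.
Proof. exact: rmorphM. Qed.

Lemma of_const1 : of_const 1 = 1 :> ratfun F.
Proof. exact: rmorph1. Qed.

Lemma tri_mul r11 r22 r12 s11 s22 s12 :
  tri r11 r22 r12 *m tri s11 s22 s12 =
  tri (r11 * s11) (r22 * s22) (r11 *: s12 + s22 *: r12).
Proof.
rewrite /tri mul_mx2; congr mx2.
- by rewrite mulr0 addr0 of_constM.
- by rewrite of_polyD -!mul_polyC !of_polyM [X in _ = _ + X]mulrC.
- by rewrite mul0r mulr0 addr0.
- by rewrite mul0r add0r of_constM.
Qed.

Lemma tri1 : tri 1 1 0 = 1%:M.
Proof. by rewrite /tri of_const1 of_poly0 mx2_scalar. Qed.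

Lemma gauge_equiv_refl A : gauge_equiv u q A A.
Proof.
exists 1, 1, 0; rewrite oner_neq0 size_poly0; split=> //.
by rewrite -/(tri 1 1 0) tri1 gauge1.
Qed.

Lemma gauge_equiv_trans A B C :
  gauge_equiv u q A B -> gauge_equiv u q B C -> gauge_equiv u q A C.
Proof.
move=> [a1 [a2 [a3 [h1 h2 h3 ->]]]] [b1 [b2 [b3 [k1 k2 k3 ->]]]].
exists (b1 * a1), (b2 * a2), (b1 *: a3 + a2 *: b3); split.
- exact: mulf_neq0.
- exact: mulf_neq0.
- rewrite (leq_trans (size_polyD _ _)) // geq_max.
  by rewrite !(leq_trans (size_scale_leq _ _)).
- rewrite -!/(tri _ _ _) -tri_mul; apply: gauge_comp; exact: tri_unit.
Qed.

Lemma gauge_equiv_sym A B : gauge_equiv u q A B -> gauge_equiv u q B A.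
Proof.
move=> [a1 [a2 [a3 [h1 h2 h3 ->]]]].
exists a1^-1, a2^-1, (- (a1 * a2)^-1 *: a3); split.
- by rewrite invr_eq0.
- by rewrite invr_eq0.
- by rewrite (leq_trans (size_scale_leq _ _)).
rewrite -!/(tri _ _ _) gauge_comp; try by apply: tri_unit; rewrite ?invr_eq0.
rewrite tri_mul !mulVf // scalerA -scalerDl (_ : _ + _ = 0).
  by rewrite scale0r tri1 gauge1.
by field; rewrite h1 h2.
Qed.

Lemma gauge_equiv_modification A B : gauge_equiv u q A B -> modification u q A B.
Proof.
move=> [a1 [a2 [a3 [h1 h2 h3 ->]]]]; exists (tri a1 a2 a3) => //.
exact: tri_unit.
Qed.

Lemma modification_trans A B C :
  modification u q A B -> modification u q B C -> modification u q A C.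
Proof.
move=> [R uR ->] [S uS ->]; exists (S *m R).
  by rewrite unitmx_mul uS uR.
exact: (gauge_comp _ uS uR).
Qed.

Lemma modification_sym A B : modification u q A B -> modification u q B A.
Proof.
move=> [R uR ->]; exists (invmx R).
  by rewrite unitmx_inv.
by rewrite (gauge_inv _ uR).
Qed.

Lemma mx_has_value_inv (A : 'M[ratfun F]_2) (M : 'M[F]_2) z :
  mx_has_value A z M -> M \in unitmx -> mx_has_value (invmx A) z (invmx M).
Proof.
move=> h; rewrite (mx2_eta A) (mx2_eta M) unit_mx2 => uM.
have hd : has_value (A 0 0 * A 1 1 - A 0 1 * A 1 0) z
                    (M 0 0 * M 1 1 - M 0 1 * M 1 0).
  by apply: has_valueD; [|apply: has_valueN]; apply: has_valueM; apply: h.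
have uA : A 0 0 * A 1 1 - A 0 1 * A 1 0 != 0.
  apply/negP => /eqP E; rewrite E in hd.
  by rewrite (has_value_unique hd (has_value0 z)) eqxx in uM.
rewrite (invmx_mx2 uA) (invmx_mx2 uM) !scale_mx2.
have hi := has_valueV uM hd.
by apply: mx2P; rewrite !mxE /=; apply: has_valueM hi _; rewrite ?has_valueN //;
  try apply: has_valueN; apply: h.
Qed.

Lemma gauge_value R A z (Rq R1 M : 'M[F]_2) : z != 0 ->
  mx_has_value R (sig u q (z / q)) Rq -> mx_has_value R (sig u q z) R1 ->
  R1 \in unitmx -> mx_has_value A z M ->
  mx_has_value (gauge u q R A) z (Rq *m M *m invmx R1).
Proof.
move=> zn h1 h2 uR hA; apply: has_value_mul_mx.
  apply: has_value_mul_mx hA; apply: (mx_has_value_subst tsq _ h1).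
  exact: has_value_sigma_zq.
apply: mx_has_value_inv uR; apply: (mx_has_value_subst ts _ h2).
exact: has_value_sigma_z.
Qed.

End Gauge.

(** * Action of the triangular gauge group on polynomial data *)

Section TriangularGauge.
Variable F : closedFieldType.
Variables u q : F.
Hypothesis un : u != 0.
Hypothesis qn : q != 0.
Hypothesis u2n : u != - u.
Variable l : param F.
Hypothesis hl : admissible u q l.

Definition hornerS := (hornerD, hornerN, hornerM, hornerZ, hornerXn, hornerX, hornerC).

Lemma two_neq0 : 2%:R != 0 :> F.
Proof.
by apply: contraNneq u2n => h; rewrite -subr_eq0 opprK -mulr2n -mulr_natr h mulr0.
Qed.

Lemma antisymmetric_root (c : {poly F}) n v : (size c <= (2 * n).+1)%N ->
  recip u (2 * n) c = - u ^+ (2 * n) *: c -> v ^+ 2 = u ^+ 2 -> v != 0 -> c.[v] = 0.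
Proof.
move=> hc ec vu vn; have := recipE u hc vn.
rewrite ec hornerZ -vu expr2 mulfK // !exprM vu => /eqP.
rewrite -subr_eq0 mulNr -opprD oppr_eq0 -mulr2n -mulr_natr mulf_eq0 (negbTE two_neq0).
by rewrite orbF -exprM mulf_eq0 expf_eq0 (negbTE un) andbF => /eqP.
Qed.

Variables r11 r22 : F.
Variable r12 : {poly F}.
Hypothesis n11 : r11 != 0.
Hypothesis n22 : r22 != 0.
Hypothesis s12 : (size r12 <= 2)%N.

(** [rho] and [rho'] are z r12(sigma(z/q)) and z r12(sigma(z)); they are polynomials because r12 has
    degree at most 1. *)
Definition rho : {poly F} :=
  (r12`_1 / q) *: 'X^2 + r12`_0 *: 'X + (r12`_1 * u ^+ 2)%:P.
Definition rho' : {poly F} :=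
  r12`_1 *: 'X^2 + r12`_0 *: 'X + (r12`_1 * u ^+ 2 / q)%:P.

Variables b11 b12 c b22 : {poly F}.

Definition tri11 : {poly F} := b11 + r11^-1 *: (rho * c).
Definition tri22 : {poly F} := b22 - r11^-1 *: (rho' * c).
Definition tri21 : {poly F} := (r22 / r11) *: c.
Definition tri12 : {poly F} :=
  r22^-1 *: (r11 *: b12 + rho * b22 - b11 * rho' - r11^-1 *: (rho * c * rho')).

Lemma horner_r12 z : r12.[z] = r12`_1 * z + r12`_0.
Proof.
by rewrite (horner_coef_wide _ s12) !big_ord_recl big_ord0 /= addr0 expr0 mulr1 addrC expr1.
Qed.

Lemma rhoE z : z != 0 -> rho.[z] = z * r12.[sig u q (z / q)].
Proof.
by move=> zn; rewrite horner_r12 /rho /sig !hornerS; field; rewrite zn qn.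
Qed.

Lemma rho'E z : z != 0 -> rho'.[z] = z * r12.[sig u q z].
Proof.
by move=> zn; rewrite horner_r12 /rho' /sig !hornerS; field; rewrite zn qn.
Qed.

Lemma mx_has_value_tri z : mx_has_value (tri r11 r22 r12) z (mx2 r11 r12.[z] 0 r22).
Proof.
apply: mx2P; rewrite !mxE /=.
- exact: has_value_const.
- exact: has_value_poly.
- exact: has_value0.
- exact: has_value_const.
Qed.

Lemma tri_gauge : gauge u q (tri r11 r22 r12) (conn_mx u l b11 b12 ('X * c) b22) =
  conn_mx u l tri11 tri12 ('X * tri21) tri22.
Proof.
apply: mx_eq_values; apply: cofinite_imp (cofinite_good un hl) => z [zn Pz _ _].
exists (conn_at u l tri11 tri12 tri21 tri22 z); last exact: conn_value.
have uR : r11 * r22 - r12.[sig u q z] * 0 != 0 by rewrite mulr0 subr0 mulf_neq0.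
have uR' : mx2 r11 r12.[sig u q z] 0 r22 \in unitmx by rewrite unit_mx2.
have := gauge_value qn zn (mx_has_value_tri (sig u q (z / q)))
  (mx_has_value_tri (sig u q z)) uR' (conn_value b11 b12 c b22 zn Pz).
rewrite (invmx_mx2 uR); set M := _ *m _ *m _; set N := conn_at _ _ _ _ _ _ _.
suff -> : M = N by [].
have eq1 := rhoE zn; have eq2 := rho'E zn.
rewrite /M /N /conn_at /tri11 /tri12 /tri21 /tri22; move: (Ppol u l).[z] Pz => P Pn.
move: rho rho' eq1 eq2 => r r' eq1 eq2.
rewrite !scale_mx2 !mul_mx2 !hornerS eq1 eq2.
by congr mx2; field; rewrite ?zn ?Pn ?n11 ?n22.
Qed.

Lemma size_rho : (size rho <= 3)%N /\ (size rho' <= 3)%N.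
Proof.
by split; rewrite (leq_trans (size_polyD _ _)) // geq_max (leq_trans (size_polyC_leq1 _)) //
  andbT (leq_trans (size_polyD _ _)) // geq_max !(leq_trans (size_scale_leq _ _)) //
  ?size_polyXn ?size_polyX.
Qed.

Lemma size_mul_bound (p r : {poly F}) m n k : (size p <= m.+1)%N -> (size r <= n.+1)%N ->
  (m + n <= k)%N -> (size (p * r)%R <= k.+1)%N.
Proof.
move=> hp hr hk; rewrite (leq_trans (size_polyMleq _ _)) //.
rewrite -subn1 leq_subLR add1n (leq_trans (leq_add hp hr)) //.
by rewrite addSn addnS !ltnS.
Qed.

Lemma size_add_bound (p r : {poly F}) k :
  (size p <= k)%N -> (size r <= k)%N -> (size (p + r)%R <= k)%N.
Proof. by move=> hp hr; rewrite (leq_trans (size_polyD _ _)) // geq_max hp. Qed.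

Lemma size_scale_bound (p : {poly F}) a k : (size p <= k)%N -> (size (a *: p)%R <= k)%N.
Proof. by move=> hp; rewrite (leq_trans (size_scale_leq _ _)). Qed.

(** The involution exchanges [rho] and [rho'], which preserves the reversals. The values at u and -u
    stay because [c] vanishes there, and the trace stays because the top coefficients of [rho] and
    [rho'] differ by the factor q that weights [b22]. *)
Lemma poly_conn_tri : poly_conn u q l b11 b12 c b22 ->
  poly_conn u q l tri11 tri12 tri21 tri22.
Proof.
move=> [[h11 h12 hc h22] hdet [e1 e2 e3] [hu hnu] htr].
have [sr sr'] := size_rho.
have k11 : (size tri11 <= 7)%N.
  by apply: size_add_bound => //; apply: size_scale_bound; apply: (size_mul_bound sr hc).
have k22 : (size tri22 <= 7)%N.
  apply: size_add_bound => //; rewrite size_polyN; apply: size_scale_bound.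
  exact: (size_mul_bound sr' hc).
have kc : (size tri21 <= 5)%N by apply: size_scale_bound.
have k12 : (size tri12 <= 9)%N.
  have hrc : (size (rho * c)%R <= 7)%N by exact: (size_mul_bound sr hc).
  apply: size_scale_bound; apply: size_add_bound; [apply: size_add_bound; [apply: size_add_bound|]|].
  - exact: size_scale_bound.
  - exact: (size_mul_bound sr h22).
  - rewrite size_polyN; exact: (size_mul_bound h11 sr').
  - rewrite size_polyN; apply: size_scale_bound; exact: (size_mul_bound hrc sr').
have Hrec z : z != 0 -> z ^+ 2 * rho.[u ^+ 2 / z] = u ^+ 2 * rho'.[z] /\
   z ^+ 2 * rho'.[u ^+ 2 / z] = u ^+ 2 * rho.[z].
  by move=> zn; rewrite /rho /rho' !hornerS; split; field; rewrite zn ?qn.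
have cof := cofinite_neq (0 : F).
have H z : z != 0 -> [/\ b11.[u ^+ 2 / z] = u ^+ 6 * b22.[z] / z ^+ 6,
    c.[u ^+ 2 / z] = - u ^+ 4 * c.[z] / z ^+ 4,
    b12.[u ^+ 2 / z] = - u ^+ 8 * b12.[z] / z ^+ 8
  & [/\ b22.[u ^+ 2 / z] = u ^+ 6 * b11.[z] / z ^+ 6,
     rho.[u ^+ 2 / z] = u ^+ 2 * rho'.[z] / z ^+ 2
   & rho'.[u ^+ 2 / z] = u ^+ 2 * rho.[z] / z ^+ 2]].
  move=> zn; have [r1 r2] := Hrec z zn.
  have wn : u ^+ 2 / z != 0 by rewrite mulf_neq0 ?invr_eq0 ?expf_neq0.
  have := recipE u h11 zn; have := recipE u hc zn; have := recipE u h12 zn.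
  have := recipE u h11 wn.
  rewrite (_ : u ^+ 2 / (u ^+ 2 / z) = z); last by field; rewrite un zn.
  rewrite e1 e2 e3 !hornerZ => E4 E3 E2 E1.
  have D n a b : b = z ^+ n * a -> a = b / z ^+ n.
    by move=> ->; rewrite mulrC mulKf // expf_neq0.
  split; [exact: D|exact: D|exact: D|split; [|exact: D (esym r1)|exact: D (esym r2)]].
  by apply: (mulfI (expf_neq0 6 un)); rewrite E4; field; rewrite zn.
split=> //.
- rewrite -hdet; apply: poly_eq_cofinite; apply: cofinite_imp cof => z zn.
  rewrite /tri11 /tri12 /tri21 /tri22; move: (rho) (rho') => r r'; rewrite !hornerS.
  by field; rewrite n11 n22.
- split; apply: recip_eq => //; apply: cofinite_imp cof => z zn;
    have [E1 E2 E3 [E4 E5 E6]] := H z zn;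
    rewrite /tri11 /tri12 /tri21 /tri22; move: (rho) (rho') E5 E6 => r r' E5 E6;
    rewrite !hornerS ?E1 ?E2 ?E3 ?E4 ?E5 ?E6;
    by field; rewrite ?n11 ?n22 ?zn.
- rewrite -hu -hnu /tri11; move: (rho) => r; rewrite !hornerS.
  have c0 : c.[u] = 0 by apply: (antisymmetric_root (n := 2) hc e2).
  have c1 : c.[- u] = 0.
    by apply: (antisymmetric_root (n := 2) hc e2); rewrite ?sqrrN ?oppr_eq0.
  by rewrite c0 c1 !mulr0 !addr0.
- rewrite -htr /tri11 /tri22 !coefD coefN !coefZ.
  rewrite (coefM_top (m := 2) (n := 4) sr hc) (coefM_top (m := 2) (n := 4) sr' hc).
  rewrite /rho /rho' !coefD !coefZ !coefXn !coefX !coefC /=.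
  by field; rewrite n11 qn.
Qed.

End TriangularGauge.

(** * The coordinates (x, y) determine the gauge class *)

Section ClassUniqueness.
Variable F : closedFieldType.
Variables u q : F.
Hypothesis un : u != 0.
Hypothesis qn : q != 0.
Hypothesis u2n : u != - u.
Variable l : param F.
Hypothesis hl : admissible u q l.
Implicit Types (A : 'M[ratfun F]_2).

Lemma is_connection_gauge A A' :
  is_connection u q l A -> gauge_equiv u q A A' -> is_connection u q l A'.
Proof.
move=> /(connectionP un qn u2n hl)[b11 [b12 [c [b22 [hb ->]]]]].
move=> [r11 [r22 [r12 [n11 n22 s12 ->]]]]; apply/(connectionP un qn u2n hl).
rewrite -/(tri r11 r22 r12) (tri_gauge un qn hl n11 n22 s12).
by do 4 eexists; split; [exact: (poly_conn_tri un qn u2n r12 n11 n22 hb)|].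
Qed.

Lemma conn_mx_inj b11 b12 b21 b22 b11' b12' b21' b22' :
  conn_mx u l b11 b12 b21 b22 = conn_mx u l b11' b12' b21' b22' ->
  [/\ b11 = b11', b12 = b12', b21 = b21' & b22 = b22'].
Proof.
have Pn : (of_poly (Ppol u l))^-1 != 0 by rewrite invr_eq0 of_poly_eq0; apply: Ppol_neq0.
have vn : (var : ratfun F)^-1 != 0 by rewrite invr_eq0; apply: var_neq0.
rewrite !conn_mxE => /mx2_inj[/(mulfI Pn)/of_poly_inj-> /(mulfI Pn)/(mulIf vn)/of_poly_inj->].
by move=> /(mulfI Pn)/of_poly_inj-> /(mulfI Pn)/of_poly_inj->.
Qed.

(** [b22] is the reversal of [b11], and the determinant then yields [b12] upon division by [c]. *)
Lemma poly_conn_determined b11 b12 b12' c b22 b22' : c != 0 ->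
  poly_conn u q l b11 b12 c b22 -> poly_conn u q l b11 b12' c b22' ->
  b12 = b12' /\ b22 = b22'.
Proof.
move=> cn [_ d1 [e1 _ _] _ _] [_ d2 [e2 _ _] _ _].
have E : b22 = b22'.
  by apply: (scalerI (expf_neq0 6 un)); rewrite -e1 -e2.
split=> //; apply: (mulIf cn); rewrite -E -d1 in d2.
by apply: oppr_inj; apply: (addrI (b11 * b22)).
Qed.

Definition xpol (t : F) : {poly F} :=
  ('X^2 - (u ^+ 2)%:P) * ('X - t%:P) * ('X - (u ^+ 2 / t)%:P).

Lemma xpolE t z : (xpol t).[z] = (z ^+ 2 - u ^+ 2) * (z - t) * (z - u ^+ 2 / t).
Proof. by rewrite /xpol !hornerS. Qed.

Lemma xpol_roots t : xpol t = \prod_(z <- [:: u; - u; t; u ^+ 2 / t]) ('X - z%:P).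
Proof.
rewrite !big_cons big_nil mulr1 /xpol !mulrA; congr (_ * _ * _).
by rewrite polyCN polyC_exp; ring.
Qed.

Lemma xpol_monic t : xpol t \is monic.
Proof. by rewrite xpol_roots monic_prod_XsubC. Qed.

Lemma xpol_size t : size (xpol t) = 5.
Proof. by rewrite xpol_roots size_prod_XsubC. Qed.

Lemma has_coordsP A x y : is_connection u q l A -> has_coords u q l A x y ->
  exists (b11 b12 b22 : {poly F}) (t : F),
    let p := b11.[t] / (Ppol u l).[t] in
    [/\ poly_conn u q l b11 b12 (xpol t) b22,
        gauge_equiv u q A (conn_mx u l b11 b12 ('X * xpol t) b22),
        t != 0 /\ (Ppol u l).[t] != 0,
        p * u - t != 0 & x = t + u ^+ 2 / t /\ y = (p * t - u) / (p * u - t)].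
Proof.
move=> hA [b11 [b12 [b21 [b22 [t [hg [tn cE] [Pt pt] xE yE]]]]]].
have cE' : b21 = 'X * xpol t by rewrite cE /xpol !mulrA.
exists b11, b12, b22, t; split=> //; last by rewrite -cE'.
have /(connectionP un qn u2n hl)[a11 [a12 [a [a22 [ha E]]]]] := is_connection_gauge hA hg.
move: E; rewrite cE' => /conn_mx_inj[-> -> E ->].
have Xn : ('X : {poly F}) != 0 by rewrite polyX_eq0.
by have /(mulfI Xn)-> := E.
Qed.

(** At a zero of [c] the matrix is triangular, so b11 b22 = P Q there; reversing [b22] gives the
    involution (t, p) -> (u^2/t, 1/p). *)
Lemma reflected_value b11 b12 c b22 t p : poly_conn u q l b11 b12 c b22 ->
  t != 0 -> (Ppol u l).[t] != 0 -> (Qpol u l).[t] != 0 -> c.[t] = 0 ->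
  b11.[t] = p * (Ppol u l).[t] ->
  p != 0 /\ b11.[u ^+ 2 / t] = (Ppol u l).[u ^+ 2 / t] / p.
Proof.
move=> [[h11 _ _ _] hd [e1 _ _] _ _] tn Pt Qt ct bt.
have := congr1 (fun p => p.[t]) hd.
rewrite (hornerM (Ppol u l)) hornerD hornerN !(hornerM b11, hornerM b12) ct mulr0 subr0 bt => E.
have pn : p != 0.
  apply/negP => /eqP p0; move/eqP: E; rewrite p0 !mul0r eq_sym mulf_eq0.
  by rewrite (negbTE Pt) (negbTE Qt).
split=> //; have b22E : b22.[t] = (Qpol u l).[t] / p.
  by apply: (mulfI (mulf_neq0 pn Pt)); rewrite E; move: (Ppol _ _).[_] (Qpol _ _).[_] => P Q; field; rewrite pn.
have := recipE u h11 tn; rewrite e1 hornerZ b22E mulrA -(PQ_reflect hl) // -mulrA => /esym.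
exact: (mulfI (expf_neq0 6 tn)).
Qed.

Lemma reflect_t t t' : t != 0 -> t' != 0 -> t + u ^+ 2 / t = t' + u ^+ 2 / t' ->
  t' = t \/ t' = u ^+ 2 / t.
Proof.
move=> tn tn' /eqP; rewrite -subr_eq0.
have -> : t + u ^+ 2 / t - (t' + u ^+ 2 / t') = (t - t') * (t' - u ^+ 2 / t) / t'.
  by field; rewrite tn tn'.
rewrite !mulf_eq0 invr_eq0 (negbTE tn') orbF !subr_eq0 => /orP[/eqP->|/eqP->];
  by [left|right].
Qed.

(** The Moebius map from p to y is its own inverse, and it is nondegenerate when t^2 differs from
    u^2. *)
Lemma coord_p t p y : t ^+ 2 != u ^+ 2 -> p * u - t != 0 ->
  y = (p * t - u) / (p * u - t) ->
  [/\ y * u - t != 0 & p = (y * t - u) / (y * u - t)].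
Proof.
move=> tu pt yE.
have E : y * (p * u - t) = p * t - u by rewrite yE divfK.
have yn : y * u - t != 0.
  apply: contraNneq tu => /eqP; rewrite subr_eq0 => /eqP yu.
  have : p * (y * u - t) = y * t - u by rewrite mulrBr mulrCA; apply/eqP; rewrite -subr_eq0 (_ : _ - _ = y * (p * u - t) - (p * t - u)); [rewrite E subrr|ring].
  rewrite yu subrr mulr0 => /esym/eqP; rewrite subr_eq0 => /eqP e.
  by rewrite !expr2 -{1}yu -mulrA [u * t]mulrC mulrA e.
split=> //; apply: (mulIf yn); rewrite divfK //.
by apply/eqP; rewrite -subr_eq0 (_ : _ - _ = y * (p * u - t) - (p * t - u)); [rewrite E subrr|ring].
Qed.

Lemma tri_equiv (b11 b12 c b22 b11' b12' b22' r12 : {poly F}) : c != 0 -> (size r12 <= 2)%N ->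
  poly_conn u q l b11 b12 c b22 -> poly_conn u q l b11' b12' c b22' ->
  b11' = b11 + rho u q r12 * c ->
  gauge_equiv u q (conn_mx u l b11 b12 ('X * c) b22) (conn_mx u l b11' b12' ('X * c) b22').
Proof.
move=> cn hr h h' E; exists 1, 1, r12; split; [exact: oner_neq0|exact: oner_neq0|exact: hr|].
have n1 := oner_neq0 F.
rewrite -/(tri 1 1 r12) (tri_gauge un qn hl n1 n1 hr).
have h2 := poly_conn_tri un qn u2n r12 n1 n1 h.
have E11 : tri11 u q 1 r12 b11 c = b11' by rewrite /tri11 invr1 scale1r E.
have E21 : tri21 1 1 c = c by rewrite /tri21 divr1 scale1r.
rewrite E11 E21 in h2 *.
by have [<- <-] := poly_conn_determined cn h2 h'.
Qed.

Lemma poly_conn_lead b11 b12 c b22 : poly_conn u q l b11 b12 c b22 ->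
  b22`_6 = b11`_0 / u ^+ 6.
Proof.
move=> [_ _ [e1 _ _] _ _]; have := congr1 (fun p : {poly F} => p`_6) e1.
rewrite coefZ coef_poly /= subnn muln0 expr0 mulr1 => ->.
by rewrite mulrC mulKf // expf_neq0.
Qed.

(** The difference of the two [b11] vanishes at all four roots of [xpol t], so it is [xpol t] times
    some e of degree at most 2. The trace condition ties e_0 to e_2, and the two-parameter family
    that remains is exactly the family of the polynomials [rho]. *)
Lemma same_values_equiv t b11 b12 b22 b11' b12' b22' :
  t != 0 -> t ^+ 2 != u ^+ 2 ->
  poly_conn u q l b11 b12 (xpol t) b22 -> poly_conn u q l b11' b12' (xpol t) b22' ->
  b11.[t] = b11'.[t] -> b11.[u ^+ 2 / t] = b11'.[u ^+ 2 / t] ->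
  gauge_equiv u q (conn_mx u l b11 b12 ('X * xpol t) b22)
                  (conn_mx u l b11' b12' ('X * xpol t) b22').
Proof.
move=> tn tu h h' Et Et'.
have cn : xpol t != 0 by apply: monic_neq0; apply: xpol_monic.
have uniq4 : uniq [:: u; - u; t; u ^+ 2 / t].
  have D a b : a ^+ 2 != b ^+ 2 -> a != b by apply: contraNneq => ->.
  have tt : (u ^+ 2 / t) ^+ 2 != u ^+ 2.
    apply: contraNneq tu => E; rewrite -(inj_eq (mulIf (expf_neq0 2 un))) -{1}E.
    by apply/eqP; field.
  have tt' : t != u ^+ 2 / t.
    by apply: contraNneq tu => E; rewrite {1}expr2 {1}E divfK.
  rewrite /= !inE !negb_or u2n tt' !andbT /=.
  by apply/andP; split; apply/andP; split; apply: D; rewrite ?sqrrN eq_sym.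
have [e dE] : exists e, b11' - b11 = e * xpol t.
  apply/dvdpP; rewrite xpol_roots; apply: uniq_roots_dvdp; last first.
    by rewrite uniq_rootsE.
  have [_ _ _ [hu hnu] _] := h; have [_ _ _ [hu' hnu'] _] := h'.
  by rewrite /= !rootE !hornerD !hornerN hu hnu hu' hnu' Et Et' !subrr eqxx.
have se : (size e <= 3)%N.
  have [->|en] := eqVneq e 0; first by rewrite size_poly0.
  have : (size (b11' - b11)%R <= 7)%N.
    have [[h11 _ _ _] _ _ _ _] := h; have [[h11' _ _ _] _ _ _ _] := h'.
    by rewrite (leq_trans (size_polyD _ _)) // geq_max h11' size_polyN.
  by rewrite dE size_mul // xpol_size addnS -[7%N]/(3 + 4)%N leq_add2r.
(* The coefficients are read off from the equation [rho] = e in degrees 2 and 1; degree 0 is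
   [e02]. *)
pose r12 := (q * e`_2) *: 'X + (e`_1)%:P.
have r1 : r12`_1 = q * e`_2 by rewrite /r12 coefD coefZ coefX coefC /= mulr1 addr0.
have r0 : r12`_0 = e`_1 by rewrite /r12 coefD coefZ coefX coefC /= mulr0 add0r.
have d6 : (b11' - b11)`_6 = e`_2.
  have sx : (size (xpol t) <= 5)%N by rewrite xpol_size.
  rewrite dE (coefM_top (m := 2) (n := 4) se sx).
  by have /monicP := xpol_monic t; rewrite lead_coefE xpol_size => ->; rewrite mulr1.
have d0 : (b11' - b11)`_0 = - u ^+ 4 * e`_0.
  rewrite dE -!horner_coef0 hornerM xpolE [LHS]mulrC; congr (_ * _).
  by field.
(* By reversal the top coefficient of [b22] is the constant term of [b11] over u^6, so the trace
   condition compares e_2 with e_0. *)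
have e02 : e`_0 = u ^+ 2 * q * e`_2.
  have [_ _ _ _ tr] := h; have [_ _ _ _ tr'] := h'.
  move: d0 d6; rewrite !coefB => d0 d6.
  have E : (b11'`_6 - b11`_6) + (b11'`_0 - b11`_0) / u ^+ 6 / q = 0.
    have := etrans tr' (esym tr); rewrite (poly_conn_lead h) (poly_conn_lead h') => E.
    apply/eqP; rewrite [X in X == _](_ : _ = b11'`_6 + b11'`_0 / u ^+ 6 / q - (b11`_6 + b11`_0 / u ^+ 6 / q)); last by ring.
    by rewrite E subrr.
  rewrite d0 d6 in E; apply/eqP; rewrite -subr_eq0.
  rewrite (_ : _ - _ = - (u ^+ 2 * q) * (e`_2 + - u ^+ 4 * e`_0 / u ^+ 6 / q)).
    by rewrite E mulr0.
  by field; rewrite un qn.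
apply: (tri_equiv (r12 := r12)) => //.
  apply: size_add_bound; last exact: leq_trans (size_polyC_leq1 _) _.
  by apply: size_scale_bound; rewrite size_polyX.
rewrite -[LHS](subrK b11) dE addrC; congr (_ + _ * _).
rewrite /rho r1 r0; apply/polyP => i.
rewrite !coefD !coefZ coefXn coefX coefC.
case: i => [|[|[|i]]] /=.
- by rewrite !mulr0 !add0r e02; ring.
- by rewrite mulr0 mulr1 add0r addr0.
- by rewrite mulr1 mulr0 !addr0 [q * _]mulrC mulfK.
- by rewrite !mulr0 !addr0 nth_default // (leq_trans se).
Qed.

(** x fixes t up to t -> u^2/t, and y then fixes p up to inversion in the same manner. Hence both
    connections give [b11] the same values at t and u^2/t. *)
Lemma class_unique A A' x y :
  (forall t, t != 0 -> x = t + u ^+ 2 / t ->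
     [/\ t ^+ 2 != u ^+ 2, (Ppol u l).[t] != 0 & (Qpol u l).[t] != 0]) ->
  is_connection u q l A -> has_coords u q l A x y ->
  is_connection u q l A' -> has_coords u q l A' x y -> gauge_equiv u q A A'.
Proof.
move=> hx hA cA hA' cA'.
have [b11 [b12 [b22 [t [h g [tn Pt] pt [xE yE]]]]]] := has_coordsP hA cA.
have [b11' [b12' [b22' [t' [h' g' [tn' Pt'] pt' [xE' yE']]]]]] := has_coordsP hA' cA'.
have [tu _ Qt] := hx _ tn xE; have [tu' _ Qt'] := hx _ tn' xE'.
have [yn pE] := coord_p tu pt yE; have [yn' pE'] := coord_p tu' pt' yE'.
have xt : (xpol t).[t] = 0 by rewrite xpolE subrr mulr0 mul0r.
have xt' : (xpol t').[t'] = 0 by rewrite xpolE subrr mulr0 mul0r.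
have bt : b11.[t] = b11.[t] / (Ppol u l).[t] * (Ppol u l).[t] by rewrite divfK.
have bt' : b11'.[t'] = b11'.[t'] / (Ppol u l).[t'] * (Ppol u l).[t'] by rewrite divfK.
have [pn r] := reflected_value h tn Pt Qt xt bt.
have [pn' r'] := reflected_value h' tn' Pt' Qt' xt' bt'.
move: g' h' r' bt' pE' pn'.
have -> : xpol t' = xpol t.
  have [->//|->] := reflect_t tn tn' (etrans (esym xE) xE').
  rewrite /xpol (_ : u ^+ 2 / (u ^+ 2 / t) = t); last by field; rewrite un tn.
  exact: mulrAC.
move=> g' h' r' bt' pE' pn'.
apply: (gauge_equiv_trans qn g); apply: (gauge_equiv_trans qn _ (gauge_equiv_sym qn g')).
have pE1 : b11.[t] / (Ppol u l).[t] = (y * t - u) / (y * u - t) := pE.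
have [tt|tt] := reflect_t tn tn' (etrans (esym xE) xE').
  have pp : b11'.[t'] / (Ppol u l).[t'] = b11.[t] / (Ppol u l).[t] by rewrite pE' pE tt.
  apply: same_values_equiv => //; rewrite -tt.
    by rewrite bt' pp tt -bt.
  by rewrite r' pp tt -r.
have tt2 : u ^+ 2 / t' = t by rewrite tt; field; rewrite un tn.
have pp : (b11'.[t'] / (Ppol u l).[t'])^-1 = b11.[t] / (Ppol u l).[t].
  rewrite pE' pE invf_div tt.
  have n1 : y * t - u != 0.
    by apply: contraNneq pn => n0; rewrite pE n0 mul0r.
  have n2 : y * (u ^+ 2 / t) - u != 0.
    by rewrite -tt; apply: contraNneq pn' => n0; rewrite pE' n0 mul0r.
  apply/eqP; rewrite eqr_div //; apply/eqP; field; by rewrite tn.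
apply: same_values_equiv => //.
  by rewrite -{2}tt2 r' pp tt2 mulrC -bt.
by rewrite r -tt [in RHS]bt' -pp invrK mulrC.
Qed.

End ClassUniqueness.

(** * Uniqueness of the modification *)

Section ModificationUniqueness.
Variable F : closedFieldType.
Variables u q : F.
Hypothesis un : u != 0.
Hypothesis qn : q != 0.
Hypothesis u2n : u != - u.
Hypothesis q_free : forall n, q ^+ n.+1 != 1.

Definition singular_points l : seq F := zs l ++ [seq u ^+ 2 / z | z <- zs l].

Definition nonresonant l : Prop :=
  (forall s s' n, s \in singular_points l -> s' \in singular_points l ->
     q ^+ n.+1 * s != s') /\
  (forall n, q ^+ n.+1 * minus_rho1 l != minus_rho2 q l /\
             q ^+ n.+1 * minus_rho2 q l != minus_rho1 l).

Variable l : param F.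
Hypothesis hl : admissible u q l.
Hypothesis nr : nonresonant l.
Implicit Types (A R : 'M[ratfun F]_2).

Lemma PQ_nonsingular w : w \notin singular_points l ->
  (Ppol u l).[w] != 0 /\ (Qpol u l).[w] != 0.
Proof.
rewrite /singular_points /zs /= !inE !negb_or => hw.
have [n1 n2 n3 [n4 n5 n6]] := adm_zn hl.
do 11 (case/andP: hw => ? hw).
rewrite PpolE QpolE; split; rewrite !mulf_neq0 ?subr_eq0 ?invr_eq0 ?mulf_neq0 //.
Qed.

Lemma connection_regular A w : is_connection u q l A -> w != 0 ->
  w \notin singular_points l -> mx_regular A w /\ mx_regular (invmx A) w.
Proof.
move=> /(connectionP un qn u2n hl)[b11 [b12 [c [b22 [[_ hd _ _ _] ->]]]]] wn ws.
have [Pw Qw] := PQ_nonsingular ws.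
have h := conn_value b11 b12 c b22 wn Pw.
have h' := mx_has_value_inv h; split=> i j.
  by eexists; apply: h.
eexists; apply: h'; rewrite unitmxE unitfE det_conn_at // hd (hornerM (Ppol u l)).
by rewrite !mulf_neq0 ?invr_eq0 ?mulf_neq0.
Qed.

Lemma regular_dec (r : ratfun F) a : regular r a \/ ~ regular r a.
Proof.
have [h|h] := regular_or_pole r a; first by left.
have [->|rn] := eqVneq r 0; first by left; exists 0; apply: has_value0.
right=> -[c hc]; have := has_valueM hc h; rewrite divff // mulr0 => h1.
by have /eqP := has_value_unique (has_value1 a) h1; rewrite oner_eq0.
Qed.

Lemma mx_regular_dec R a : mx_regular R a \/ ~ mx_regular R a.
Proof.
have [h00|h] := regular_dec (R 0 0) a; last by right=> /(_ 0 0).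
have [h01|h] := regular_dec (R 0 1) a; last by right=> /(_ 0 1).
have [h10|h] := regular_dec (R 1 0) a; last by right=> /(_ 1 0).
have [h11|h] := regular_dec (R 1 1) a; last by right=> /(_ 1 1).
by left; apply: mx2P.
Qed.

Lemma mx_irregular_finite R : exists2 d : {poly F}, d != 0 &
  forall a, ~ mx_regular R a -> root d a.
Proof.
have [d00 n00 h00] := irregular_finite (R 0 0).
have [d01 n01 h01] := irregular_finite (R 0 1).
have [d10 n10 h10] := irregular_finite (R 1 0).
have [d11 n11 h11] := irregular_finite (R 1 1).
exists (d00 * d01 * (d10 * d11)); first by rewrite !mulf_neq0.
move=> a h; rewrite !rootM.
have [k00|/h00->//] := regular_dec (R 0 0) a.
have [k01|/h01->] := regular_dec (R 0 1) a; last by rewrite orbT.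
have [k10|/h10->] := regular_dec (R 1 0) a; last by rewrite !orbT.
have [k11|/h11->] := regular_dec (R 1 1) a; last by rewrite !orbT.
by case: h; apply: mx2P.
Qed.

Lemma sig_preimage_finite (d : {poly F}) : d != 0 -> exists2 e : {poly F}, e != 0 &
  forall v, v != 0 -> root d (sig u q v) -> root e v.
Proof.
move=> dn; have [r rE] := closed_field_poly_normal d.
(* For nonzero v the factor indexed by z vanishes at v exactly when [sig] v = z. *)
exists (\prod_(z <- r) (q *: 'X^2 - (q * z) *: 'X + (u ^+ 2)%:P)).
  rewrite prodf_seq_neq0; apply/allP => z _ /=.
  apply/negP => /eqP /(congr1 (fun p : {poly F} => p.[0])).
  by rewrite !hornerS expr0n !mulr0 subrr add0r => /eqP; rewrite expf_eq0 (negbTE un) andbF.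
move=> v vn; rewrite rE rootZ ?lead_coef_eq0 // root_prod_XsubC => hv.
rewrite (perm_big _ (perm_to_rem hv)) big_cons rootM.
apply/orP; left; rewrite rootE !hornerS /sig; apply/eqP; field.
by rewrite vn qn.
Qed.

(** The points of the orbit are distinct, so the first [size e] of them cannot all be roots. *)
Lemma orbit_leaves (e : {poly F}) (w a : F) : e != 0 -> w != 0 -> a != 0 ->
  (forall n, a ^+ n.+1 != 1) -> exists n, ~~ root e (a ^+ n * w).
Proof.
move=> en wn an afree.
have uniq_orbit : uniq [seq a ^+ n * w | n <- iota 0 (size e)].
  rewrite map_inj_in_uniq ?iota_uniq // => i j _ _ /(mulIf wn).
  wlog: i j / (i <= j)%N => [H E|ij E].
    by case: (leqP i j) => [/H->//|/ltnW /H->].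
  apply/eqP; rewrite eqn_leq ij /= leqNgt; apply/negP => lt.
  case/negP: (afree (j - i).-1); rewrite prednK ?subn_gt0 //.
  by apply/eqP/(mulIf (expf_neq0 i an)); rewrite -exprD subnK // mul1r.
case: (boolP (all (root e) [seq a ^+ n * w | n <- iota 0 (size e)])) => [h|].
  by have := max_poly_roots en h uniq_orbit; rewrite size_map size_iota ltnn.
by move=> /allPn[_ /mapP[n _ ->] h]; exists n.
Qed.

Section Poles.
Variables (A A' R : 'M[ratfun F]_2).
Hypothesis hA : is_connection u q l A.
Hypothesis hA' : is_connection u q l A'.
Hypothesis uR : R \in unitmx.
Hypothesis hR : A' = gauge u q R A.

Let ts := transcendental_sigma_z u qn.
Let tsq := transcendental_sigma_zq u qn.

Lemma connection_unit B : is_connection u q l B -> B \in unitmx.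
Proof.
move=> [_ hdet _ _]; rewrite unitmxE unitfE hdet; apply: mulf_neq0.
  by rewrite of_poly_eq0; apply: (Qpol_neq0 hl).
by rewrite invr_eq0 of_poly_eq0; apply: Ppol_neq0.
Qed.

Lemma gauge_intertwine : subst_mx (sigma_zq u q) R *m A = A' *m subst_mx (sigma_z u q) R.
Proof.
have uR1 : subst_mx (sigma_z u q) R \in unitmx by rewrite (subst_mx_unit ts).
by rewrite hR; exact: esym (mulmxKV uR1 _).
Qed.

Lemma mx_regular_subst s (B : 'M[ratfun F]_2) a b : transcendental s -> has_value s b a ->
  mx_regular (subst_mx s B) b <-> mx_regular B a.
Proof.
move=> hs sb; split=> h i j.
  by apply/(regular_subst _ hs sb); have := h i j; rewrite mxE.
by rewrite mxE; apply/(regular_subst _ hs sb).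
Qed.

(** Off the singular points A, A' and their inverses are regular, and the intertwining relation
    expresses each of R(sigma(w)) and R(sigma(w/q)) through the other. *)
Lemma regular_propagate w : w != 0 -> w \notin singular_points l ->
  mx_regular R (sig u q w) <-> mx_regular R (sig u q (w / q)).
Proof.
move=> wn ws.
have [rA rA1] := connection_regular hA wn ws.
have [rA' rA'1] := connection_regular hA' wn ws.
have E1 := mx_regular_subst R ts (has_value_sigma_z u qn wn).
have E2 := mx_regular_subst R tsq (has_value_sigma_zq u qn wn).
rewrite -E1 -E2; have E := gauge_intertwine.
have eq1 : subst_mx (sigma_zq u q) R = A' *m subst_mx (sigma_z u q) R *m invmx A.
  by rewrite -E; exact: esym (mulmxK (connection_unit hA) _).
have eq2 : subst_mx (sigma_z u q) R = invmx A' *m (subst_mx (sigma_zq u q) R *m A).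
  by rewrite E; exact: esym (mulKmx (connection_unit hA') _).
split=> h; [rewrite eq1|rewrite eq2].
  by apply: mx_regularM rA1; apply: mx_regularM h.
by apply: mx_regularM rA'1 _; apply: mx_regularM h rA.
Qed.

(** R has finitely many poles, so a pole followed along the q-orbit must disappear in both
    directions, each time at a singular point. Two singular points would then differ by a positive
    power of q. *)
Lemma mx_regular_orbit w : w != 0 -> mx_regular R (sig u q w).
Proof.
move=> wn; have [//|nreg] := mx_regular_dec R (sig u q w).
have [d dn hd] := mx_irregular_finite R.
have [e en he] := sig_preimage_finite dn.
(* Propagation at w links [sig] w with [sig] (w/q), so the way up from w crosses q w, q^2 w, ... and
   the exponent is positive. *)
have up : exists2 n, (0 < n)%N & q ^+ n * w \in singular_points l.
  have [N hN] := orbit_leaves en wn qn q_free.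
  case: (boolP (has (fun n => q ^+ n.+1 * w \in singular_points l) (iota 0 N))).
    by move=> /hasP[n _ h]; exists n.+1.
  move=> /hasPn h; case/negP: hN; apply: he.
    by rewrite mulf_neq0 ?expf_neq0.
  apply: hd; elim: N h => [|N IHN] h; first by rewrite expr0 mul1r.
  move=> reg; apply: IHN => [n|].
    by rewrite mem_iota add0n => /andP[_ nN]; apply: h; rewrite mem_iota /= add0n ltnS ltnW.
  have qN : q ^+ N.+1 * w != 0 by rewrite mulf_neq0 ?expf_neq0.
  have hs : q ^+ N.+1 * w \notin singular_points l.
    by apply: h; rewrite mem_iota /= add0n ltnSn.
  move/(regular_propagate qN hs): reg.
  by rewrite (_ : q ^+ N.+1 * w / q = q ^+ N * w) // exprS; field.
(* The way down crosses w itself, so the exponent 0 is allowed here. *)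
have down : exists n, q^-1 ^+ n * w \in singular_points l.
  have qV : q^-1 != 0 by rewrite invr_eq0.
  have qVfree n : q^-1 ^+ n.+1 != 1 by rewrite exprVn invr_eq1.
  have [N hN] := orbit_leaves en wn qV qVfree.
  case: (boolP (has (fun n => q^-1 ^+ n * w \in singular_points l) (iota 0 N))).
    by move=> /hasP[n _ h]; exists n.
  move=> /hasPn h; case/negP: hN; apply: he.
    by rewrite mulf_neq0 ?expf_neq0.
  apply: hd; elim: N h => [|N IHN] h; first by rewrite expr0 mul1r.
  move=> reg; apply: IHN => [n|].
    by rewrite mem_iota add0n => /andP[_ nN]; apply: h; rewrite mem_iota /= add0n ltnS ltnW.
  have qN : q^-1 ^+ N * w != 0 by rewrite mulf_neq0 ?expf_neq0.
  have hs : q^-1 ^+ N * w \notin singular_points l.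
    by apply: h; rewrite mem_iota /= add0n ltnSn.
  apply/(regular_propagate qN hs); move: reg.
  by rewrite (_ : q^-1 ^+ N.+1 * w = q^-1 ^+ N * w / q) // exprS; ring.
have [n n0 hn] := up; have [m hm] := down.
(* The ratio of the two singular points is q^(n + m), with n + m > 0 because n > 0. *)
case/negP: (nr.1 _ _ (n + m).-1 hm hn).
rewrite prednK ?addn_gt0 ?n0 // exprD exprVn; apply/eqP.
by move: (q ^+ m) (expf_neq0 m qn) => Q Qn; field.
Qed.

Lemma gauge_polynomial : exists r11 r12 r21 r22 : {poly F},
  R = mx2 (of_poly r11) (of_poly r12) (of_poly r21) (of_poly r22).
Proof.
have H a : mx_regular R a.
  (* Every a is a value of [sig]: w is a root of the quadratic equation [sig] w = a. *)
  have [w] : exists w, root ('X^2 - a *: 'X + (u ^+ 2 / q)%:P) w.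
    apply/closed_rootP; rewrite -addrA size_polyDl size_polyXn //.
    apply: size_add_bound; last by rewrite (leq_trans (size_polyC_leq1 _)).
    by rewrite size_polyN; apply: size_scale_bound; rewrite size_polyX.
  rewrite rootE !hornerS => /eqP wE.
  have wn : w != 0.
    apply/negP => /eqP w0; move/eqP: wE; rewrite w0 expr0n mulr0 subrr add0r.
    by rewrite mulf_eq0 expf_eq0 (negbTE un) invr_eq0 (negbTE qn) andbF.
  have -> : a = sig u q w.
    apply: (mulIf wn); apply/eqP; rewrite -subr_eq0.
    rewrite (_ : _ - _ = - (w ^+ 2 - a * w + u ^+ 2 / q)); first by rewrite wE oppr0.
    by rewrite /sig; field; rewrite wn qn.
  exact: mx_regular_orbit.
have P i j : exists p, R i j = of_poly p.
  by apply: everywhere_regular_poly => a; apply: H.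
have [r11 E11] := P 0 0; have [r12 E12] := P 0 1.
have [r21 E21] := P 1 0; have [r22 E22] := P 1 1.
by exists r11, r12, r21, r22; rewrite (mx2_eta R) E11 E12 E21 E22.
Qed.

End Poles.
Let tw := @transcendental_winv F.

(* S(w) R(w) S(w)^-1 / w ^ n *)
Definition twist n (r11 r12 r21 r22 : {poly F}) (w : ratfun F) : 'M[ratfun F]_2 :=
  mx2 (polyat w r11 / w ^+ n) (polyat w r12 / w ^+ n.+1)
      (polyat w ('X * r21) / w ^+ n) (polyat w r22 / w ^+ n).

Lemma mul_Smx_twist (K : fieldType) n (w a b c d : K) : w != 0 ->
  mx2 1 0 0 w *m mx2 a b c d =
  w ^+ n *: (mx2 (a / w ^+ n) (b / w ^+ n.+1) (w * c / w ^+ n) (d / w ^+ n) *m mx2 1 0 0 w).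
Proof.
move=> wn; rewrite !mul_mx2 scale_mx2 exprS.
by move: (w ^+ n) (expf_neq0 n wn) => W Wn; congr mx2; field; rewrite ?wn ?Wn.
Qed.

Lemma twistE n r11 r12 r21 r22 w : w != 0 -> transcendental w ->
  Smx w *m subst_mx w (mx2 (of_poly r11) (of_poly r12) (of_poly r21) (of_poly r22)) =
  w ^+ n *: (twist n r11 r12 r21 r22 w *m Smx w).
Proof.
move=> wn hw; rewrite subst_mx2 !(subst_poly hw) /twist polyatM polyatX.
exact: mul_Smx_twist.
Qed.

Lemma twist_limit n (r11 r12 r21 r22 : {poly F}) (w : ratfun F) : w != 0 -> has_limit w^-1 0 ->
  (size r11 <= n.+1)%N -> (size r12 <= n.+2)%N ->
  (size ('X * r21)%R <= n.+1)%N -> (size r22 <= n.+1)%N ->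
  mx_has_limit (twist n r11 r12 r21 r22 w) (mx2 r11`_n r12`_n.+1 ('X * r21)`_n r22`_n).
Proof.
move=> wn hw h11 h12 h21 h22.
by apply: mx2P; rewrite !mxE /=; apply: (has_limit_polyat tw).
Qed.

(** Conjugation by S turns the intertwining of A and A' by R into that of the asymptotically finite
    matrices by T; the scalars x and x' carry the growth of R. *)
Lemma twisted_intertwine (K : fieldType) (x x' : K) (R R' A A' S S' T T' : 'M[K]_2) :
  x != 0 -> S \in unitmx -> R' *m A = A' *m R ->
  S *m R = x *: (T *m S) -> S' *m R' = x' *: (T' *m S') ->
  (x' / x) *: (T' *m (S' *m A *m invmx S)) = S' *m A' *m invmx S *m T.
Proof.
move=> xn uS E E1 E2; apply: (scalerI xn); rewrite scalerA mulrC divfK //.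
have -> : x *: (S' *m A' *m invmx S *m T) = S' *m A' *m invmx S *m (x *: (T *m S)) *m invmx S.
  by rewrite -scalemxAr -scalemxAl !mulmxA mulmxK.
rewrite -E1 !mulmxA mulmxKV // -(mulmxA S' A') -E !mulmxA E2.
by rewrite -!scalemxAl.
Qed.

(** In eigenbases the (i, j) entry of N satisfies (k d_j - d_i) N_ij = 0. *)
Lemma eigen_vanish k (N M M' G G' : 'M[F]_2) d1 d2 :
  G \in unitmx -> G' \in unitmx ->
  G *m M *m invmx G = mx2 d1 0 0 d2 -> G' *m M' *m invmx G' = mx2 d1 0 0 d2 ->
  k *: (N *m M) = M' *m N ->
  k != 1 -> d1 != 0 -> d2 != 0 -> k * d1 != d2 -> k * d2 != d1 -> N = 0.
Proof.
move=> uG uG' E E' EN k1 d1n d2n k12 k21.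
set N' := G' *m N *m invmx G.
suff N'0 : N' = 0.
  have -> : N = invmx G' *m N' *m G by rewrite /N' !mulmxA mulVmx // mul1mx mulmxKV.
  by rewrite N'0 mulmx0 mul0mx.
have : k *: (N' *m mx2 d1 0 0 d2) = mx2 d1 0 0 d2 *m N'.
  transitivity (G' *m (k *: (N *m M)) *m invmx G).
    by rewrite -E /N' -scalemxAr -scalemxAl !mulmxA mulmxKV.
  by rewrite EN -E' /N' !mulmxA mulmxKV.
rewrite (mx2_eta N') !mul_mx2 scale_mx2 => /mx2_inj[].
rewrite !mulr0 !mul0r !addr0 !add0r.
have H (x a b : F) : a != b -> a * x = b * x -> x = 0.
  move=> ab /eqP; rewrite -subr_eq0 -mulrBl mulf_eq0 subr_eq0 (negbTE ab).
  by move/eqP.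
rewrite ![N' _ _ * _]mulrC !mulrA => e1 e2 e3 e4.
rewrite (H _ _ _ _ e1) ?(H _ _ _ _ e2) ?(H _ _ _ _ e3) ?(H _ _ _ _ e4) //.
- by apply/matrixP; apply: mx2P; rewrite !mxE.
- by rewrite -[X in _ != X]mul1r (inj_eq (mulIf d2n)).
- by rewrite -[X in _ != X]mul1r (inj_eq (mulIf d1n)).
Qed.

Lemma size_drop_lead (p : {poly F}) n : (size p <= n.+1)%N -> p`_n = 0 -> (size p <= n)%N.
Proof.
rewrite leq_eqVlt => /orP[/eqP sp|//] p0.
have : lead_coef p = 0 by rewrite lead_coefE sp.
by move/eqP; rewrite lead_coef_eq0 => /eqP p00; rewrite p00 size_poly0.
Qed.

Lemma minus_rho_neq0 : minus_rho1 l != 0 /\ minus_rho2 q l != 0.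
Proof.
have [n1 n2 n3 [n4 n5 n6]] := adm_zn hl; have dn := adm_d hl.
by rewrite /minus_rho1 /minus_rho2; split=> //; rewrite !mulf_neq0 ?invr_eq0 ?mulf_neq0.
Qed.

(** The bounds say that S R S^-1 has degree at most n, which allows [r12] one degree more and [r21]
    one less. The leading coefficient vanishes as long as n > 0; at n = 0 the bounds leave just the
    gauge group. *)
Lemma twist_descent A A' (r11 r12 r21 r22 : {poly F}) n :
  is_connection u q l A -> is_connection u q l A' ->
  let R := mx2 (of_poly r11) (of_poly r12) (of_poly r21) (of_poly r22) in
  subst_mx (sigma_zq u q) R *m A = A' *m subst_mx (sigma_z u q) R ->
  (size r11 <= n.+1)%N -> (size r12 <= n.+2)%N ->
  (size ('X * r21)%R <= n.+1)%N -> (size r22 <= n.+1)%N ->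
  [/\ (size r11 <= 1)%N, (size r12 <= 2)%N, (size ('X * r21)%R <= 1)%N & (size r22 <= 1)%N].
Proof.
move=> hA hA' R E; elim: n => [|n IHn] h11 h12 h21 h22; first by split.
have [_ _ [M [G [hM uG GM]]] _] := hA; have [_ _ [M' [G' [hM' uG' GM']]] _] := hA'.
have sn := sigma_z_neq0 u qn; have sn' := sigma_zq_neq0 u qn.
have ts := transcendental_sigma_z u qn; have ts' := transcendental_sigma_zq u qn.
have uS : Smx (sigma_z u q) \in unitmx.
  rewrite unit_mx2 mulr0 subr0 mul1r; exact: sn.
have W := twisted_intertwine (expf_neq0 n.+1 sn) uS E (twistE n.+1 r11 r12 r21 r22 sn ts)
  (twistE n.+1 r11 r12 r21 r22 sn' ts').
set N := mx2 r11`_n.+1 r12`_n.+2 ('X * r21)`_n.+1 r22`_n.+1.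
have L := twist_limit sn (has_limit_sigma_z_inv u qn) h11 h12 h21 h22.
have L' := twist_limit sn' (has_limit_sigma_zq_inv u qn) h11 h12 h21 h22.
have lim1 := mx_has_limitM tw hM' L.
have Eq : (sigma_zq u q) ^+ n.+1 / (sigma_z u q) ^+ n.+1 =
  (sigma_zq u q / sigma_z u q) ^+ n.+1 by exact: esym (expr_div_n _ _ _).
rewrite Eq in W.
have lim2 := mx_has_limitZ tw (has_limitX tw n.+1 (has_limit_sigma_ratio u qn))
  (mx_has_limitM tw L' hM).
rewrite W in lim2.
have EN := mx_has_limit_unique lim2 lim1.
have [d1n d2n] := minus_rho_neq0.
have [nr1 nr2] := nr.2 n.
have Qn : q ^+ n.+1 != 0 by rewrite expf_neq0.
have : N = 0.
  apply: (eigen_vanish uG uG' GM GM' EN) => //.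
  - by rewrite exprVn invr_eq1.
  - apply: contraNneq nr2 => <-; rewrite exprVn; apply/eqP.
    by move: (q ^+ n.+1) Qn => Q Qn; field.
  - apply: contraNneq nr1 => <-; rewrite exprVn; apply/eqP.
    by move: (q ^+ n.+1) Qn => Q Qn; field.
move=> /matrixP N0; move: (N0 0 0) (N0 0 1) (N0 1 0) (N0 1 1); rewrite !mxE /=.
by move=> c11 c12 c21 c22; apply: IHn; apply: size_drop_lead.
Qed.

Lemma modification_unique A A' : is_connection u q l A -> is_connection u q l A' ->
  modification u q A A' -> gauge_equiv u q A A'.
Proof.
move=> hA hA' [R uR AE].
have [r11 [r12 [r21 [r22 RE]]]] := gauge_polynomial hA hA' uR AE.
have E := gauge_intertwine uR AE; rewrite RE in E.
pose n := (size r11 + size r12 + size ('X * r21)%R + size r22)%N.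
have [| | | |k11 k12 k21 k22] := twist_descent (n := n) hA hA' E.
- by rewrite /n -!addnA -addnS leq_addr.
- by rewrite /n [(size r11 + _)%N]addnC -!addnA -!addnS leq_addr.
- by rewrite /n [(_ + size ('X * r21)%R)%N]addnC -!addnA -addnS leq_addr.
- by rewrite /n [(_ + size r22)%N]addnC -addnS leq_addr.
have r210 : r21 = 0.
  apply/eqP; apply: contraLR k21 => h.
  by rewrite mulrC size_mulX // -ltnNge ltnS lt0n size_poly_eq0.
have [a aE] : exists a, r11 = a%:P by exists r11`_0; apply: size1_polyC.
have [d dE] : exists d, r22 = d%:P by exists r22`_0; apply: size1_polyC.
move: uR; rewrite RE aE dE r210 of_poly0 unit_mx2 mulr0 subr0 => uR.
have an : a != 0.
  by apply: contraNneq uR => ->; rewrite polyC0 of_poly0 mul0r.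
have dn : d != 0.
  by apply: contraNneq uR => ->; rewrite polyC0 of_poly0 mulr0.
exists a, d, r12; split; [exact: an|exact: dn|exact: k12|].
rewrite AE; congr (gauge u q _ A).
by rewrite RE aE dE r210 of_poly0.
Qed.

End ModificationUniqueness.

(** * The explicit step *)

Section TopCoefficient.
Variable F : closedFieldType.
Implicit Types p r : {poly F}.

(** n is a formal degree: the coefficient a may vanish. *)
Definition top n p (a : F) : Prop := (size p <= n.+1)%N /\ p`_n = a.

Lemma topM m n p r a b : top m p a -> top n r b -> top (m + n) (p * r) (a * b).
Proof.
move=> [sp <-] [sr <-]; split; first exact: (size_mul_bound sp sr).
exact: coefM_top.
Qed.

Lemma topD n p r a b : top n p a -> top n r b -> top n (p + r) (a + b).
Proof. by move=> [sp <-] [sr <-]; split; [apply: size_add_bound|rewrite coefD]. Qed.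

Lemma topN n p a : top n p a -> top n (- p) (- a).
Proof. by move=> [sp <-]; split; [rewrite size_polyN|rewrite coefN]. Qed.

Lemma topZ n p a k : top n p a -> top n (k *: p) (k * a).
Proof. by move=> [sp <-]; split; [apply: size_scale_bound|rewrite coefZ]. Qed.

Definition lin (a b : F) : {poly F} := a *: 'X + b%:P.

Lemma linE a b z : (lin a b).[z] = a * z + b.
Proof. by rewrite /lin !hornerS. Qed.

Lemma top_lin a b : top 1 (lin a b) a.
Proof.
split; last by rewrite /lin coefD coefZ coefX coefC mulr1 addr0.
apply: size_add_bound; last by rewrite (leq_trans (size_polyC_leq1 _)).
by apply: size_scale_bound; rewrite size_polyX.
Qed.

(* 'X * wpol u x is the normal form of b21. *)
Definition wpol (u x : F) : {poly F} :=
  ('X^2 - (u ^+ 2)%:P) * ('X^2 + lin (- x) (u ^+ 2)).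

Lemma wpolE u x z : (wpol u x).[z] = (z ^+ 2 - u ^+ 2) * (z ^+ 2 - x * z + u ^+ 2).
Proof. by rewrite /wpol /lin !hornerS; ring. Qed.

Lemma top_wpol u x : top 4 (wpol u x) 1.
Proof.
have tX : top 2 ('X^2 : {poly F}) 1 by split; rewrite ?size_polyXn ?coefXn.
rewrite -(mulr1 1); apply: (@topM 2 2).
  rewrite -(subr0 1); apply: topD => //; apply: topN.
  by split; [rewrite (leq_trans (size_polyC_leq1 _))|rewrite coefC].
rewrite -(addr0 1); apply: topD => //.
have [s _] := top_lin (- x) (u ^+ 2); split; first exact: leq_trans s _.
by rewrite nth_default.
Qed.

Lemma wpol_xpol u t : t != 0 -> wpol u (t + u ^+ 2 / t) = xpol u t.
Proof.
move=> tn; apply: poly_eq_cofinite; apply: cofinite_imp (cofinite_neq 0) => z zn.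
by rewrite wpolE xpolE; field.
Qed.

(** Since the coefficient of formal degree n is zero, n roots are already too many. *)
Lemma interpolate (p : {poly F}) n (s : seq F) : top n p 0 -> size s = n -> uniq s ->
  (forall z, z \in s -> p.[z] = 0) -> p = 0.
Proof.
move=> [sp p0] ss us h; apply/eqP; apply: contraT => pn.
have := max_poly_roots pn _ us; rewrite ss ltnNge (size_drop_lead sp p0).
by apply; apply/allP => z /h /eqP.
Qed.

End TopCoefficient.

(** * The polynomial identity of degree 6 *)

Section CoreIdentity.
Variable F : closedFieldType.
Variables u q z1 z2 z3 z4 z5 z6 d1 d2 x g al be : F.
Hypothesis un : u != 0.
Hypothesis u2n : u != - u.
Hypothesis qn : q != 0.
Hypothesis n2 : z2 != 0.
Hypothesis n4 : z4 != 0.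
Hypothesis n6 : z6 != 0.
Let e := u ^+ 2 / (q * z2 * z4).
Let ze := - be / al.
Let Phi (w : F) := (w - z6 * d1) * (w - z6 * d2).
Let P3 (z : F) := (z - z1) * (z - z3) * (z - z5).
Hypothesis hd : z6 ^+ 2 * (d1 * d2) * u ^+ 2 = z1 * z3 * z5 * z6 * e.
Hypothesis h1 : P3 g * (g - z6) = (g ^+ 2 - x * g + u ^+ 2) * (al * g + be).
Hypothesis h2 : Phi g = al * g + e * be.
Hypothesis aln : al != 0.
Hypothesis ben : be != 0.
Hypothesis gn : g != 0.
Hypothesis gu : g ^+ 2 != u ^+ 2.
Hypothesis zu : ze ^+ 2 != u ^+ 2.
Hypothesis gz : g != ze.
Hypothesis gzu : g * ze != u ^+ 2.
Hypothesis gez : g != e * ze.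
Hypothesis Pz : Phi (e * ze) != 0.

Let en : e != 0.
Proof. by rewrite !mulf_neq0 ?expf_neq0 ?invr_eq0 ?mulf_neq0. Qed.

Lemma beE : be = - (al * ze).
Proof. by rewrite /ze mulrC divfK // opprK. Qed.

Lemma ze_neq0 : ze != 0.
Proof. by rewrite mulf_neq0 ?oppr_eq0 ?invr_eq0. Qed.

Let gez' : g - e * ze != 0.
Proof. by rewrite subr_eq0. Qed.

Lemma alE : al = Phi g / (g - e * ze).
Proof. by apply: (mulIf gez'); rewrite divfK ?gez' // h2 [in RHS]beE; ring. Qed.

(** Two constants are left free on the right-hand side: [core_C] comes from the coefficients of
    degree 6, [core_x] from the values at [ze]. *)
Definition core_C := - u ^+ 4 * al * Phi (e * ze) / (e * (g - e * ze)).
Definition core_x :=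
  ze + u ^+ 2 / ze + e * P3 ze * (z6 - ze) * (g - e * ze) / (ze * (g - ze) * Phi (e * ze)).

(** [polL] is z6 h(z) (g - z), and [polK] is its part free of al and be. A final s marks a reversal:
    z^3 P3(u^2/z) for [polP3s], z^5 K(u^2/z) for [polKs]. *)
Definition polP3 := lin 1 (- z1) * lin 1 (- z3) * lin 1 (- z5).
Definition polK := polP3 * lin (- 1) z6 * lin g (- u ^+ 2).
Definition polP3s := lin (- z1) (u ^+ 2) * lin (- z3) (u ^+ 2) * lin (- z5) (u ^+ 2).
Definition polKs := polP3s * lin z6 (- u ^+ 2) * lin (- u ^+ 2) (u ^+ 2 * g).
Definition polL := polK + wpol u x * lin al be.

(** If L, K stand for [polL], [polK] and L*, K* for their reversals, then L L* - K K* is [wpol u x]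
    times this polynomial. *)
Definition core_lhs := lin al be * polKs - u ^+ 4 *: (lin be (al * u ^+ 2) * polL).
Definition core_rhs := core_C *: (lin (- 1) g * lin g (- u ^+ 2) * wpol u core_x).

Lemma polP3E z : polP3.[z] = P3 z.
Proof. by rewrite /polP3 !hornerM !linE !mul1r. Qed.

Lemma polP3sE z : polP3s.[z] = (u ^+ 2 - z1 * z) * (u ^+ 2 - z3 * z) * (u ^+ 2 - z5 * z).
Proof. by rewrite /polP3s !hornerM !linE; ring. Qed.

Lemma polP3s_reflect z : z != 0 -> polP3s.[z] = z ^+ 3 * P3 (u ^+ 2 / z).
Proof. by move=> zn; rewrite polP3sE /P3; field. Qed.

Lemma polKE z : polK.[z] = P3 z * (z6 - z) * (g * z - u ^+ 2).
Proof. by rewrite /polK hornerM (hornerM polP3) polP3E !linE; ring. Qed.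

Lemma polKsE z : polKs.[z] = polP3s.[z] * (z6 * z - u ^+ 2) * (u ^+ 2 * (g - z)).
Proof. by rewrite /polKs hornerM (hornerM polP3s) !linE; ring. Qed.

Lemma polKs_reflect z : z != 0 -> polKs.[z] = z ^+ 5 * polK.[u ^+ 2 / z].
Proof.
move=> zn; rewrite polKsE polP3s_reflect // polKE.
by move: (P3 _) => a; field.
Qed.

Lemma polLE z : polL.[z] =
  polK.[z] + (z ^+ 2 - u ^+ 2) * (z ^+ 2 - x * z + u ^+ 2) * (al * z + be).
Proof. by rewrite /polL hornerD (hornerM (wpol u x)) wpolE linE. Qed.

Lemma core_lhsE z : core_lhs.[z] =
  (al * z + be) * polKs.[z] - u ^+ 4 * (be * z + al * u ^+ 2) * polL.[z].
Proof. by rewrite /core_lhs hornerD hornerN hornerZ (hornerM (lin al be)) (hornerM (lin be _)) !linE mulrA. Qed.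

Lemma core_rhsE z : core_rhs.[z] = core_C * ((g - z) * (g * z - u ^+ 2) *
  ((z ^+ 2 - u ^+ 2) * (z ^+ 2 - core_x * z + u ^+ 2))).
Proof. by rewrite /core_rhs hornerZ (hornerM _ (wpol u core_x)) (hornerM (lin _ _)) !linE wpolE; ring. Qed.

(** Nonzero roots of the difference come in pairs, so checking g and [ze] also settles u^2/g and
    u^2/ze. *)
Lemma core_antisym z : z != 0 ->
  z ^+ 6 * (core_lhs - core_rhs).[u ^+ 2 / z] = - u ^+ 6 * (core_lhs - core_rhs).[z].
Proof.
move=> zn; have wn : u ^+ 2 / z != 0 by rewrite mulf_neq0 ?invr_eq0 ?expf_neq0.
have E := polKs_reflect wn; have E' := polKs_reflect zn.
rewrite (_ : u ^+ 2 / (u ^+ 2 / z) = z) in E; last by field; rewrite un zn.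
rewrite !(hornerD core_lhs) !(hornerN core_rhs) !core_lhsE !core_rhsE !polLE E E'.
move: core_C core_x polK.[z] polK.[_] => C X k k'.
by field.
Qed.

(** The product of the exponents at infinity enters through [hd], and the trace relation [h2]
    through [alE]. *)
Lemma top_core : top 6 (core_lhs - core_rhs) 0.
Proof.
have t3 : top 3 polP3 (1 * 1 * 1).
  by apply: (@topM _ 2 1); [apply: (@topM _ 1 1)|]; apply: top_lin.
have tK : top 5 polK (1 * 1 * 1 * (- 1) * g).
  by apply: (@topM _ 4 1); [apply: (@topM _ 3 1)|]; rewrite //; apply: top_lin.
have t3s : top 3 polP3s (- z1 * - z3 * - z5).
  by apply: (@topM _ 2 1); [apply: (@topM _ 1 1)|]; apply: top_lin.
have tKs : top 5 polKs (- z1 * - z3 * - z5 * z6 * - u ^+ 2).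
  by apply: (@topM _ 4 1); [apply: (@topM _ 3 1)|]; rewrite //; apply: top_lin.
have tL : top 5 polL (1 * 1 * 1 * (- 1) * g + 1 * al).
  by apply: topD => //; apply: (@topM _ 4 1); [apply: top_wpol|apply: top_lin].
have := topD (topD (@topM _ 1 5 _ _ _ _ (top_lin al be) tKs)
   (topN (topZ (u ^+ 4) (@topM _ 1 5 _ _ _ _ (top_lin be (al * u ^+ 2)) tL))))
   (topN (topZ core_C (@topM _ 2 4 _ _ _ _ (@topM _ 1 1 _ _ _ _ (top_lin (- 1) g)
      (top_lin g (- u ^+ 2))) (top_wpol u core_x)))).
move=> [s c]; split; first exact: s.
rewrite [LHS]c /core_C beE.
have E : z1 * z3 * z5 * z6 = z6 ^+ 2 * (d1 * d2) * u ^+ 2 / e by rewrite hd (mulfK en).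
have -> : - z1 * - z3 * - z5 * z6 * - u ^+ 2 = z6 ^+ 2 * (d1 * d2) * u ^+ 2 / e * u ^+ 2.
  by rewrite -E; ring.
rewrite alE; move: e ze en gez gez' => e' z en' gez1 gez2; rewrite /Phi; field.
by rewrite gez2 en'.
Qed.

Lemma core_L_g : polL.[g] = 0.
Proof.
rewrite polLE polKE.
have -> : P3 g * (z6 - g) = - (P3 g * (g - z6)) by ring.
by rewrite h1; ring.
Qed.

(** The difference has formal degree 6 and vanishing top coefficient, so six distinct roots
    suffice. *)
Lemma core_identity : core_lhs = core_rhs.
Proof.
apply/eqP; rewrite -subr_eq0; apply/eqP.
have zn := ze_neq0.
have D a b : a ^+ 2 != b ^+ 2 -> a != b by apply: contraNneq => ->.
have refl z : z != 0 -> (core_lhs - core_rhs).[z] = 0 -> (core_lhs - core_rhs).[u ^+ 2 / z] = 0.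
  move=> z0 E; apply: (mulfI (expf_neq0 6 z0)).
  by rewrite core_antisym // E !mulr0.
have V z : core_lhs.[z] = core_rhs.[z] -> (core_lhs - core_rhs).[z] = 0.
  by move=> E; rewrite (hornerD core_lhs) (hornerN core_rhs) E subrr.
(* Both [polL] and [polKs] vanish at g, the former by [h1]. *)
have Vg : (core_lhs - core_rhs).[g] = 0.
  by apply: V; rewrite core_lhsE core_rhsE core_L_g polKsE; ring.
(* Here al z + be vanishes, and what remains is the equation that defines [core_x]. *)
have Vz : (core_lhs - core_rhs).[ze] = 0.
  apply: V; rewrite core_lhsE core_rhsE polLE polKE.
  have -> : al * ze + be = 0 by rewrite beE; ring.
  have -> : be * ze + al * u ^+ 2 = al * (u ^+ 2 - ze ^+ 2) by rewrite beE; ring.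
  rewrite /core_C /core_x; move: (P3 ze) (Phi (e * ze)) Pz => p ph phn.
  move: e en gez' => e' en' gez1; field.
  by rewrite en' phn zn gez1 subr_eq0 gz.
apply: (@interpolate _ _ 6 [:: u; - u; g; ze; u ^+ 2 / g; u ^+ 2 / ze]) => //.
- exact: top_core.
- have gun : g != u by apply: D.
  have gun' : g != - u by apply: D; rewrite sqrrN.
  have zun : ze != u by apply: D.
  have zun' : ze != - u by apply: D; rewrite sqrrN.
  have H a b : b != 0 -> (a == u ^+ 2 / b) = (a * b == u ^+ 2).
    by move=> bn; rewrite -[in RHS](divfK bn (u ^+ 2)) (inj_eq (mulIf bn)).
  have H' a b : a != 0 -> b != 0 -> (u ^+ 2 / a == u ^+ 2 / b) = (a == b).
    move=> an bn; rewrite H // mulrAC -(inj_eq (mulIf an)) divfK //.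
    by rewrite (inj_eq (mulfI (expf_neq0 2 un))) eq_sym.
  have X a : a != u -> u * a != u ^+ 2 by move=> h; rewrite expr2 (inj_eq (mulfI un)).
  have X' a : a != - u -> - u * a != u ^+ 2.
    move=> h; have -> : u ^+ 2 = - u * - u by rewrite mulrNN.
    by rewrite (inj_eq (mulfI _)) // oppr_eq0.
  rewrite /= !inE !negb_or (H' _ _ gn zn) !H // !X // !X' // !andbT.
  rewrite u2n !(eq_sym u) !(eq_sym (- u)) gun gun' zun zun' gz gzu -!expr2 gu zu.
  by rewrite mulrC gzu.
- move=> z; rewrite !inE => /or3P[/eqP->|/eqP->|/orP[/eqP->//|]].
  + apply: V; rewrite core_lhsE core_rhsE polLE polKs_reflect //.
    by rewrite expr2 mulfK //; ring.
  + have nun : - u != 0 by rewrite oppr_eq0.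
    apply: V; rewrite core_lhsE core_rhsE polLE polKs_reflect //.
    have -> : u ^+ 2 / - u = - u by field.
    by ring.
  + by move=> /or3P[/eqP->//|/eqP->|/eqP->]; apply: refl.
Qed.

End CoreIdentity.

(** * The connections before and after the step *)

Section Step.
Variable F : closedFieldType.
Variables u q : F.
Hypothesis un : u != 0.
Hypothesis u2n : u != - u.
Hypothesis qn : q != 0.
Variable l : param F.
Hypothesis hl : admissible u q l.
Hypothesis hl' : admissible u q (evolve q l).

Definition par_e := u ^+ 2 / (q * z2 l * z4 l).
Definition par_Phi (w : F) := (w - z6 l * minus_rho1 l) * (w - z6 l * minus_rho2 q l).
Definition par_P3 (z : F) := (z - z1 l) * (z - z3 l) * (z - z5 l).

Lemma par_d : z6 l ^+ 2 * (minus_rho1 l * minus_rho2 q l) * u ^+ 2 =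
  z1 l * z3 l * z5 l * z6 l * par_e.
Proof.
have [n1 n2 n3 [n4 n5 n6]] := adm_zn hl.
by rewrite (minus_rho_prod qn hl) /par_e; field; rewrite n2 n4 n6 qn.
Qed.

Variables x g al be : F.
Let ze := - be / al.
Hypothesis h1 : par_P3 g * (g - z6 l) = (g ^+ 2 - x * g + u ^+ 2) * (al * g + be).
Hypothesis h2 : par_Phi g = al * g + par_e * be.
Hypothesis aln : al != 0.
Hypothesis ben : be != 0.
Hypothesis gn : g != 0.
Hypothesis gu : g ^+ 2 != u ^+ 2.
Hypothesis zu : ze ^+ 2 != u ^+ 2.
Hypothesis gz : g != ze.
Hypothesis gzu : g * ze != u ^+ 2.
Hypothesis gez : g != par_e * ze.
Hypothesis Pz : par_Phi (par_e * ze) != 0.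

Definition step_C := core_C u q (z2 l) (z4 l) (z6 l) (minus_rho1 l) (minus_rho2 q l) g al be.
Definition step_x := core_x u q (z1 l) (z2 l) (z3 l) (z4 l) (z5 l) (z6 l)
  (minus_rho1 l) (minus_rho2 q l) g al be.
Let pL := polL u (z1 l) (z3 l) (z5 l) (z6 l) x g al be.
Let pK := polK u (z1 l) (z3 l) (z5 l) (z6 l) g.
Let pKs := polKs u (z1 l) (z3 l) (z5 l) (z6 l) g.

Let n1 : z1 l != 0. Proof. by have [] := adm_zn hl. Qed.
Let n2 : z2 l != 0. Proof. by have [] := adm_zn hl. Qed.
Let n3 : z3 l != 0. Proof. by have [] := adm_zn hl. Qed.
Let n4 : z4 l != 0. Proof. by have [_ _ _ []] := adm_zn hl. Qed.
Let n5 : z5 l != 0. Proof. by have [_ _ _ []] := adm_zn hl. Qed.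
Let n6 : z6 l != 0. Proof. by have [_ _ _ []] := adm_zn hl. Qed.

Lemma step_identity z :
  (al * z + be) * pKs.[z] - u ^+ 4 * (be * z + al * u ^+ 2) * pL.[z] =
  step_C * ((g - z) * (g * z - u ^+ 2) *
    ((z ^+ 2 - u ^+ 2) * (z ^+ 2 - step_x * z + u ^+ 2))).
Proof.
have E := core_identity un u2n qn n2 n4 par_d h1 h2 aln ben gn gu zu gz gzu gez Pz.
by have := congr1 (fun p : {poly F} => p.[z]) E; rewrite core_lhsE core_rhsE.
Qed.

(** [h1] makes [polL] vanish at g, so that it is divisible by g - z. The two extreme coefficients
    are kept for the trace condition. *)
Lemma step_h : exists h : {poly F},
  [/\ top 4 h ((g - al) / z6 l),
      (forall z, z6 l * h.[z] * (g - z) = pL.[z])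
    & h.[0] = (u ^+ 2 * (z6 l * (z1 l * z3 l * z5 l)) - u ^+ 4 * be) / (g * z6 l)].
Proof.
have Lg : root pL g by apply/eqP; apply: core_L_g h1.
have /factor_theorem[p pE] := Lg.
have tL : top 5 pL (1 * 1 * 1 * (- 1) * g + 1 * al).
  apply: topD; last by apply: (@topM _ 4 1); [apply: top_wpol|apply: top_lin].
  apply: (@topM _ 4 1); last exact: top_lin.
  apply: (@topM _ 3 1); last exact: top_lin.
  by apply: (@topM _ 2 1); [apply: (@topM _ 1 1)|]; apply: top_lin.
have [sL cL] := tL.
have tp : top 4 p (al - g).
  have sp : (size p <= 5)%N.
    have [->|pn] := eqVneq p 0; first by rewrite size_poly0.
    move: sL; rewrite pE size_mul ?polyXsubC_eq0 // size_XsubC addn2 /=.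
    by rewrite ltnS.
  split=> //; have sX : (size ('X - g%:P)%R <= 2)%N by rewrite size_XsubC.
  have := @coefM_top _ p ('X - g%:P) 4 1 sp sX; rewrite -pE cL coefB coefX coefC /=.
  by rewrite subr0 => E; rewrite -[LHS]mulr1 -E; ring.
have hE z : z6 l * (- (z6 l)^-1 *: p).[z] * (g - z) = pL.[z].
  by rewrite pE hornerM hornerXsubC hornerZ; field; rewrite n6.
exists (- (z6 l)^-1 *: p); split=> //.
  have -> : (g - al) / z6 l = - (z6 l)^-1 * (al - g) by ring.
  exact: topZ tp.
have gz6 : g * z6 l != 0 by rewrite mulf_neq0.
apply: (mulIf gz6); rewrite divfK // -[RHS](_ : pL.[0] = _).
  by rewrite -hE; ring.
by rewrite polLE polKE; ring.
Qed.

Section WithH.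
Variable h : {poly F}.
Hypothesis th : top 4 h ((g - al) / z6 l).
Hypothesis hE : forall z, z6 l * h.[z] * (g - z) = pL.[z].
Hypothesis h0 : h.[0] =
  (u ^+ 2 * (z6 l * (z1 l * z3 l * z5 l)) - u ^+ 4 * be) / (g * z6 l).

Definition hs := recip u 4 h.
(** The factor of [sb12] for which the term with the two [wpol] in h h* cancels from the
    determinant. *)
Definition kap := step_C / (z6 l ^+ 2 * z2 l * z4 l * u ^+ 2).

Lemma hsE z : z != 0 -> hs.[z] = z ^+ 4 * h.[u ^+ 2 / z].
Proof. by move=> zn; apply: recipE => //; case: th. Qed.

Lemma h_reflect z : z != 0 -> h.[u ^+ 2 / z] = hs.[z] / z ^+ 4.
Proof. by move=> zn; rewrite hsE // [RHS]mulrC mulKf // expf_neq0. Qed.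

Lemma hs_reflect z : z != 0 -> hs.[u ^+ 2 / z] = u ^+ 8 * h.[z] / z ^+ 4.
Proof.
move=> zn; have wn : u ^+ 2 / z != 0 by rewrite mulf_neq0 ?invr_eq0 ?expf_neq0.
rewrite hsE // (_ : u ^+ 2 / (u ^+ 2 / z) = z); last by field; rewrite un zn.
by move: h.[z] => a; field.
Qed.

Lemma hs_top : (size hs <= 5)%N /\ hs`_4 = h.[0].
Proof.
split; first exact: size_poly.
by rewrite coef_poly /= subnn muln0 expr0 mulr1 horner_coef0.
Qed.

(** Multiplying L by its reversal L* gives z6^2 h h* times (g - z)(g z - u^2). The core identity
    shows that this factor also divides the remainder L L* - K K*. *)
Lemma hhs z :
  z6 l ^+ 2 * (h.[z] * hs.[z]) =
  u ^+ 2 * (z1 l * z3 l * z5 l * z6 l) *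
  ((z - z1 l) * (z - z3 l) * (z - z5 l) * (z - z6 l) * ((z - u ^+ 2 / z1 l) *
   (z - u ^+ 2 / z3 l) * (z - u ^+ 2 / z5 l) * (z - u ^+ 2 / z6 l)))
  + step_C * ((wpol u x).[z] * (wpol u step_x).[z]).
Proof.
pose A := ('X - (z1 l)%:P) * ('X - (z3 l)%:P) * ('X - (z5 l)%:P) * ('X - (z6 l)%:P) *
   (('X - (u ^+ 2 / z1 l)%:P) * ('X - (u ^+ 2 / z3 l)%:P) * ('X - (u ^+ 2 / z5 l)%:P)
   * ('X - (u ^+ 2 / z6 l)%:P)).
suff E : z6 l ^+ 2 *: (h * hs) = (u ^+ 2 * (z1 l * z3 l * z5 l * z6 l)) *: A
     + step_C *: (wpol u x * wpol u step_x).
  have := congr1 (fun p : {poly F} => p.[z]) E.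
  rewrite hornerZ hornerM hornerD !hornerZ (hornerM (wpol u x)) => ->.
  by rewrite /A !hornerM !hornerXsubC.
apply: poly_eq_cofinite.
have c := cofinite_and (cofinite_neq 0) (cofinite_and (cofinite_neq g) (cofinite_neq (u ^+ 2 / g))).
apply: cofinite_imp c => {}z [zn [zg zug]].
have gz1 : g - z != 0 by rewrite subr_eq0 eq_sym.
have gz2 : g * z - u ^+ 2 != 0.
  by rewrite subr_eq0; apply: contraNneq zug => <-; rewrite mulrC mulKf.
rewrite hornerZ hornerM hornerD !hornerZ (hornerM (wpol u x)).
have -> : A.[z] = (z - z1 l) * (z - z3 l) * (z - z5 l) * (z - z6 l) * ((z - u ^+ 2 / z1 l) *
   (z - u ^+ 2 / z3 l) * (z - u ^+ 2 / z5 l) * (z - u ^+ 2 / z6 l)).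
  by rewrite /A !hornerM !hornerXsubC.
rewrite hsE //.
have wn : u ^+ 2 / z != 0 by rewrite mulf_neq0 ?invr_eq0 ?expf_neq0.
have e1 := hE z; have e2 := hE (u ^+ 2 / z).
have e3 : z ^+ 5 * pL.[u ^+ 2 / z] =
    pKs.[z] - u ^+ 4 * (wpol u x).[z] * (al * u ^+ 2 + be * z).
  rewrite polLE mulrDr -polKs_reflect // wpolE.
  by move: pKs.[z] => k; field.
have e4 := step_identity z.
have e5 : pL.[z] = pK.[z] + (wpol u x).[z] * (al * z + be) by rewrite polLE wpolE.
have e6 : pK.[z] * pKs.[z] = (g - z) * (g * z - u ^+ 2) *
  (u ^+ 2 * (z1 l * z3 l * z5 l * z6 l) *
  ((z - z1 l) * (z - z3 l) * (z - z5 l) * (z - z6 l) * ((z - u ^+ 2 / z1 l) *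
   (z - u ^+ 2 / z3 l) * (z - u ^+ 2 / z5 l) * (z - u ^+ 2 / z6 l)))).
  rewrite polKE polKsE polP3sE.
  have B a : a != 0 -> u ^+ 2 - a * z = - a * (z - u ^+ 2 / a) by move=> an; field.
  rewrite (B (z1 l)) // (B (z3 l)) // (B (z5 l)) //.
  have -> : z6 l * z - u ^+ 2 = z6 l * (z - u ^+ 2 / z6 l) by field.
  have -> : z6 l - z = - (z - z6 l) by rewrite opprB.
  move: (z - u ^+ 2 / _) (z - u ^+ 2 / _) (z - u ^+ 2 / _) (z - u ^+ 2 / _) => b1 b3 b5 b6.
  move: (z - z1 l) (z - z3 l) (z - z5 l) (z - z6 l) => a1 a3 a5 a6.
  by ring.
have W : (wpol u step_x).[z] = (z ^+ 2 - u ^+ 2) * (z ^+ 2 - step_x * z + u ^+ 2) by rewrite wpolE.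
rewrite -W in e4.
apply: (mulIf (mulf_neq0 gz1 gz2)).
transitivity (pL.[z] * (z ^+ 5 * pL.[u ^+ 2 / z])).
  rewrite -e1 -e2; move: h.[z] h.[_] => a b; field; by [].
rewrite e3 {1}e5.
transitivity (pK.[z] * pKs.[z] + (wpol u x).[z] *
   ((al * z + be) * pKs.[z] - u ^+ 4 * (be * z + al * u ^+ 2) * pL.[z])).
  by rewrite e5; ring.
by rewrite e4 e6; ring.
Qed.

(* s.. and e.. are the entries of the connection before and after the step. *)
Definition sb11 := ('X - (u ^+ 2 / z2 l)%:P) * ('X - (u ^+ 2 / z4 l)%:P) * h.
Definition sb22 := (u ^+ 2 * z2 l * z4 l)^-1 *: (('X - (z2 l)%:P) * ('X - (z4 l)%:P) * hs).
Definition sb12 := kap *: (('X - (u ^+ 2 / z2 l)%:P) * ('X - (u ^+ 2 / z4 l)%:P) *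
  (('X - (z2 l)%:P) * ('X - (z4 l)%:P)) * wpol u step_x).

Definition eb11 := (q ^+ 2 * u ^+ 2 * z2 l * z4 l)^-1 *:
  (('X - (q * z2 l)%:P) * ('X - (q * z4 l)%:P) * hs).
Definition eb22 :=
  ('X - (u ^+ 2 / (q * z2 l))%:P) * ('X - (u ^+ 2 / (q * z4 l))%:P) * h.
Definition eb12 := (kap / q ^+ 2) *:
  (('X - (u ^+ 2 / (q * z2 l))%:P) * ('X - (u ^+ 2 / (q * z4 l))%:P) *
  (('X - (q * z2 l)%:P) * ('X - (q * z4 l)%:P)) * wpol u x).

Lemma top_XsubC (a : F) : top 1 ('X - a%:P) 1.
Proof.
split; first by rewrite size_XsubC.
by rewrite coefB coefX coefC subr0.
Qed.

Lemma recip_wpol y : recip u 4 (wpol u y) = - u ^+ 4 *: wpol u y.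
Proof.
have [s _] := top_wpol u y; apply: recip_eq => //.
apply: cofinite_imp (cofinite_neq 0) => z zn.
by rewrite hornerZ !wpolE; field.
Qed.

(** At such v the [wpol] term vanishes and g v - u^2 = v (g - v), so that g - v cancels. *)
Lemma h_at v : v ^+ 2 = u ^+ 2 -> z6 l * h.[v] = par_P3 v * (z6 l - v) * v.
Proof.
move=> vu; have gv : g - v != 0.
  by rewrite subr_eq0; apply: contraNneq gu => ->; rewrite vu.
apply: (mulIf gv); rewrite hE polLE polKE -vu /par_P3; ring.
Qed.

Lemma hs_at v : v ^+ 2 = u ^+ 2 -> hs.[v] = u ^+ 4 * h.[v].
Proof.
move=> vu; have vn : v != 0.
  by apply: contra_eq_neq vu => ->; rewrite expr0n eq_sym expf_eq0 (negbTE un) andbF.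
have e4 : v ^+ 4 = u ^+ 4 by rewrite (exprM v 2 2) vu -exprM.
have ev : u ^+ 2 / v = v by rewrite -vu expr2 mulfK.
by rewrite hsE // e4 ev.
Qed.

(** Multiplied by z6 g, this is [h2], once z1 z3 z5 is expressed through the exponents by
    [par_d]. *)
Lemma step_trace : h`_4 + h.[0] / (u ^+ 2 * z2 l * z4 l) / q = minus_rho1 l + minus_rho2 q l.
Proof.
have [_ ->] := th; rewrite h0.
have z6g : z6 l * g != 0 by rewrite mulf_neq0.
apply: (mulIf z6g).
have := h2; have := par_d; rewrite /par_Phi => e1 e2.
have E : z1 l * z3 l * z5 l * z6 l = z6 l ^+ 2 * (minus_rho1 l * minus_rho2 q l) * u ^+ 2 / par_e.
  by rewrite e1 mulfK // /par_e !mulf_neq0 ?expf_neq0 ?invr_eq0 ?mulf_neq0.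
rewrite (_ : z6 l * (z1 l * z3 l * z5 l) = z1 l * z3 l * z5 l * z6 l); last by ring.
rewrite E.
have -> : (minus_rho1 l + minus_rho2 q l) * (z6 l * g) =
   g ^+ 2 + z6 l ^+ 2 * (minus_rho1 l * minus_rho2 q l) - (al * g + par_e * be).
  by rewrite -e2; ring.
by rewrite /par_e; field; rewrite ?n2 ?n4 ?n6 ?qn ?gn ?un.
Qed.

Let c0 := cofinite_neq (0 : F).

Lemma sb11E z : sb11.[z] = (z - u ^+ 2 / z2 l) * (z - u ^+ 2 / z4 l) * h.[z].
Proof. by rewrite /sb11 !hornerM !hornerXsubC. Qed.

Lemma sb22E z : sb22.[z] = (u ^+ 2 * z2 l * z4 l)^-1 * ((z - z2 l) * (z - z4 l) * hs.[z]).
Proof. by rewrite /sb22 hornerZ !hornerM !hornerXsubC. Qed.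

Lemma sb12E z : sb12.[z] = kap * ((z - u ^+ 2 / z2 l) * (z - u ^+ 2 / z4 l) *
  ((z - z2 l) * (z - z4 l)) * (wpol u step_x).[z]).
Proof. by rewrite /sb12 hornerZ (hornerM _ (wpol _ _)) !hornerM !hornerXsubC. Qed.

Lemma eb11E z : eb11.[z] = (q ^+ 2 * u ^+ 2 * z2 l * z4 l)^-1 *
  ((z - q * z2 l) * (z - q * z4 l) * hs.[z]).
Proof. by rewrite /eb11 hornerZ !hornerM !hornerXsubC. Qed.

Lemma eb22E z : eb22.[z] = (z - u ^+ 2 / (q * z2 l)) * (z - u ^+ 2 / (q * z4 l)) * h.[z].
Proof. by rewrite /eb22 !hornerM !hornerXsubC. Qed.

Lemma eb12E z : eb12.[z] = kap / q ^+ 2 * ((z - u ^+ 2 / (q * z2 l)) *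
  (z - u ^+ 2 / (q * z4 l)) * ((z - q * z2 l) * (z - q * z4 l)) * (wpol u x).[z]).
Proof. by rewrite /eb12 hornerZ (hornerM _ (wpol _ _)) !hornerM !hornerXsubC. Qed.

Lemma hhs' z : h.[z] * hs.[z] = (u ^+ 2 * (z1 l * z3 l * z5 l * z6 l) *
  ((z - z1 l) * (z - z3 l) * (z - z5 l) * (z - z6 l) * ((z - u ^+ 2 / z1 l) *
   (z - u ^+ 2 / z3 l) * (z - u ^+ 2 / z5 l) * (z - u ^+ 2 / z6 l)))
  + step_C * ((wpol u x).[z] * (wpol u step_x).[z])) / z6 l ^+ 2.
Proof. by rewrite -hhs [RHS]mulrC mulKf // expf_neq0. Qed.

Lemma reflect_pair a z : a != 0 -> z != 0 ->
  (u ^+ 2 / z - u ^+ 2 / a = - (u ^+ 2 / (a * z)) * (z - a)) *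
  (u ^+ 2 / z - a = - (a / z) * (z - u ^+ 2 / a)).
Proof. by move=> an zn; split; field; rewrite ?an ?zn. Qed.

Lemma wpol_reflect y z : z != 0 -> (wpol u y).[u ^+ 2 / z] = - u ^+ 4 * (wpol u y).[z] / z ^+ 4.
Proof. by move=> zn; rewrite !wpolE; field. Qed.

Lemma step_conn : poly_conn u q l sb11 sb12 (wpol u x) sb22.
Proof.
have [sh ch] := th; have [shs chs] := hs_top.
have t11 : top 6 sb11 (1 * 1 * h`_4).
  by apply: (@topM _ 2 4); [apply: (@topM _ 1 1); apply: top_XsubC|split].
have t22 : top 6 sb22 ((u ^+ 2 * z2 l * z4 l)^-1 * (1 * 1 * h.[0])).
  by apply: topZ; apply: (@topM _ 2 4); [apply: (@topM _ 1 1); apply: top_XsubC|split].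
have [sw _] := top_wpol u x.
have t12 : top 8 sb12 (kap * (1 * 1 * (1 * 1) * 1)).
  apply: topZ; apply: (@topM _ 4 4); last exact: top_wpol.
  by apply: (@topM _ 2 2); apply: (@topM _ 1 1); apply: top_XsubC.
have at_u v : v ^+ 2 = u ^+ 2 -> sb11.[v] = (Ppol u l).[v].
  move=> vu; apply: (mulfI n6).
  rewrite sb11E PpolE mulrCA h_at // /par_P3 -vu.
  by field; rewrite ?n2 ?n4 ?n6.
split.
- by split=> //; [case: t11|case: t12|case: t22].
- apply: poly_eq_cofinite; apply: cofinite_imp c0 => z zn.
  rewrite (hornerM (Ppol u l)) PpolE QpolE hornerD hornerN (hornerM sb11) (hornerM sb12).
  rewrite sb11E sb12E sb22E.
  (* The four linear factors at z2, z4 and their reflections are common to both products; what is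
     left is governed by h h*. *)
  transitivity ((z - u ^+ 2 / z2 l) * (z - u ^+ 2 / z4 l) * ((z - z2 l) * (z - z4 l)) *
     ((h.[z] * hs.[z]) / (u ^+ 2 * z2 l * z4 l)
     - kap * ((wpol u x).[z] * (wpol u step_x).[z]))).
    by ring.
  rewrite hhs' /kap; move: step_C (wpol u x).[z] (wpol u step_x).[z] => C w w'.
  move: (z - u ^+ 2 / _) (z - u ^+ 2 / _) (z - u ^+ 2 / _) (z - u ^+ 2 / _)
        (z - u ^+ 2 / _) (z - u ^+ 2 / _) => a1 a2 a3 a4 a5 a6.
  move: (z - z1 l) (z - z2 l) (z - z3 l) (z - z4 l) (z - z5 l) (z - z6 l).
  by move=> b1 b2 b3 b4 b5 b6; field; rewrite ?un ?n2 ?n4 ?n6.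
- split; [| exact: recip_wpol |]; apply: recip_eq.
  + by case: t11.
  + apply: cofinite_imp c0 => z zn.
    rewrite sb11E hornerZ sb22E h_reflect // !(reflect_pair n2 zn) !(reflect_pair n4 zn).
    by field; rewrite ?n2 ?n4 ?zn ?un.
  + by case: t12.
  + apply: cofinite_imp c0 => z zn.
    rewrite (hornerZ _ sb12) !sb12E wpol_reflect // !(reflect_pair n2 zn) !(reflect_pair n4 zn).
    by move: (wpol _ _).[z] => w; field; rewrite ?n2 ?n4 ?zn.
- by split; apply: at_u; rewrite ?sqrrN.
- have [_ ->] := t11; have [_ ->] := t22; rewrite -step_trace.
  by rewrite !mul1r [_^-1 * _]mulrC.
Qed.

Lemma evolve_step_conn : poly_conn u q (evolve q l) eb11 eb12 (wpol u step_x) eb22.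
Proof.
have [sh ch] := th; have [shs chs] := hs_top.
have t11 : top 6 eb11 ((q ^+ 2 * u ^+ 2 * z2 l * z4 l)^-1 * (1 * 1 * h.[0])).
  by apply: topZ; apply: (@topM _ 2 4); [apply: (@topM _ 1 1); apply: top_XsubC|split].
have t22 : top 6 eb22 (1 * 1 * h`_4).
  by apply: (@topM _ 2 4); [apply: (@topM _ 1 1); apply: top_XsubC|split].
have [sw _] := top_wpol u step_x.
have t12 : top 8 eb12 (kap / q ^+ 2 * (1 * 1 * (1 * 1) * 1)).
  apply: topZ; apply: (@topM _ 4 4); last exact: top_wpol.
  by apply: (@topM _ 2 2); apply: (@topM _ 1 1); apply: top_XsubC.
have at_u v : v ^+ 2 = u ^+ 2 -> eb11.[v] = (Ppol u (evolve q l)).[v].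
  move=> vu; apply: (mulfI n6).
  have -> : z6 l * eb11.[v] = (q ^+ 2 * u ^+ 2 * z2 l * z4 l)^-1 *
     ((v - q * z2 l) * (v - q * z4 l) * (u ^+ 4 * (z6 l * h.[v]))).
    by rewrite eb11E hs_at //; ring.
  have vn : v != 0.
    by apply: contra_eq_neq vu => ->; rewrite expr0n eq_sym expf_eq0 (negbTE un) andbF.
  rewrite PpolE /= h_at // /par_P3 (exprM u 2 2) -vu.
  by field; rewrite ?vn ?n2 ?n4 ?n6 ?qn.
have m2 : q * z2 l != 0 by rewrite mulf_neq0.
have m4 : q * z4 l != 0 by rewrite mulf_neq0.
split.
- by split=> //; [case: t11|case: t12|case: t22].
- apply: poly_eq_cofinite; apply: cofinite_imp c0 => z zn.
  rewrite (hornerM (Ppol u (evolve q l))) PpolE QpolE /= hornerD hornerN (hornerM eb11) (hornerM eb12).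
  rewrite eb11E eb12E eb22E.
  transitivity ((z - u ^+ 2 / (q * z2 l)) * (z - u ^+ 2 / (q * z4 l)) *
     ((z - q * z2 l) * (z - q * z4 l)) *
     ((h.[z] * hs.[z]) / (q ^+ 2 * u ^+ 2 * z2 l * z4 l)
     - kap / q ^+ 2 * ((wpol u x).[z] * (wpol u step_x).[z]))).
    by ring.
  rewrite hhs' /kap; move: step_C (wpol u x).[z] (wpol u step_x).[z] => C w w'.
  move: (z - u ^+ 2 / _) (z - u ^+ 2 / _) (z - u ^+ 2 / _) (z - u ^+ 2 / _)
        (z - u ^+ 2 / _) (z - u ^+ 2 / _) => a1 a2 a3 a4 a5 a6.
  move: (z - z1 l) (z - q * z2 l) (z - z3 l) (z - q * z4 l) (z - z5 l) (z - z6 l).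
  by move=> b1 b2 b3 b4 b5 b6; field; rewrite ?un ?n2 ?n4 ?n6 ?qn.
- split; [| exact: recip_wpol |]; apply: recip_eq.
  + by case: t11.
  + apply: cofinite_imp c0 => z zn.
    rewrite eb11E hornerZ eb22E hs_reflect // !(reflect_pair m2 zn) !(reflect_pair m4 zn).
    by field; rewrite ?qn ?n2 ?n4 ?zn ?un.
  + by case: t12.
  + apply: cofinite_imp c0 => z zn.
    rewrite (hornerZ _ eb12) !eb12E wpol_reflect // !(reflect_pair m2 zn) !(reflect_pair m4 zn).
    by move: (wpol _ _).[z] => w; field; rewrite ?qn ?n2 ?n4 ?zn.
- by split; apply: at_u; rewrite ?sqrrN.
- have [_ ->] := t11; have [_ ->] := t22.
  (* Both exponents are multiplied by q^-1: the first because d is, the second because z2 z4 d is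
     multiplied by q. *)
  have -> : minus_rho1 (evolve q l) + minus_rho2 q (evolve q l) =
     q^-1 * (minus_rho1 l + minus_rho2 q l).
    by rewrite /minus_rho1 /minus_rho2 /=; field; rewrite n2 n4 n6 qn (adm_d hl).
  rewrite -step_trace; by field; rewrite ?qn ?n2 ?n4 ?un.
Qed.

(** D(sigma(z)) vanishes at z2, z4, u^2/(q z2), u^2/(q z4), and D(sigma(z/q)) at q z2, q z4, u^2/z2,
    u^2/z4. These are the factors to be exchanged when z2 and z4 are multiplied by q. *)
Definition step_D : {poly F} :=
  ('X - (sig u q (z2 l))%:P) * ('X - (sig u q (z4 l))%:P).

(** Being antidiagonal, it exchanges the roles of [b11] and [b22] and of [b12] and [b21]; the
    constant makes the new [b21] monic. *)
Definition step_R : 'M[ratfun F]_2 := mx2 0 (of_poly step_D) (of_const kap^-1) 0.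

Lemma step_D_sig z : z != 0 -> step_D.[sig u q z] =
  (z - z2 l) * (z - u ^+ 2 / (q * z2 l)) * ((z - z4 l) * (z - u ^+ 2 / (q * z4 l))) / z ^+ 2.
Proof.
move=> zn; rewrite /step_D !hornerM !hornerXsubC /sig.
have E a : a != 0 -> z + u ^+ 2 / (q * z) - (a + u ^+ 2 / (q * a)) =
   (z - a) * (z - u ^+ 2 / (q * a)) / z.
  by move=> an; field; rewrite zn an qn.
by rewrite !E //; field; rewrite ?zn ?n2 ?n4 ?qn.
Qed.

Lemma step_D_sigq z : z != 0 -> step_D.[sig u q (z / q)] =
  (z - q * z2 l) * (z - u ^+ 2 / z2 l) * ((z - q * z4 l) * (z - u ^+ 2 / z4 l)) /
  (q ^+ 2 * z ^+ 2).
Proof.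
move=> zn; rewrite step_D_sig ?mulf_neq0 ?invr_eq0 //.
by field; rewrite ?zn ?n2 ?n4 ?qn.
Qed.

Hypothesis Cn : step_C != 0.

Lemma kap_neq0 : kap != 0.
Proof.
apply: mulf_neq0; first exact: Cn.
by rewrite invr_eq0 !mulf_neq0 ?expf_neq0.
Qed.

Lemma step_R_unit : step_R \in unitmx.
Proof.
rewrite unit_mx2 mul0r sub0r oppr_eq0; apply: mulf_neq0.
  by rewrite of_poly_eq0 mulf_neq0 // polyXsubC_eq0.
by apply: of_const_neq0; rewrite invr_eq0 kap_neq0.
Qed.

Lemma step_R_value z : mx_has_value step_R z (mx2 0 step_D.[z] kap^-1 0).
Proof.
apply: mx2P; rewrite !mxE /=.
- exact: has_value0.
- exact: has_value_poly.
- exact: has_value_const.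
- exact: has_value0.
Qed.

Lemma step_gauge :
  gauge u q step_R (conn_mx u l sb11 sb12 ('X * wpol u x) sb22) =
  conn_mx u (evolve q l) eb11 eb12 ('X * wpol u step_x) eb22.
Proof.
apply: mx_eq_values.
apply: cofinite_imp (cofinite_and (cofinite_good un hl) (cofinite_good un hl')) => z.
move=> [[zn Pz' Qz' _] [_ Pe' _ _]].
exists (conn_at u (evolve q l) eb11 eb12 (wpol u step_x) eb22 z); last exact: conn_value.
have kn := kap_neq0.
have := Pz'; rewrite PpolE !mulf_eq0 !negb_or => /andP[/andP[/andP[/andP[/andP[a1n a2n] a3n] a4n] a5n] a6n].
have := Qz'; rewrite QpolE !mulf_eq0 !negb_or => /andP[_ /andP[/andP[/andP[/andP[/andP[_ b2n] _] b4n] _] _]].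
have := Pe'; rewrite PpolE /= !mulf_eq0 !negb_or => /andP[/andP[/andP[/andP[/andP[_ c2n] _] c4n] _] _].
have D1 := step_D_sig zn; have Dq := step_D_sigq zn.
have uR : 0 * 0 - step_D.[sig u q z] * kap^-1 != 0.
  by rewrite mul0r sub0r oppr_eq0 D1 !mulf_neq0 ?invr_eq0 ?expf_neq0.
have uR' : mx2 0 step_D.[sig u q z] kap^-1 0 \in unitmx by rewrite unit_mx2.
have := gauge_value qn zn (step_R_value (sig u q (z / q)))
  (step_R_value (sig u q z)) uR' (conn_value sb11 sb12 (wpol u x) sb22 zn Pz').
rewrite (invmx_mx2 uR); set M := _ *m _ *m _; set N := conn_at _ _ _ _ _ _ _.
suff -> : M = N by [].
rewrite /M /N /conn_at {M N uR uR'} sb11E sb12E sb22E eb11E eb12E eb22E Dq D1.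
rewrite !PpolE /=; move: kap kn (wpol u x).[z] (wpol u step_x).[z] h.[z] hs.[z] => k kn w w' hz hz'.
move: (z - u ^+ 2 / (q * z2 l)) c2n (z - u ^+ 2 / (q * z4 l)) c4n => c2 c2n c4 c4n.
move: (z - u ^+ 2 / z2 l) a2n (z - u ^+ 2 / z4 l) a4n (z - u ^+ 2 / z6 l) a6n => a2 a2n a4 a4n a6 a6n.
move: (z - z1 l) a1n (z - z3 l) a3n (z - z5 l) a5n (z - z2 l) b2n (z - z4 l) b4n.
move=> a1 a1n a3 a3n a5 a5n b2 b2n b4 b4n.
move: (z - q * z2 l) (z - q * z4 l) => b2' b4'.
have bc : - (b2 * c2 * (b4 * c4)) != 0 by rewrite oppr_eq0 !mulf_neq0.
rewrite !scale_mx2 !mul_mx2 ?scale_mx2; congr mx2; field;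
 by rewrite ?un ?qn ?zn ?kn ?n2 ?n4 ?a1n ?a2n ?a3n ?a4n ?a5n ?a6n ?b2n ?b4n ?c2n ?c4n ?bc.
Qed.

End WithH.
End Step.

(** * The coordinates f and g in terms of t and p *)

Section CoordinateRelations.
Variable F : fieldType.
Variable u : F.
Variable l : param F.
Variables t p : F.
Hypothesis tn : t != 0.
Hypothesis pt : p * u - t != 0.
Let x := t + u ^+ 2 / t.
Let y := (p * t - u) / (p * u - t).

(** In terms of t and p, the numerator and the denominator share the factor t + u; without it g is a
    simple Moebius function of p. The same happens for f below. *)
Lemma g_num_p : g_num u l x y * ((p * u - t) * t) =
  (t + u) * (p * t * (z6 l * t - u ^+ 2) - u ^+ 2 * (z6 l - t)).
Proof. by rewrite /g_num /x /y; field; rewrite tn pt. Qed.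

Lemma g_den_p : g_den u l x y * ((p * u - t) * t) =
  (t + u) * (p * (z6 l * t - u ^+ 2) - t * (z6 l - t)).
Proof. by rewrite /g_den /x /y; field; rewrite tn pt. Qed.

Lemma f_num_p : f_num u l x y * ((p * u - t) * t ^+ 2) =
  (t + u) * (p * ((z2 l * t - u ^+ 2) * (z4 l * t - u ^+ 2) * (z6 l * t - u ^+ 2))
             - (z2 l - t) * (z4 l - t) * (z6 l - t) * u ^+ 2 * t).
Proof. by rewrite /f_num /sigma1 /sigma2 /sigma3 /x /y; field; rewrite tn pt. Qed.

Lemma f_den_p : f_den u l x y * ((p * u - t) * t ^+ 2) =
  (t + u) * (p * t * ((z2 l * t - u ^+ 2) * (z4 l * t - u ^+ 2) * (z6 l * t - u ^+ 2))
             - (z2 l - t) * (z4 l - t) * (z6 l - t) * u ^+ 4).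
Proof. by rewrite /f_den /sigma1 /sigma2 /sigma3 /x /y; field; rewrite tn pt. Qed.

End CoordinateRelations.

Section BiquadraticRelation.
Variable F : fieldType.
Variable u : F.
Variable l : param F.
Variables x y z : F.

(** Written with numerators and denominators, the relation is a polynomial identity and asks for no
    nonvanishing. *)
Lemma biquadratic_relation :
  let fn := f_num u l x y in let fd := f_den u l x y in
  let gn := g_num u l x y in let gd := g_den u l x y in
  (z2 l * z - u ^+ 2) * (z4 l * z - u ^+ 2) * (gn * z - u ^+ 2 * gd) * (fd - fn * z)
  - u ^+ 2 * (fd * z - fn * u ^+ 2) * (z2 l - z) * (z4 l - z) * (gn - gd * z) =
  (u ^+ 2 * fd * gd - z2 l * z4 l * fn * gn) * (z ^+ 2 - u ^+ 2) * (z ^+ 2 - x * z + u ^+ 2).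
Proof.
rewrite /f_num /f_den /g_num /g_den /sigma1 /sigma2 /sigma3 /=.
by ring.
Qed.

End BiquadraticRelation.

(** * Coordinates of the two connections *)

Section StepCoordinates.
Variable F : closedFieldType.
Variables u q : F.
Hypothesis un : u != 0.
Hypothesis u2n : u != - u.
Hypothesis qn : q != 0.

Lemma coord_inverse t y : t ^+ 2 != u ^+ 2 -> y * u - t != 0 ->
  let p := (y * t - u) / (y * u - t) in
  p * u - t != 0 /\ (p * t - u) / (p * u - t) = y.
Proof.
move=> tu yn /=; have tu' : t ^+ 2 - u ^+ 2 != 0 by rewrite subr_eq0.
have E : (y * t - u) / (y * u - t) * u - t = (t ^+ 2 - u ^+ 2) / (y * u - t) by field.
have En : (y * t - u) / (y * u - t) * u - t != 0.
  by rewrite E mulf_neq0 ?invr_eq0.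
by split=> //; apply: (mulIf En); rewrite divfK //; field.
Qed.

Lemma conn_has_coords l b11 b12 b22 t y : t != 0 -> t ^+ 2 != u ^+ 2 -> y * u - t != 0 ->
  (Ppol u l).[t] != 0 ->
  b11.[t] = (y * t - u) / (y * u - t) * (Ppol u l).[t] ->
  has_coords u q l (conn_mx u l b11 b12 ('X * wpol u (t + u ^+ 2 / t)) b22)
    (t + u ^+ 2 / t) y.
Proof.
move=> tn tu yn Pt bt; have [pn pE] := coord_inverse tu yn.
exists b11, b12, ('X * wpol u (t + u ^+ 2 / t)), b22, t; rewrite /= bt mulfK //.
split=> //; first by apply: gauge_equiv_refl.
by split=> //; rewrite (wpol_xpol u tn) /xpol !mulrA.
Qed.

Lemma exists_t (x : F) : exists2 t, t != 0 & x = t + u ^+ 2 / t.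
Proof.
have [t] : exists t, root ('X^2 + lin (- x) (u ^+ 2)) t.
  apply/closed_rootP; rewrite size_polyDl size_polyXn //.
  by have [s _] := top_lin (- x) (u ^+ 2).
rewrite rootE hornerD hornerXn linE => /eqP tE.
have tn : t != 0.
  apply/negP => /eqP t0; move/eqP: tE; rewrite t0 expr0n mulr0 !add0r.
  by rewrite expf_eq0 (negbTE un) andbF.
exists t => //; apply: (mulIf tn); rewrite mulrDl divfK //.
by apply/eqP; rewrite -subr_eq0 (_ : _ - _ = - (t ^+ 2 + (- x * t + u ^+ 2)));
  [rewrite tE oppr0|ring].
Qed.

Variable l : param F.
Let l' := evolve q l.
Hypothesis hl : admissible u q l.
Hypothesis hl' : admissible u q l'.

Let n1 : z1 l != 0. Proof. by have [] := adm_zn hl. Qed.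
Let n2 : z2 l != 0. Proof. by have [] := adm_zn hl. Qed.
Let n3 : z3 l != 0. Proof. by have [] := adm_zn hl. Qed.
Let n4 : z4 l != 0. Proof. by have [_ _ _ []] := adm_zn hl. Qed.
Let n5 : z5 l != 0. Proof. by have [_ _ _ []] := adm_zn hl. Qed.
Let n6 : z6 l != 0. Proof. by have [_ _ _ []] := adm_zn hl. Qed.

Variables x g al be : F.
Let ze := - be / al.
Hypothesis h1 : par_P3 l g * (g - z6 l) = (g ^+ 2 - x * g + u ^+ 2) * (al * g + be).
Hypothesis h2 : par_Phi q l g = al * g + par_e u q l * be.
Hypothesis aln : al != 0.
Hypothesis ben : be != 0.
Hypothesis gn : g != 0.
Hypothesis gu : g ^+ 2 != u ^+ 2.
Hypothesis zu : ze ^+ 2 != u ^+ 2.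
Hypothesis gz : g != ze.
Hypothesis gzu : g * ze != u ^+ 2.
Hypothesis gez : g != par_e u q l * ze.
Hypothesis Pz : par_Phi q l (par_e u q l * ze) != 0.

Let X := step_x u q l g al be.
Let C := step_C u q l g al be.

Lemma step_C_neq0 : C != 0.
Proof.
have en : par_e u q l != 0.
  by rewrite /par_e !mulf_neq0 ?expf_neq0 ?invr_eq0 ?mulf_neq0.
have gez1 : g - par_e u q l * ze != 0 by rewrite subr_eq0.
apply: mulf_neq0; last by rewrite invr_eq0; apply: mulf_neq0; [exact: en|exact: gez1].
apply: mulf_neq0; last exact: Pz.
by apply: mulf_neq0; rewrite // oppr_eq0 expf_neq0.
Qed.

Variables y y' : F.
Hypothesis xg : g ^+ 2 - x * g + u ^+ 2 != 0.
Hypothesis gd : g_den u l x y != 0.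
Hypothesis gE : g_num u l x y = g * g_den u l x y.
Hypothesis fE : ze * f_num u l' X y' = f_den u l' X y'.
Hypothesis xz : ze ^+ 2 - X * ze + u ^+ 2 != 0.
Hypothesis yy : y ^+ 2 * u ^+ 2 - x * y * u + u ^+ 2 != 0.
Hypothesis yy' : y' ^+ 2 * u ^+ 2 - X * y' * u + u ^+ 2 != 0.
Hypothesis xgood : forall t, t != 0 -> x = t + u ^+ 2 / t ->
  [/\ t ^+ 2 != u ^+ 2, (Ppol u l).[t] != 0 & (Qpol u l).[t] != 0].
Hypothesis Xgood : forall t, t != 0 -> X = t + u ^+ 2 / t ->
  [/\ t ^+ 2 != u ^+ 2, (Ppol u l').[t] != 0 & (Qpol u l').[t] != 0].

Lemma split_xpol (t s w : F) : t != 0 -> w = t + u ^+ 2 / t ->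
  s ^+ 2 - w * s + u ^+ 2 = (s - t) * (s - u ^+ 2 / t).
Proof. by move=> tn ->; field. Qed.

Lemma split_yy (t w v : F) : t != 0 -> w = t + u ^+ 2 / t ->
  v ^+ 2 * u ^+ 2 - w * v * u + u ^+ 2 = (v * u - t) * (v * u - u ^+ 2 / t).
Proof. by move=> tn ->; field. Qed.

Lemma plus_u_neq0 (t : F) : t ^+ 2 != u ^+ 2 -> t + u != 0.
Proof.
by apply: contraNneq => /eqP; rewrite addr_eq0 => /eqP->; rewrite sqrrN.
Qed.

(** The core identity divided by g - z; as both sides are polynomials, the quotient holds at z = g
    too. *)
Lemma reduced_identity h z :
  (forall z, z6 l * h.[z] * (g - z) = (polL u (z1 l) (z3 l) (z5 l) (z6 l) x g al be).[z]) ->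
  (al * z + be) * ((polP3s u (z1 l) (z3 l) (z5 l)).[z] * (z6 l * z - u ^+ 2) * u ^+ 2)
  - u ^+ 4 * (be * z + al * u ^+ 2) * (z6 l * h.[z]) =
  C * ((g * z - u ^+ 2) * (wpol u X).[z]).
Proof.
move=> hE.
pose A := lin al be * (polP3s u (z1 l) (z3 l) (z5 l) * lin (z6 l) (- u ^+ 2) * (u ^+ 2)%:P)
  - u ^+ 4 *: (lin be (al * u ^+ 2) * (z6 l *: h)).
pose B := C *: (lin g (- u ^+ 2) * wpol u X).
have AE w : A.[w] = (al * w + be) * ((polP3s u (z1 l) (z3 l) (z5 l)).[w] *
    (z6 l * w - u ^+ 2) * u ^+ 2) - u ^+ 4 * (be * w + al * u ^+ 2) * (z6 l * h.[w]).
  rewrite /A hornerD hornerN hornerZ (hornerM (lin al be)) (hornerM (lin be _)) !linE.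
  by rewrite (hornerM _ (u ^+ 2)%:P) (hornerM (polP3s _ _ _ _)) linE hornerC hornerZ; ring.
have BE w : B.[w] = C * ((g * w - u ^+ 2) * (wpol u X).[w]).
  by rewrite /B hornerZ (hornerM _ (wpol u X)) linE.
suff E : A = B by rewrite -AE E BE.
apply: poly_eq_cofinite; apply: cofinite_imp (cofinite_neq g) => w wg.
have gw : g - w != 0 by rewrite subr_eq0 eq_sym.
apply: (mulIf gw); rewrite AE BE.
have := step_identity un u2n qn hl h1 h2 aln ben gn gu zu gz gzu gez Pz w.
rewrite -/X -/C -hE polKsE wpolE => E.
transitivity ((al * w + be) * ((polP3s u (z1 l) (z3 l) (z5 l)).[w] *
  (z6 l * w - u ^+ 2) * (u ^+ 2 * (g - w))) -
  u ^+ 4 * (be * w + al * u ^+ 2) * (z6 l * h.[w] * (g - w))); first by ring.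
by rewrite E; ring.
Qed.

(** At u^2/t the factor [wpol u X] vanishes, so the reduced identity ties the reversal of h at t to
    [ze], just as [polL] ties h to g at the zeros of the old [b21]. *)
Lemma zeta_relation h t : top 4 h ((g - al) / z6 l) ->
  (forall z, z6 l * h.[z] * (g - z) = (polL u (z1 l) (z3 l) (z5 l) (z6 l) x g al be).[z]) ->
  t != 0 -> X = t + u ^+ 2 / t ->
  u ^+ 4 * (u ^+ 2 - ze * t) * par_P3 l t * (z6 l - t) = (t - ze) * (z6 l * (hs u h).[t]).
Proof.
move=> th hE tn xE; have := reduced_identity (u ^+ 2 / t) hE.
have wn : u ^+ 2 / t != 0 by rewrite mulf_neq0 ?invr_eq0 ?expf_neq0.
rewrite wpolE (split_xpol _ tn xE) subrr !mulr0 => /eqP; rewrite subr_eq0 => /eqP.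
rewrite polP3s_reflect // (_ : u ^+ 2 / (u ^+ 2 / t) = t); last by field; rewrite un tn.
rewrite -/(par_P3 l t) (h_reflect _ th) // (_ : be = - (al * ze)); last first.
  by rewrite /ze mulrC divfK // opprK.
move: (par_P3 l t) (hs u h).[t] ze => P H z E.
have k : al * u ^+ 6 / t ^+ 5 != 0 by rewrite !mulf_neq0 ?invr_eq0 ?expf_neq0.
apply: (mulfI k); set lhs := LHS.
have -> : lhs = (al * (u ^+ 2 / t) + - (al * z)) *
   ((u ^+ 2 / t) ^+ 3 * P * (z6 l * (u ^+ 2 / t) - u ^+ 2) * u ^+ 2).
  by rewrite /lhs; field.
by rewrite E; field.
Qed.

Theorem step_exists : exists A A' : 'M[ratfun F]_2,
  [/\ is_connection u q l A, has_coords u q l A x y,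
      modification u q A A', is_connection u q l' A' & has_coords u q l' A' X y'].
Proof.
have [h [th hE h0]] := step_h hl h1 gn.
have hconn := step_conn un u2n qn hl h1 h2 aln ben gn gu zu gz gzu gez Pz th hE h0.
have hconn' := evolve_step_conn un u2n qn hl h1 h2 aln ben gn gu zu gz gzu gez Pz th hE h0.
have hg := step_gauge un qn hl hl' x h step_C_neq0.
exists (conn_mx u l (sb11 u l h) (sb12 u q l g al be) ('X * wpol u x) (sb22 u l h)).
exists (conn_mx u l' (eb11 u q l h) (eb12 u q l x g al be) ('X * wpol u X) (eb22 u q l h)).
split.
- by apply/(connectionP un qn u2n hl); do 4 eexists; split; first exact: hconn.
- have [t tn xE] := exists_t x; have [tu Pt Qt] := xgood tn xE.
  have := yy; rewrite (split_yy y tn xE) mulf_eq0 negb_or => /andP[yn _].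
  have := xg; rewrite (split_xpol _ tn xE) mulf_eq0 negb_or => /andP[gt _].
  rewrite {-1}xE; move: hconn; rewrite xE => hc.
  apply: conn_has_coords => //; have [pn pE] := coord_inverse tu yn.
  set p := _ / _ in pn pE *.
  have G1 := g_num_p l tn pn; have G2 := g_den_p l tn pn.
  rewrite pE -xE in G1 G2.
  have tpu := plus_u_neq0 tu.
  (* This is [gE] expressed through p, with the common factor t + u cancelled. *)
  have rel : p * (z6 l * t - u ^+ 2) * (g - t) = (z6 l - t) * (g * t - u ^+ 2).
    apply: (mulfI tpu); apply/eqP; rewrite -subr_eq0.
    have -> : (t + u) * (p * (z6 l * t - u ^+ 2) * (g - t)) -
      (t + u) * ((z6 l - t) * (g * t - u ^+ 2)) =
      g * ((t + u) * (p * (z6 l * t - u ^+ 2) - t * (z6 l - t))) -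
      (t + u) * (p * t * (z6 l * t - u ^+ 2) - u ^+ 2 * (z6 l - t)) by ring.
    by rewrite -G1 -G2 gE; apply/eqP; ring.
  (* The [wpol] term of [polL] vanishes at t. *)
  have hz : z6 l * h.[t] * (g - t) = par_P3 l t * ((z6 l - t) * (g * t - u ^+ 2)).
    rewrite hE polLE polKE (_ : _ ^+ 2 - x * t + _ = 0) ?mulr0 ?mul0r ?addr0 -?mulrA //.
    by rewrite (split_xpol t tn xE) subrr mul0r.
  apply: (mulfI (mulf_neq0 n6 gt)).
  transitivity ((t - u ^+ 2 / z2 l) * (t - u ^+ 2 / z4 l) * (z6 l * h.[t] * (g - t))).
    by rewrite sb11E; ring.
  rewrite hz -rel PpolE /par_P3; move: (t - z1 l) (t - z3 l) (t - z5 l) => a1 a3 a5.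
  by field; rewrite n2 n4 n6.
- exists (step_R u q l g al be) => //.
  exact: step_R_unit step_C_neq0.
- by apply/(connectionP un qn u2n hl'); do 4 eexists; split; first exact: hconn'.
have [t tn xE] := exists_t X; have [tu Pt Qt] := Xgood tn xE.
have := yy'; rewrite (split_yy y' tn xE) mulf_eq0 negb_or => /andP[yn _].
have := xz; rewrite (split_xpol _ tn xE) mulf_eq0 negb_or => /andP[zt _].
have hz := zeta_relation th hE tn xE.
suff : has_coords u q l' (conn_mx u l' (eb11 u q l h) (eb12 u q l x g al be)
    ('X * wpol u (t + u ^+ 2 / t)) (eb22 u q l h)) (t + u ^+ 2 / t) y' by rewrite -xE.
apply: (conn_has_coords _ _ tn tu yn Pt); have [pn pE] := coord_inverse tu yn.
set p := _ / _ in pn pE *.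
have F1 := f_num_p l' tn pn; have F2 := f_den_p l' tn pn.
rewrite pE -xE in F1 F2.
have tpu := plus_u_neq0 tu.
pose Pi := (q * z2 l * t - u ^+ 2) * (q * z4 l * t - u ^+ 2) * (z6 l * t - u ^+ 2).
pose M := (q * z2 l - t) * (q * z4 l - t) * (z6 l - t).
(* This is [fE], that is f' = 1/ze, expressed through p at the evolved parameters. *)
have rel : p * Pi * (ze - t) = M * u ^+ 2 * (ze * t - u ^+ 2).
  apply: (mulfI tpu); apply/eqP; rewrite -subr_eq0.
  have -> : (t + u) * (p * Pi * (ze - t)) - (t + u) * (M * u ^+ 2 * (ze * t - u ^+ 2)) =
    ze * ((t + u) * (p * Pi - M * u ^+ 2 * t)) - (t + u) * (p * t * Pi - M * u ^+ 4) by ring.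
  by rewrite -F1 -F2 -fE; apply/eqP; ring.
have PE : par_P3 l t * Pi = q ^+ 2 * z2 l * z4 l * z6 l * (Ppol u l').[t].
  rewrite /Pi PpolE /par_P3 /=.
  move: (t - z1 l) (t - z3 l) (t - z5 l) => a1 a3 a5.
  by field; rewrite n2 n4 n6 qn.
have k : q ^+ 2 * z2 l * z4 l * z6 l * (ze - t) != 0.
  by rewrite mulf_neq0 ?mulf_neq0 ?expf_neq0 // subr_eq0 eq_sym -subr_eq0 -opprB oppr_eq0.
apply: (mulfI k).
transitivity (p * Pi * (ze - t) * par_P3 l t); last first.
  rewrite (_ : _ * par_P3 l t = p * (ze - t) * (par_P3 l t * Pi)); last by ring.
  by rewrite PE; ring.
rewrite rel eb11E.
transitivity (- u ^- 2 * ((t - q * z2 l) * (t - q * z4 l)) * ((t - ze) * (z6 l * (hs u h).[t]))).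
  by move: (hs u h).[t] => H; field; rewrite ?n2 ?n4 ?qn ?un.
by rewrite -hz /M; move: (par_P3 l t) => P; field; rewrite un.
Qed.

End StepCoordinates.

(** * The q-Painleve equations *)

Section PainleveStep.
Variable F : closedFieldType.
Variables u q : F.
Hypothesis un : u != 0.
Hypothesis qn : q != 0.
Variable l : param F.
Hypothesis hl : admissible u q l.
Let l' := evolve q l.
Let e := par_e u q l.
Hypothesis e1 : e != 1.
Hypothesis qe1 : e != q.

Let n1 : z1 l != 0. Proof. by have [] := adm_zn hl. Qed.
Let n2 : z2 l != 0. Proof. by have [] := adm_zn hl. Qed.
Let n3 : z3 l != 0. Proof. by have [] := adm_zn hl. Qed.
Let n4 : z4 l != 0. Proof. by have [_ _ _ []] := adm_zn hl. Qed.
Let n5 : z5 l != 0. Proof. by have [_ _ _ []] := adm_zn hl. Qed.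
Let n6 : z6 l != 0. Proof. by have [_ _ _ []] := adm_zn hl. Qed.

Let d1 := minus_rho1 l.
Let d2 := minus_rho2 q l.
Let en : e != 0.
Proof. by rewrite /e /par_e !mulf_neq0 ?expf_neq0 ?invr_eq0 ?mulf_neq0. Qed.
Let dn1 : d1 != 0. Proof. by have [] := minus_rho_neq0 qn hl. Qed.
Let dn2 : d2 != 0. Proof. by have [] := minus_rho_neq0 qn hl. Qed.

(** Each q-Painleve equation prescribes such a Moebius function of its unknown, so one known
    solution is the only one. *)
Lemma moebius_eq (a b k c : F) : k != 1 -> a - 1 != 0 -> b - 1 != 0 -> c != 0 ->
  c * ((a - k) / (a - 1)) = c * ((b - k) / (b - 1)) -> a = b.
Proof.
move=> k1 an bn cn /(mulfI cn) /eqP; rewrite eqr_div // => /eqP E.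
have k1' : k - 1 != 0 by rewrite subr_eq0.
apply: (mulIf k1'); apply/eqP; rewrite -subr_eq0.
rewrite (_ : _ - _ = (a - k) * (b - 1) - (b - k) * (a - 1)); last by ring.
by rewrite E subrr.
Qed.

Lemma prod_1_5 (f : nat -> F) : \prod_(1 <= i < 5) f i = f 1 * (f 2 * (f 3 * f 4)).
Proof. by rewrite /index_iota /= !big_cons big_nil mulr1. Qed.

Lemma prod_5_9 (f : nat -> F) : \prod_(5 <= i < 9) f i = f 5 * (f 6 * (f 7 * f 8)).
Proof. by rewrite /index_iota /= !big_cons big_nil mulr1. Qed.

Variables f g ze gb x X al : F.
Hypothesis aln : al != 0.
Hypothesis zn : ze != 0.
Hypothesis gn : g != 0.
Hypothesis fg1 : f * g - 1 != 0.
Hypothesis fgk : f * g != u ^+ 2 / (z2 l * z4 l).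
Hypothesis gz : g - ze != 0.
Hypothesis gez : g - e * ze != 0.
Hypothesis G0 : g ^+ 2 - x * g + u ^+ 2 != 0.
Hypothesis Z0 : ze ^+ 2 - X * ze + u ^+ 2 != 0.
Hypothesis gb1 : gb - ze != 0.
Hypothesis Pg : par_P3 l g * (g - z6 l) != 0.
Hypothesis Pze : par_P3 l ze * (z6 l - ze) != 0.
Hypothesis R0 : par_P3 l g * (g - z6 l) = (g ^+ 2 - x * g + u ^+ 2) * (al * (g - ze)).
Hypothesis R0' : par_Phi q l g = al * (g - e * ze).
Hypothesis R1 : (g ^+ 2 - x * g + u ^+ 2) * (u ^+ 2 - z2 l * z4 l * f * g) =
  (z2 l * g - u ^+ 2) * (z4 l * g - u ^+ 2) * (1 - f * g).
Hypothesis R2 : (q * z2 l * (q * z4 l) * gb - u ^+ 2 * ze) * (ze ^+ 2 - X * ze + u ^+ 2) =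
  u ^+ 2 * (q * z2 l - ze) * (q * z4 l - ze) * (gb - ze).
Hypothesis R3 : (ze ^+ 2 - X * ze + u ^+ 2) * ((g - ze) * par_Phi q l (e * ze)) =
  - e * (par_P3 l ze * (z6 l - ze)) * (g - e * ze).

Lemma nu_prod1 : \prod_(1 <= i < 5) (g - (nu (matching u q l) i)^-1) =
  par_P3 l g * (g - z6 l).
Proof. by rewrite prod_1_5 /= !invrK /par_P3; ring. Qed.

Lemma nu_prod2 : \prod_(5 <= i < 9)
  (g - nu (matching u q l) i / kappa2 (matching u q l)) =
  (g - u ^+ 2 / z2 l) * (g - u ^+ 2 / z4 l) * par_Phi q l g.
Proof.
rewrite prod_5_9 /= /par_Phi -/d1 -/d2.
have -> : u * z4 l / z2 l / (z4 l / u) = u ^+ 2 / z2 l by field; rewrite ?un ?n2 ?n4.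
have -> : u / (z4 l / u) = u ^+ 2 / z4 l by field; rewrite ?un ?n4.
have E a : a * z4 l * z6 l / u / (z4 l / u) = z6 l * a by field; rewrite ?un ?n4.
by rewrite !E; ring.
Qed.

Lemma kappa_ratio : kappa1 (matching u q l) / kappa2 (matching u q l) = u ^+ 2 / (z2 l * z4 l).
Proof. by rewrite /=; field; rewrite ?un ?n2 ?n4. Qed.

Lemma kappa_ratio_q : kappa1 (matching u q l) / (q * kappa2 (matching u q l)) = e.
Proof. by rewrite /= /e /par_e; field; rewrite ?un ?n2 ?n4 ?qn. Qed.

Lemma first_factor : (f * g - u ^+ 2 / (z2 l * z4 l)) / (f * g - 1) =
  (g - u ^+ 2 / z2 l) * (g - u ^+ 2 / z4 l) / (g ^+ 2 - x * g + u ^+ 2).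
Proof.
apply/eqP; rewrite eqr_div //; apply/eqP.
have zz : z2 l * z4 l != 0 by rewrite mulf_neq0.
apply: (mulfI zz); apply: oppr_inj.
transitivity ((g ^+ 2 - x * g + u ^+ 2) * (u ^+ 2 - z2 l * z4 l * f * g)).
  by field; rewrite ?n2 ?n4.
by rewrite R1; field; rewrite ?n2 ?n4.
Qed.

(** [R0] and [R0'] share the factor al, which drops out of the quotient of Phi(g) by P3(g)(g -
    z6). *)
Lemma qP_eq1_value :
  (g - u ^+ 2 / z2 l) * (g - u ^+ 2 / z4 l) / (g ^+ 2 - x * g + u ^+ 2) *
  ((ze^-1 * g - e) / (ze^-1 * g - 1)) =
  (g - u ^+ 2 / z2 l) * (g - u ^+ 2 / z4 l) * par_Phi q l g / (par_P3 l g * (g - z6 l)).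
Proof.
rewrite R0 R0'; move: e gez => e' gez'.
have -> : (ze^-1 * g - e') / (ze^-1 * g - 1) = (g - e' * ze) / (g - ze) by field; rewrite gz zn.
by move: G0 => G0'; move: (g ^+ 2 - _ + _) G0' => G Gn; field; rewrite ?G0 ?aln ?gz ?n2 ?n4 ?Gn.
Qed.

Lemma ze_g1 : ze^-1 * g - 1 != 0.
Proof.
by rewrite subr_eq0 mulrC -(inj_eq (mulIf zn)) divfK // mul1r -subr_eq0.
Qed.

(** [first_factor] identifies the part of the equation without [fn], and [qP_eq1_value] shows that
    ze^-1 solves what is left; uniqueness rests on e <> 1. *)
Lemma qP_eq1_iff fn : qP_eq1 q (matching u q l) f g fn <-> fn = ze^-1.
Proof.
have fgk' : f * g - u ^+ 2 / (z2 l * z4 l) != 0 by rewrite subr_eq0.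
have c0 : (f * g - u ^+ 2 / (z2 l * z4 l)) / (f * g - 1) != 0 by rewrite mulf_neq0 ?invr_eq0.
rewrite /qP_eq1 nu_prod1 nu_prod2 kappa_ratio kappa_ratio_q.
have E fn' : (f * g - u ^+ 2 / (z2 l * z4 l)) * (fn' * g - e) / ((f * g - 1) * (fn' * g - 1)) =
  (f * g - u ^+ 2 / (z2 l * z4 l)) / (f * g - 1) * ((fn' * g - e) / (fn' * g - 1)).
  by rewrite mulf_div.
rewrite E first_factor -qP_eq1_value; split=> [[h1 _ h]|->].
  have fn1 : fn * g - 1 != 0 by apply: contraNneq h1 => ->; rewrite mulr0.
  apply: (mulIf gn); apply: (@moebius_eq _ _ e _ e1 fn1 ze_g1 _ h).
  by rewrite -first_factor.
by split=> //; rewrite mulf_neq0 // ze_g1.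
Qed.

Let k' := qP_evolve q (matching u q l).
Let fb := ze^-1.

Lemma nu_prod3 : \prod_(1 <= i < 5) (fb - nu k' i) =
  - (par_P3 l ze * (z6 l - ze)) / (ze ^+ 4 * (z1 l * z3 l * z5 l * z6 l)).
Proof. by rewrite prod_1_5 /= /fb /par_P3; field; rewrite ?zn ?n1 ?n3 ?n5 ?n6. Qed.

Lemma nu_prod4 : \prod_(5 <= i < 9) (fb - kappa1 k' / nu k' i) =
  (q * z2 l - ze) * (q * z4 l - ze) * par_Phi q l (e * ze) /
  (ze ^+ 4 * (q ^+ 2 * z2 l * z4 l * (z6 l ^+ 2 * (d1 * d2)))).
Proof.
rewrite prod_5_9 /= /par_Phi -/d1 -/d2.
have -> : u / z2 l / q / (u * z4 l / z2 l) = (q * z4 l)^-1 by field; rewrite ?un ?n2 ?n4 ?qn.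
have -> : u / z2 l / q / u = (q * z2 l)^-1 by field; rewrite ?un ?n2 ?n4 ?qn.
have E a : a != 0 -> u / z2 l / q / (a * z4 l * z6 l / u) = e / (z6 l * a).
  by move=> an; rewrite /e /par_e; field; rewrite ?un ?n2 ?n4 ?n6 ?qn ?an.
rewrite !E // /fb; move: d1 dn1 d2 dn2 e => a an b bn e'.
by field; rewrite ?zn ?n2 ?n4 ?n6 ?qn ?an ?bn.
Qed.

Lemma second_factor : (fb * gb - e / q) / (fb * gb - 1) =
  e / q * ((q * z2 l - ze) * (q * z4 l - ze)) / (ze ^+ 2 - X * ze + u ^+ 2).
Proof.
have -> : (fb * gb - e / q) / (fb * gb - 1) = (gb - e / q * ze) / (gb - ze).
  by rewrite /fb; move: e => e'; field; rewrite ?zn ?gb1 ?qn.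
apply/eqP; rewrite eqr_div //; apply/eqP.
have zz : q ^+ 2 * z2 l * z4 l != 0 by rewrite !mulf_neq0 ?expf_neq0.
apply: (mulfI zz).
transitivity ((q * z2 l * (q * z4 l) * gb - u ^+ 2 * ze) * (ze ^+ 2 - X * ze + u ^+ 2)).
  by rewrite /e /par_e; field; rewrite ?n2 ?n4 ?qn.
by rewrite R2 /e /par_e; field; rewrite ?n2 ?n4 ?qn.
Qed.

(** [R3] gives the quotient of Phi(e ze) by P3(ze)(z6 - ze), and [par_d] matches the constants of
    the two products. *)
Lemma qP_eq2_value :
  e / q * ((q * z2 l - ze) * (q * z4 l - ze)) / (ze ^+ 2 - X * ze + u ^+ 2) *
  ((fb * g - e) / (fb * g - 1)) =
  ((q * z2 l - ze) * (q * z4 l - ze) * par_Phi q l (e * ze) /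
  (ze ^+ 4 * (q ^+ 2 * z2 l * z4 l * (z6 l ^+ 2 * (d1 * d2))))) /
  (- (par_P3 l ze * (z6 l - ze)) / (ze ^+ 4 * (z1 l * z3 l * z5 l * z6 l))).
Proof.
have -> : (fb * g - e) / (fb * g - 1) = (g - e * ze) / (g - ze).
  by rewrite /fb; move: e => e'; field; rewrite ?zn ?gz.
have Pn := Pze; move: R3; move: (par_P3 l ze * (z6 l - ze)) (par_Phi q l (e * ze)) Pn => P Ph Pn R3'.
have E : z6 l ^+ 2 * (d1 * d2) = z1 l * z3 l * z5 l * z6 l * e / u ^+ 2.
  by rewrite -(par_d qn hl) mulfK // expf_neq0.
rewrite E; set Z := ze ^+ 2 - _ + _ in R3' *.
have -> : Ph = - e * P * (g - e * ze) / (Z * (g - ze)).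
  by rewrite -R3'; move: Z0; rewrite -/Z => Zn; field; rewrite ?Zn ?gz.
have u2E : u ^+ 2 = e * q * z2 l * z4 l by rewrite /e /par_e; field; rewrite ?n2 ?n4 ?qn.
rewrite u2E; move: Z0 e en; rewrite -/Z => Zn e' en'.
by field; rewrite ?Zn ?gz ?n1 ?n2 ?n3 ?n4 ?n5 ?n6 ?qn ?Pn ?zn ?en' ?oppr_eq0 ?Pn.
Qed.

Lemma kappa_ratio' : kappa1 k' / kappa2 k' = e / q /\ q * kappa1 k' / kappa2 k' = e.
Proof.
by rewrite /= /e /par_e; split; field; rewrite ?un ?n2 ?n4 ?qn.
Qed.

Lemma qP_eq2_iff gn' : qP_eq2 q k' fb gn' g <-> gn' = gb.
Proof.
have [r1 r2] := kappa_ratio'; have g1 := ze_g1; rewrite -/fb in g1.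
have ge : fb * g - e != 0.
  apply: contraNneq gez => /eqP; rewrite subr_eq0 => /eqP <-.
  by rewrite /fb mulrAC mulVf // mul1r subrr.
have c0 : (fb * g - e) / (fb * g - 1) != 0 by rewrite mulf_neq0 ?invr_eq0.
have gb1' : fb * gb - 1 != 0.
  by rewrite /fb subr_eq0 mulrC -(inj_eq (mulIf zn)) divfK // mul1r -subr_eq0.
have P0 : - (par_P3 l ze * (z6 l - ze)) / (ze ^+ 4 * (z1 l * z3 l * z5 l * z6 l)) != 0.
  apply: mulf_neq0; first by rewrite oppr_eq0.
  by rewrite invr_eq0; apply: mulf_neq0; rewrite ?expf_neq0 // !mulf_neq0.
have E h : (fb * h - e / q) * (fb * g - e) / ((fb * h - 1) * (fb * g - 1)) =
   (fb * g - e) / (fb * g - 1) * ((fb * h - e / q) / (fb * h - 1)).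
  by rewrite [RHS]mulrC mulf_div.
rewrite /qP_eq2 nu_prod3 nu_prod4 r1 r2 E -qP_eq2_value -second_factor.
split=> [[h1 _ h]|->].
  have h1' : fb * gn' - 1 != 0 by apply: contraNneq h1 => ->; rewrite mul0r.
  have fbn : fb != 0 by rewrite /fb invr_eq0.
  apply: (mulfI fbn); apply: (@moebius_eq _ _ (e / q) _ _ h1' gb1' c0).
    by rewrite -(inj_eq (mulIf qn)) divfK // mul1r.
  by rewrite h mulrC.
by split=> //; [rewrite mulf_neq0|rewrite mulrC].
Qed.

Lemma qP_step_iff fn gn' : qP_step q (matching u q l) f g fn gn' <-> fn = fb /\ gn' = gb.
Proof.
rewrite /qP_step -/k'; split=> [[/qP_eq1_iff->] /qP_eq2_iff->|[-> ->]] //.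
by split; [apply/qP_eq1_iff|apply/qP_eq2_iff].
Qed.

End PainleveStep.

Ltac solve_rational := repeat first
  [ exact: rational_const | exact: rational_var
  | apply: rationalD | apply: rationalN | apply: rationalM | apply: rationalV | apply: rationalX ].

Ltac solve_polyfun := repeat first
  [ exact: polyfun_const | exact: polyfun_var
  | apply: polyfunD | apply: polyfunN | apply: polyfunM | apply: polyfunX ].

(** * Changes of coordinates *)

Section PlaneTools.
Variable F : closedFieldType.

Lemma cofinite_quadratic (a b c : F) : a != 0 ->
  cofinite (fun z => a * z ^+ 2 + b * z + c != 0).
Proof.
move=> an; exists (a *: 'X^2 + b *: 'X + c%:P) => [|z]; last by rewrite !hornerS.
apply: contraNneq an => h; have := congr1 (fun p : {poly F} => p`_2) h.
by rewrite !coefD !coefZ coefXn coefX coefC coef0 /= mulr1 mulr0 !addr0 => ->.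
Qed.

Lemma generic2_witness (f : F -> F -> F) x0 y0 :
  polyfun (fun v : 'I_2 -> F => f (v ord0) (v ord_max)) -> f x0 y0 != 0 ->
  generic2 (fun x y => f x y != 0).
Proof. by move=> hf h; apply: (generic_polyfun (v0 := point x0 y0)) hf _. Qed.

Lemma generic2_moebius (m : F -> F -> F) (a b c d : F -> F) P :
  rational2 m ->
  cofinite (fun x => a x * d x - b x * c x != 0) ->
  (forall x y, a x * d x - b x * c x != 0 -> c x * y + d x != 0 ->
     m x y = (a x * y + b x) / (c x * y + d x)) ->
  generic2 P -> generic2 (fun x y => P x (m x y)).
Proof.
move=> hm hdet hE; apply: generic2_fibered => //.
apply: cofinite_imp hdet => x hx p pn.
by apply: cofinite_imp (cofinite_moebius hx pn) => y [h1 h2]; rewrite hE.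
Qed.

End PlaneTools.

Section InverseCoordinates.
Variable F : closedFieldType.
Variables u q : F.
Hypothesis un : u != 0.
Hypothesis u2n : u != - u.
Variable l : param F.
Hypothesis n2 : z2 l != 0.
Hypothesis n4 : z4 l != 0.
Hypothesis n6 : z6 l != 0.
Hypothesis u6 : z6 l != - u.
Hypothesis z24 : u ^+ 2 - z2 l * z4 l != 0.

Let k := matching u q l.
Let Y (g : F) := (z2 l * g - u ^+ 2) * (z4 l * g - u ^+ 2).
Let G (g x : F) := g ^+ 2 - x * g + u ^+ 2.

(** The determinant of the Moebius map y -> g at fixed x. [y_Num]/[y_Den] is its inverse, and
    [f_Num]/[f_Den] is f as a function of g and x. *)
Definition g_det (x : F) := - ((x + 2%:R * u) * (z6 l * x - (z6 l ^+ 2 + u ^+ 2))).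
Definition y_Num (x g : F) := u * z6 l + u ^+ 2 + g * (z6 l - x - u).
Definition y_Den (x g : F) := x * z6 l + u * z6 l - u ^+ 2 - g * (z6 l + u).
Definition f_Num (g x : F) := Y g - u ^+ 2 * G g x.
Definition f_Den (g x : F) := g * (Y g - z2 l * z4 l * G g x).

Lemma cofinite_g_det : cofinite (fun x => g_det x != 0).
Proof.
have := cofinite_and (cofinite_neq (- (2%:R * u))) (cofinite_neq ((z6 l ^+ 2 + u ^+ 2) / z6 l)).
apply: cofinite_imp => x [h1 h2]; rewrite oppr_eq0 mulf_neq0 //.
  by rewrite addr_eq0.
by rewrite subr_eq0; apply: contraNneq h2 => <-; rewrite mulrC mulKf.
Qed.

Lemma cofinite_Y : cofinite (fun g => Y g != 0).
Proof.
have := cofinite_and (cofinite_neq (u ^+ 2 / z2 l)) (cofinite_neq (u ^+ 2 / z4 l)).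
apply: cofinite_imp => g [h1 h2]; rewrite /Y mulf_neq0 // subr_eq0.
  by apply: contraNneq h1 => <-; rewrite mulrC mulKf.
by apply: contraNneq h2 => <-; rewrite mulrC mulKf.
Qed.

Lemma y_Num_Den x y g : (y * y_Den x g = y_Num x g) <-> g_num u l x y = g * g_den u l x y.
Proof.
have E : y * y_Den x g - y_Num x g = g_num u l x y - g * g_den u l x y.
  by rewrite /y_Num /y_Den /g_num /g_den; ring.
by split=> /eqP h; apply/eqP; move: h; rewrite -subr_eq0 -[_ == _ in X in _ -> X]subr_eq0 E.
Qed.

Lemma y_Den_neq0 x y g : g_det x != 0 -> g_num u l x y = g * g_den u l x y -> y_Den x g != 0.
Proof.
move=> hx /y_Num_Den h; apply: contraNneq hx => D0; rewrite D0 mulr0 in h.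
have -> : g_det x = (z6 l - x - u) * y_Den x g + (z6 l + u) * y_Num x g.
  by rewrite /g_det /y_Den /y_Num; ring.
by rewrite D0 -h !mulr0 addr0.
Qed.

(** At z = g the second product of the biquadratic relation vanishes, and g^2 - u^2 cancels from the
    rest. What remains is linear in x and in f. *)
Lemma relation_at_g x y g : g ^+ 2 != u ^+ 2 -> f_den u l x y != 0 -> g_den u l x y != 0 ->
  g_num u l x y = g * g_den u l x y ->
  G g x * (u ^+ 2 - z2 l * z4 l * f_of u l x y * g) = Y g * (1 - f_of u l x y * g).
Proof.
move=> gu fd gd gE; have := biquadratic_relation u l x y g; rewrite /= gE.
have fE : f_num u l x y = f_of u l x y * f_den u l x y by rewrite divfK.
rewrite fE; move: (f_of u l x y) (f_den u l x y) fd (g_den u l x y) gd => f fd fdn gd gdn E.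
have kn : fd * gd * (g ^+ 2 - u ^+ 2) != 0 by rewrite !mulf_neq0 // subr_eq0.
apply: (mulfI kn); apply/eqP; rewrite -subr_eq0; apply/eqP.
move/eqP: E; rewrite -subr_eq0 => /eqP E.
by apply: oppr_inj; rewrite oppr0 -[RHS]E /G /Y; ring.
Qed.

(** If the coefficient of f vanished, so would [f_Num], and with them their combination G (u^2 - z2
    z4). *)
Lemma f_unique g x f : g != 0 -> G g x != 0 ->
  G g x * (u ^+ 2 - z2 l * z4 l * f * g) = Y g * (1 - f * g) ->
  f_Den g x != 0 /\ f = f_Num g x / f_Den g x.
Proof.
move=> gn Gn h.
have E : f * f_Den g x = f_Num g x.
  apply/eqP; rewrite -subr_eq0.
  have -> : f * f_Den g x - f_Num g x = G g x * (u ^+ 2 - z2 l * z4 l * f * g) - Y g * (1 - f * g).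
    by rewrite /f_Den /f_Num; ring.
  by rewrite h subrr.
have D : f_Den g x != 0.
  rewrite /f_Den mulf_neq0 //; apply: contraNneq (mulf_neq0 Gn z24) => D0.
  have N0 : f_Num g x = 0 by rewrite -E /f_Den D0 !mulr0.
  have -> : G g x * (u ^+ 2 - z2 l * z4 l) =
    (Y g - z2 l * z4 l * G g x) - f_Num g x by rewrite /f_Num; ring.
  by rewrite D0 N0 subrr.
by split=> //; rewrite -E mulfK.
Qed.

(** [x_of] is the relation at g solved for x. *)
Lemma x_of_relation f g : g != 0 -> x_den k f g != 0 ->
  G g (x_of k f g) * (u ^+ 2 - z2 l * z4 l * f * g) = Y g * (1 - f * g).
Proof.
move=> gn; rewrite /x_of; set D := x_den _ _ _ => Dn.
have DE : D = (u ^+ 2 - z2 l * z4 l * f * g) / (u * z2 l).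
  by rewrite /D /x_den /k /=; field; rewrite ?un ?n2.
have Dn' : u ^+ 2 - z2 l * z4 l * f * g != 0 by apply: contraNneq Dn => h; rewrite DE h mul0r.
rewrite /G /Y /x_num DE /k /=; field.
by rewrite ?un ?n2 ?n4 ?Dn' ?gn.
Qed.

Lemma x_of_unique f g x : g != 0 -> x_den k f g != 0 ->
  G g x * (u ^+ 2 - z2 l * z4 l * f * g) = Y g * (1 - f * g) -> x_of k f g = x.
Proof.
move=> gn Dn h; have h' := x_of_relation gn Dn.
have Dn' : u ^+ 2 - z2 l * z4 l * f * g != 0.
  apply: contraNneq Dn => h0; rewrite /x_den /k /=.
  have -> : u / z2 l - z4 l / u * f * g = (u ^+ 2 - z2 l * z4 l * f * g) / (u * z2 l).
    by field; rewrite ?un ?n2.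
  by rewrite h0 mul0r.
have := mulIf Dn' (etrans h' (esym h)); rewrite /G => E; apply: (mulIf gn).
by apply: oppr_inj; apply: (addrI (g ^+ 2)); apply: (addIr (u ^+ 2)).
Qed.

Lemma y_of_relation f g : g != 0 -> x_den k f g != 0 ->
  y_num k f g * y_Den (x_of k f g) g = y_den k f g * y_Num (x_of k f g) g.
Proof.
move=> gn; rewrite /x_of; set D := x_den _ _ _ => Dn.
have DE : D = (u ^+ 2 - z2 l * z4 l * f * g) / (u * z2 l).
  by rewrite /D /x_den /k /=; field; rewrite ?un ?n2.
have Dn' : u ^+ 2 - z2 l * z4 l * f * g != 0 by apply: contraNneq Dn => h; rewrite DE h mul0r.
rewrite /y_num /y_den /y_Num /y_Den DE /x_num /k /=.
field; by rewrite ?un ?n2 ?n4 ?n6 ?Dn'.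
Qed.

Lemma generic2_g_of P : generic2 P -> generic2 (fun x y => P x (g_of u l x y)).
Proof.
apply: (@generic2_moebius _ _ (fun x => x * z6 l + u * z6 l - u ^+ 2)
  (fun x => - (u * z6 l + u ^+ 2)) (fun x => z6 l + u) (fun x => z6 l - x - u)).
- by rewrite /rational2 /g_of /g_num /g_den; solve_rational.
- by apply: cofinite_imp cofinite_g_det => x; congr (_ != 0); rewrite /g_det; ring.
- by move=> x y _ _; rewrite /g_of /g_num /g_den; congr (_ / _); ring.
Qed.

Lemma generic2_f_of_x P : generic2 P -> generic2 (fun g x => P g (f_Num g x / f_Den g x)).
Proof.
apply: (@generic2_moebius _ _ (fun g => u ^+ 2 * g) (fun g => Y g - u ^+ 2 * (g ^+ 2 + u ^+ 2))
  (fun g => z2 l * z4 l * g ^+ 2) (fun g => g * (Y g - z2 l * z4 l * (g ^+ 2 + u ^+ 2)))).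
- by rewrite /rational2 /f_Num /f_Den /Y /G; solve_rational.
- have := cofinite_and (cofinite_neq 0) cofinite_Y; apply: cofinite_imp => g [gn Yn].
  have -> : u ^+ 2 * g * (g * (Y g - z2 l * z4 l * (g ^+ 2 + u ^+ 2))) -
     (Y g - u ^+ 2 * (g ^+ 2 + u ^+ 2)) * (z2 l * z4 l * g ^+ 2) =
     g ^+ 2 * Y g * (u ^+ 2 - z2 l * z4 l) by rewrite /Y; ring.
  exact: mulf_neq0 (mulf_neq0 (mulf_neq0 gn gn) Yn) z24.
- by move=> g x _ _; congr (_ / _); rewrite /f_Num /f_Den /G; ring.
Qed.

Lemma generic2_x_of P : generic2 P -> generic2 (fun g f => P g (x_of k f g)).
Proof.
apply: (@generic2_moebius _ _
  (fun g => - u * (1 + kappa1 k * kappa2 k) * g + u ^+ 2 * (kappa1 k - kappa2 k))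
  (fun g => (kappa1 k - kappa2 k) * g + u * (1 + kappa1 k * kappa2 k))
  (fun g => - kappa2 k * g) (fun g => kappa1 k)).
- by rewrite /rational2 /x_of /x_num /x_den; solve_rational.
- apply: cofinite_imp cofinite_Y => g Yn.
  have -> : (- u * (1 + kappa1 k * kappa2 k) * g + u ^+ 2 * (kappa1 k - kappa2 k)) * kappa1 k -
    ((kappa1 k - kappa2 k) * g + u * (1 + kappa1 k * kappa2 k)) * (- kappa2 k * g) =
     Y g * (u ^+ 2 - z2 l * z4 l) / (u ^+ 2 * z2 l ^+ 2).
    by rewrite /k /Y /=; field; rewrite ?un ?n2.
  apply: mulf_neq0 (mulf_neq0 Yn z24) _.
  by rewrite invr_eq0 mulf_neq0 ?expf_neq0.
- by move=> g f _ _; rewrite /x_of /x_num /x_den; congr (_ / _); rewrite /=; ring.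
Qed.

Lemma generic2_y_of_g P : generic2 P -> generic2 (fun x g => P x (y_Num x g / y_Den x g)).
Proof.
apply: (@generic2_moebius _ _ (fun x => z6 l - x - u) (fun x => u * z6 l + u ^+ 2)
   (fun x => - (z6 l + u)) (fun x => x * z6 l + u * z6 l - u ^+ 2)).
- by rewrite /rational2 /y_Num /y_Den; solve_rational.
- by apply: cofinite_imp cofinite_g_det => x; congr (_ != 0); rewrite /g_det; ring.
- by move=> x g _ _; rewrite /y_Num /y_Den; congr (_ / _); ring.
Qed.

Lemma generic2_fg_defined : generic2 (fun x y => f_den u l x y != 0 /\ g_den u l x y != 0).
Proof.
apply: generic2_and.
  have s3 : sigma3 l != 0 by rewrite /sigma3 !mulf_neq0.
  (* At y = 1, [f_den] is a quadratic polynomial in x with leading coefficient [sigma3]. *)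
  have [x hx] := cofinite_exists (cofinite_quadratic (- (u ^+ 2 * sigma2 l) - u ^+ 4)
    (2%:R * u ^+ 4 * sigma1 l - 2%:R * u ^+ 2 * sigma3 l) s3).
  apply: (@generic2_witness _ _ x 1); first by rewrite /f_den; solve_polyfun.
  by move: hx; congr (_ != 0); rewrite /f_den; ring.
apply: (@generic2_witness _ _ (z6 l - u - 1) 0); first by rewrite /g_den; solve_polyfun.
by apply: contraTneq (oner_neq0 F) => h; rewrite -h negbK /g_den; apply/eqP; ring.
Qed.

Lemma generic2_G : generic2 (fun g x => G g x != 0).
Proof.
apply: (@generic2_witness _ _ 0 0); first by rewrite /G; solve_polyfun.
by rewrite /G expr0n mul0r subr0 add0r expf_neq0.
Qed.

Lemma generic2_y_Den : generic2 (fun x g => y_Den x g != 0).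
Proof.
apply: (@generic2_witness _ _ (u ^+ 2 / z6 l + 1 - u) 0); first by rewrite /y_Den; solve_polyfun.
by rewrite (_ : y_Den _ _ = z6 l) // /y_Den; field.
Qed.

Lemma generic2_xy_defined :
  generic2 (fun g f => x_den k f g != 0 /\ y_den k f g != 0).
Proof.
apply: generic2_and.
  apply: (@generic2_witness _ _ 0 0); first by rewrite /x_den; solve_polyfun.
  by rewrite /x_den /k /= mulr0 subr0 mulf_neq0 ?invr_eq0.
have k2 : kappa2 k * (1 + u / z6 l) != 0.
  have -> : kappa2 k * (1 + u / z6 l) = z4 l * (z6 l + u) / (u * z6 l).
    by rewrite /k /=; field; rewrite ?un ?n6.
  by rewrite !mulf_neq0 ?invr_eq0 ?mulf_neq0 // addr_eq0.
(* The coefficient of f in [y_den] is quadratic in g with leading coefficient kappa2 (1 + u/z6),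
   nonzero because z6 differs from -u. *)
have [g hg] := cofinite_exists (cofinite_quadratic
  (kappa2 k * (u ^+ 2 / z6 l - u) - u * (1 + kappa1 k * kappa2 k))
  (u ^+ 2 * (kappa1 k - kappa2 k)) k2).
have [f hf] := cofinite_exists (cofinite_affine (introT orP
  (or_introl hg : _ \/ (y_den k 0 g != 0)))).
apply: (@generic2_witness _ _ g f); first by rewrite /y_den; solve_polyfun.
by move: hf; congr (_ != 0); rewrite /y_den /=; ring.
Qed.

Lemma inverse_coordinates_proof : inverse_coordinates u q l.
Proof.
split.
  (* Conditions are pulled back along (x, y) -> (x, g) -> (f, g). *)
  have h1 := generic2_and generic2_fg_defined (generic2_g_of
    (generic2_and (generic2_poly1 cofinite_g_det)
    (generic2_swap (generic2_and (generic2_poly1 (cofinite_and (cofinite_neq 0)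
       (cofinite_and (cofinite_neq u) (cofinite_neq (- u)))))
     (generic2_and generic2_G (generic2_f_of_x generic2_xy_defined)))))).
  apply: (@generic2_imp _ _ (fun x y => [/\ fg_defined u l x y,
    xy_defined k (f_of u l x y) (g_of u l x y),
    x_of k (f_of u l x y) (g_of u l x y) = x & y_of k (f_of u l x y) (g_of u l x y) = y]) _ h1).
  move=> x y [[fd gd]] [xn [[gn [g1 g2]] [Gn [xd yd]]]].
  have gu : g_of u l x y ^+ 2 != u ^+ 2 by rewrite eqf_sqr negb_or g1.
  have gE : g_num u l x y = g_of u l x y * g_den u l x y by rewrite divfK.
  have R := relation_at_g gu fd gd gE.
  have [_ fE] := f_unique gn Gn R; rewrite -fE in xd yd.
  have xE := x_of_unique gn xd R.
  split=> //; have := y_of_relation gn xd; rewrite xE => E.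
  have Dn := y_Den_neq0 xn gE; have yE := (y_Num_Den _ _ _).2 gE.
  apply: (mulfI yd); rewrite mulrC divfK //; apply: (mulIf Dn).
  by rewrite E -yE mulrA.
(* Here the way is (f, g) -> (x, g) -> (x, y). *)
have h2 := generic2_swap (generic2_and generic2_xy_defined
  (generic2_and (generic2_poly1 (cofinite_and (cofinite_neq 0)
       (cofinite_and (cofinite_neq u) (cofinite_neq (- u)))))
  (generic2_x_of (generic2_and generic2_G
    (generic2_swap (generic2_and (generic2_poly1 cofinite_g_det)
      (generic2_and generic2_y_Den (generic2_y_of_g generic2_fg_defined)))))))).
apply: (@generic2_imp _ _ (fun f g => [/\ xy_defined k f g,
  fg_defined u l (x_of k f g) (y_of k f g), f_of u l (x_of k f g) (y_of k f g) = f
  & g_of u l (x_of k f g) (y_of k f g) = g]) _ h2).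
move=> f g [[xd yd]] [[gn [g1 g2]]] [Gn [xn [Dn [fd gd]]]].
have gu : g ^+ 2 != u ^+ 2 by rewrite eqf_sqr negb_or g1.
have yE : y_of k f g = y_Num (x_of k f g) g / y_Den (x_of k f g) g.
  apply: (mulIf Dn); rewrite divfK //; apply: (mulfI yd).
  by rewrite -(y_of_relation gn xd) mulrA; congr (_ * _); rewrite mulrC divfK.
rewrite -yE in fd gd.
have gE : g_num u l (x_of k f g) (y_of k f g) = g * g_den u l (x_of k f g) (y_of k f g).
  by apply/y_Num_Den; rewrite yE divfK.
have gg : g_of u l (x_of k f g) (y_of k f g) = g by rewrite /g_of gE mulfK.
have R := relation_at_g gu fd gd gE.
split=> //.
have [_ ->] := f_unique gn Gn R.
by have [_ <-] := f_unique gn Gn (x_of_relation gn xd).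
Qed.

Lemma matching_compatible_proof : q != 0 -> z1 l != 0 -> z3 l != 0 -> z5 l != 0 -> dd l != 0 ->
  matching_compatible u q l.
Proof.
move=> qn n1 n3 n5 dn; split=> /=.
- rewrite unlock /= /minus_rho1 /minus_rho2; field.
  by rewrite ?un ?n1 ?n2 ?n3 ?n4 ?n5 ?n6 ?dn ?qn.
- by field; rewrite ?n2 ?qn.
- by rewrite mulrA.
- case=> [|[|[|[|[|[|[|[|[|i]]]]]]]]] // _; rewrite /= /minus_rho1 /minus_rho2 //=; field;
  by rewrite ?un ?n1 ?n2 ?n3 ?n4 ?n5 ?n6 ?dn ?qn.
Qed.

End InverseCoordinates.

(** * Equivalence at generic points *)

Section Dynamics.
Variable F : closedFieldType.
Variables u q : F.
Hypothesis un : u != 0.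
Hypothesis qn : q != 0.
Hypothesis u2n : u != - u.
Hypothesis q_free : forall n, q ^+ n.+1 != 1.

(** With x = t + u^2/t, this keeps t away from all z_i, u^2/z_i and from u and -u, where x is 2u and
    -2u. *)
Definition regular_x l (x : F) : bool :=
  [&& all (fun z => x != z + u ^+ 2 / z) (zs l), x != u + u & x != - u - u].

Lemma cofinite_regular_x l : cofinite (regular_x l).
Proof.
have A (s : seq F) : cofinite (fun x => all (fun z => x != z + u ^+ 2 / z) s).
  elim: s => [|z s IH]; first by exists 1 => //; apply: oner_neq0.
  by apply: cofinite_imp (cofinite_and (cofinite_neq (z + u ^+ 2 / z)) IH) => x [/= -> ->].
have := cofinite_and (A (zs l)) (cofinite_and (cofinite_neq (u + u)) (cofinite_neq (- u - u))).
by apply: cofinite_imp => x [h1 [h2 h3]]; apply/and3P.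
Qed.

Lemma regular_x_nonsingular l x t : admissible u q l -> regular_x l x -> t != 0 -> x = t + u ^+ 2 / t ->
  [/\ t ^+ 2 != u ^+ 2, (Ppol u l).[t] != 0 & (Qpol u l).[t] != 0].
Proof.
move=> hl /and3P[hx xu xu'] tn xE.
have tu : t ^+ 2 != u ^+ 2.
  rewrite eqf_sqr negb_or; apply/andP; split.
    apply: contraNneq xu => tE; rewrite xE tE; apply/eqP; congr (_ + _).
    by rewrite expr2 mulfK.
  apply: contraNneq xu' => tE; rewrite xE tE; apply/eqP; congr (_ + _).
  by rewrite invrN mulrN expr2 mulfK.
have hs : t \notin singular_points u l.
  rewrite mem_cat; apply/negP => /orP[tz|/mapP[z zl tE]].
    by move/allP: hx => /(_ _ tz); rewrite -xE eqxx.
  have zn : z != 0 by move/allP: (adm_z hl) => /(_ _ zl).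
  move/allP: hx => /(_ _ zl); rewrite xE tE.
  rewrite (_ : u ^+ 2 / (u ^+ 2 / z) = z); last by field; rewrite un zn.
  by rewrite addrC eqxx.
by have [hP hQ] := PQ_nonsingular hl hs.
Qed.

Variable l : param F.
Let l' := evolve q l.
Hypothesis hl : admissible u q l.
Hypothesis hl' : admissible u q l'.
Hypothesis nr' : nonresonant u q l'.
Let e := par_e u q l.
Hypothesis e1 : e != 1.
Hypothesis qe1 : e != q.
Hypothesis z24 : u ^+ 2 - z2 l * z4 l != 0.

Let n1 : z1 l != 0. Proof. by have [] := adm_zn hl. Qed.
Let n2 : z2 l != 0. Proof. by have [] := adm_zn hl. Qed.
Let n3 : z3 l != 0. Proof. by have [] := adm_zn hl. Qed.
Let n4 : z4 l != 0. Proof. by have [_ _ _ []] := adm_zn hl. Qed.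
Let n5 : z5 l != 0. Proof. by have [_ _ _ []] := adm_zn hl. Qed.
Let n6 : z6 l != 0. Proof. by have [_ _ _ []] := adm_zn hl. Qed.

Let Phi := par_Phi q l.
Let T (g : F) := par_P3 l g * (g - z6 l).
Let G (g x : F) := g ^+ 2 - x * g + u ^+ 2.
Let T' (z : F) := par_P3 l z * (z6 l - z).

(* next_z is 1 / f, next_x is x and next_y is y at the next step. *)
Definition next_z (g x : F) := g * (Phi g * G g x - T g) / (Phi g * G g x - e * T g).
Definition next_x (z g : F) := z + u ^+ 2 / z +
  e * par_P3 l z * (z6 l - z) * (g - e * z) / (z * (g - z) * Phi (e * z)).
(* f_num = f_A1 * y + f_A0 and f_den = f_B1 * y + f_B0 at the evolved parameters. *)
Definition f_A1 x := sigma3 l' * (x + u) - u ^+ 2 * sigma2 l' - u ^+ 3 * (sigma1 l' - x) + u ^+ 4.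
Definition f_A0 x := - (sigma3 l' * u) - u ^+ 2 * (x ^+ 2 - sigma1 l' * x + sigma2 l')
   + u ^+ 3 * (sigma1 l' - x) + u ^+ 4.
Definition f_B1 x := sigma3 l' * x * (x + u) - u ^+ 2 * (sigma2 l' * x + sigma3 l')
   - u ^+ 3 * sigma2 l' + u ^+ 4 * sigma1 l' + u ^+ 5.
Definition f_B0 x := - (sigma3 l' * x * u) - u ^+ 2 * sigma3 l' + u ^+ 3 * sigma2 l'
   + u ^+ 4 * (sigma1 l' - x) - u ^+ 5.
Definition next_y (x z : F) := (f_B0 x - f_A0 x * z) / (f_A1 x * z - f_B1 x).

(** The determinant of y -> 1/f at the evolved parameters. It vanishes only for x = -2u and for x =
    z_i + u^2/z_i with i = 2, 4, 6. *)
Lemma f_det x : f_A0 x * f_B1 x - f_A1 x * f_B0 x = - (u ^+ 2 * (x + u + u) *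
  ((z2 l' * x - z2 l' ^+ 2 - u ^+ 2) * (z4 l' * x - z4 l' ^+ 2 - u ^+ 2) *
   (z6 l' * x - z6 l' ^+ 2 - u ^+ 2))).
Proof.
rewrite /f_A0 /f_B1 /f_A1 /f_B0 /sigma3 /sigma2 /sigma1.
move: (z2 l') (z4 l') (z6 l') => a b c; ring.
Qed.

Lemma next_yE x z : f_A1 x * z - f_B1 x != 0 ->
  z * f_num u l' x (next_y x z) = f_den u l' x (next_y x z).
Proof.
move=> h; apply/eqP; rewrite -subr_eq0.
have -> y : z * f_num u l' x y - f_den u l' x y = (f_A1 x * z - f_B1 x) * y - (f_B0 x - f_A0 x * z).
  by rewrite /f_num /f_den /f_A1 /f_B1 /f_A0 /f_B0; ring.
by rewrite /next_y mulrC divfK // subrr.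
Qed.

Section AtPoint.
Variables x y g z X y' : F.
Hypothesis xg : regular_x l x.
Hypothesis Xg : regular_x l' X.
Hypothesis gE : g = g_of u l x y.
Hypothesis zE : z = next_z g x.
Hypothesis XE : X = next_x z g.
Hypothesis yE : y' = next_y X z.
Hypothesis fgd : f_den u l x y != 0 /\ g_den u l x y != 0.
Hypothesis fgd' : f_den u l' X y' != 0 /\ g_den u l' X y' != 0.
Hypothesis yy : y ^+ 2 * u ^+ 2 - x * y * u + u ^+ 2 != 0.
Hypothesis yy' : y' ^+ 2 * u ^+ 2 - X * y' * u + u ^+ 2 != 0.
Hypothesis gn : g != 0.
Hypothesis gu : g ^+ 2 != u ^+ 2.
Hypothesis Phin : Phi g != 0.
Hypothesis Tn : T g != 0.
Hypothesis Yn : (z2 l * g - u ^+ 2) * (z4 l * g - u ^+ 2) != 0.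
Hypothesis Gn : G g x != 0.
Hypothesis dn : Phi g * G g x - e * T g != 0.
Hypothesis zn : z != 0.
Hypothesis zu : z ^+ 2 != u ^+ 2.
Hypothesis Pz : Phi (e * z) != 0.
Hypothesis Tz : T' z != 0.
Hypothesis gz : g != z.
Hypothesis gzu : g * z != u ^+ 2.
Hypothesis gez : g != e * z.
Hypothesis yd : f_A1 X * z - f_B1 X != 0.

Let al := Phi g / (g - e * z).
Let be := - (al * z).

Let gz0 : g - z != 0. Proof. by rewrite subr_eq0. Qed.
Let gez0 : g - e * z != 0. Proof. by rewrite subr_eq0. Qed.
Let aln : al != 0. Proof. by rewrite mulf_neq0 ?invr_eq0. Qed.
Let en : e != 0.
Proof. by rewrite /e /par_e !mulf_neq0 ?expf_neq0 ?invr_eq0 ?mulf_neq0. Qed.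

(** The two equations for al and be, with be = - al z and al eliminated; [next_z] is its solution in
    z. *)
Lemma T_relation : T g * (g - e * z) = Phi g * G g x * (g - z).
Proof.
have : z * (Phi g * G g x - e * T g) = g * (Phi g * G g x - T g).
  by rewrite zE /next_z divfK.
move: (T g) (Phi g) (G g x) => t p w E.
apply/eqP; rewrite -subr_eq0 (_ : _ - _ = z * (p * w - e * t) - g * (p * w - t)); last by ring.
by rewrite E subrr.
Qed.

Lemma X_relation : G z X * ((g - z) * Phi (e * z)) = - e * T' z * (g - e * z).
Proof.
rewrite XE /next_x /G /T'; move: Pz; move: (Phi (e * z)) => p pn.
by field; rewrite zn gz0 pn.
Qed.

Lemma Z_neq0 : G z X != 0.
Proof.
have : - e * T' z * (g - e * z) != 0.
  by apply: mulf_neq0 _ gez0; apply: mulf_neq0 _ Tz; rewrite oppr_eq0.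
by rewrite -X_relation mulf_eq0 negb_or => /andP[].
Qed.

Lemma zbE : - be / al = z.
Proof. by rewrite /be opprK mulrC mulKf. Qed.

Lemma connections_at_point : exists A A' : 'M[ratfun F]_2,
  [/\ is_connection u q l A, has_coords u q l A x y,
      modification u q A A', is_connection u q l' A' & has_coords u q l' A' X y'].
Proof.
have XX : step_x u q l g al be = X by rewrite XE -zbE.
have gd := fgd.2; have fd' := fgd'.1.
have gEd : g_num u l x y = g * g_den u l x y by rewrite gE divfK.
rewrite -XX; apply: (@step_exists F u q un u2n qn l hl hl' x g al be); rewrite ?XX ?zbE //.
- apply: (mulIf gez0); rewrite T_relation /be /al -/(G g x); move: (Phi g) (G g x) => p w.
  by move: gez0 => h; field.
- by rewrite -/Phi -/e /be /al; move: (Phi g) => p; move: gez0 => h; field.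
- by rewrite /be oppr_eq0 mulf_neq0.
- by rewrite yE next_yE // -yE.
- exact: Z_neq0.
- by move=> t tn tE; apply: regular_x_nonsingular xg tn tE.
- by move=> t tn tE; apply: regular_x_nonsingular Xg tn tE.
Qed.

Let f := f_of u l x y.
Let gb := g_of u l' X y'.

Lemma g_ratio : g_num u l x y = g * g_den u l x y.
Proof. by rewrite gE divfK //; case: fgd. Qed.

Lemma f_relation : G g x * (u ^+ 2 - z2 l * z4 l * f * g) =
  (z2 l * g - u ^+ 2) * (z4 l * g - u ^+ 2) * (1 - f * g).
Proof. by have [fd gd] := fgd; exact: relation_at_g gu fd gd g_ratio. Qed.

Lemma f_next : f_num u l' X y' != 0 /\ f_of u l' X y' = z^-1.
Proof.
have [fd gd] := fgd'; have E : z * f_num u l' X y' = f_den u l' X y' by rewrite yE next_yE.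
have fn : f_num u l' X y' != 0 by apply: contraNneq fd => h; rewrite -E h mulr0.
by split=> //; rewrite /f_of -E invfM mulrC -mulrA mulVf // mulr1.
Qed.

(** Since f_den = z f_num at the image, the first product of the biquadratic relation vanishes at z,
    and z^2 - u^2 cancels from the rest. *)
Lemma gb_relation : (q * z2 l * (q * z4 l) * gb - u ^+ 2 * z) * G z X =
  u ^+ 2 * (q * z2 l - z) * (q * z4 l - z) * (gb - z).
Proof.
have [fd gd] := fgd'; have [fn _] := f_next.
have E : f_den u l' X y' = z * f_num u l' X y' by rewrite yE next_yE.
have gbE : g_num u l' X y' = gb * g_den u l' X y' by rewrite divfK.
have := biquadratic_relation u l' X y' z; rewrite /= gbE E -/(G z X).
have zu0 : z ^+ 2 - u ^+ 2 != 0 by rewrite subr_eq0.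
move: fn gd zu0; move: (f_num _ _ _ _) (g_den _ _ _ _) (G z X) => N D W Nn Dn Wn R.
have k : N * D * (z ^+ 2 - u ^+ 2) != 0 by rewrite !mulf_neq0.
apply: (mulfI k); apply/eqP; rewrite -subr_eq0; apply/eqP.
move/eqP: R; rewrite -subr_eq0 => /eqP R.
by rewrite -[RHS]R /l' /=; ring.
Qed.

(** If the two were equal, [gb_relation] would force e = q. *)
Lemma gb_neq_z : gb - z != 0.
Proof.
apply/negP => /eqP h; have := gb_relation; rewrite h mulr0.
have -> : gb = z by apply/eqP; rewrite -subr_eq0 h.
move/eqP; rewrite mulf_eq0 (negbTE Z_neq0) orbF.
have -> : q * z2 l * (q * z4 l) * z - u ^+ 2 * z = q * z2 l * z4 l * z * (q - e).
  by rewrite /e /par_e; field; rewrite n2 n4 qn.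
rewrite mulf_eq0 subr_eq0 [q == _]eq_sym (negbTE qe1) orbF.
by apply/negP; rewrite !mulf_neq0.
Qed.

Lemma fg_neq1 : f * g - 1 != 0.
Proof.
apply/negP => /eqP h; have := f_relation; rewrite -(opprB _ 1) h oppr0 mulr0.
have -> : u ^+ 2 - z2 l * z4 l * f * g = u ^+ 2 - z2 l * z4 l - z2 l * z4 l * (f * g - 1) by ring.
by rewrite h mulr0 subr0 => /eqP; apply/negP; rewrite mulf_neq0.
Qed.

Lemma fg_neq_ratio : f * g != u ^+ 2 / (z2 l * z4 l).
Proof.
have zz : z2 l * z4 l != 0 by rewrite mulf_neq0.
apply/negP => /eqP h; have := f_relation.
have -> : u ^+ 2 - z2 l * z4 l * f * g = u ^+ 2 - z2 l * z4 l * (f * g) by ring.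
rewrite h mulrCA divff // mulr1 subrr mulr0 => /esym/eqP; apply/negP.
apply: mulf_neq0 => //; apply: contraNneq z24 => h1.
have -> : u ^+ 2 - z2 l * z4 l = - (z2 l * z4 l) * (1 - u ^+ 2 / (z2 l * z4 l)) by field; rewrite n2 n4.
by rewrite h1 mulr0.
Qed.

Lemma painleve_at_point fn gn' : qP_step q (matching u q l) f g fn gn' <->
  fn = f_of u l' X y' /\ gn' = gb.
Proof.
rewrite f_next.2.
apply: (@qP_step_iff F u q un qn l hl e1 qe1 f g z gb x X al) => //.
- exact: fg_neq1.
- exact: fg_neq_ratio.
- exact: Z_neq0.
- exact: gb_neq_z.
- apply: (mulIf gez0); rewrite T_relation /al -/(G g x); move: (Phi g) (G g x) => p w.
  by move: gez0 => h; field.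
- by rewrite /al divfK.
- exact: f_relation.
- exact: gb_relation.
exact: X_relation.
Qed.

(** A is gauge equivalent to the explicit connection with the same coordinates, so A' is a
    modification of A as well; any other modification of the evolved type is then a modification of
    A'. *)
Lemma isomonodromy_at_point A : is_connection u q l A -> has_coords u q l A x y ->
  exists A', isomonodromic u q l A A' /\ has_coords u q l' A' X y'.
Proof.
move=> hA cA; have [A0 [A' [hA0 cA0 m hA' cA']]] := connections_at_point.
have E := class_unique un qn u2n hl (fun t => regular_x_nonsingular hl xg) hA cA hA0 cA0.
have mA := modification_trans qn (gauge_equiv_modification E) m.
exists A'; split=> //; split=> // A'' hA'' mA''.
apply: (modification_unique un qn u2n q_free hl' nr' hA' hA'').
exact (modification_trans qn (modification_sym qn mA) mA'').
Qed.

End AtPoint.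

Let en : e != 0.
Proof. by rewrite /e /par_e !mulf_neq0 ?expf_neq0 ?invr_eq0 ?mulf_neq0. Qed.
Let e10 : e - 1 != 0. Proof. by rewrite subr_eq0. Qed.

Lemma cofinite_Phi : cofinite (fun g => Phi g != 0).
Proof.
have := cofinite_and (cofinite_neq (z6 l * minus_rho1 l)) (cofinite_neq (z6 l * minus_rho2 q l)).
by apply: cofinite_imp => g [h1 h2]; rewrite mulf_neq0 // subr_eq0.
Qed.

Lemma cofinite_scaled_Phi : cofinite (fun z => Phi (e * z) != 0).
Proof.
have := cofinite_and (@cofinite_affine F e (- (z6 l * minus_rho1 l)) (introT orP (or_introl en)))
  (@cofinite_affine F e (- (z6 l * minus_rho2 q l)) (introT orP (or_introl en))).
by apply: cofinite_imp => g [h1 h2]; rewrite mulf_neq0.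
Qed.

Lemma cofinite_T : cofinite (fun g => T g != 0).
Proof.
have := cofinite_and (cofinite_and (cofinite_neq (z1 l)) (cofinite_neq (z3 l)))
  (cofinite_and (cofinite_neq (z5 l)) (cofinite_neq (z6 l))).
by apply: cofinite_imp => g [[h1 h2] [h3 h4]]; rewrite !mulf_neq0 // subr_eq0.
Qed.

Lemma cofinite_T' : cofinite (fun z => T' z != 0).
Proof.
have := cofinite_and (cofinite_and (cofinite_neq (z1 l)) (cofinite_neq (z3 l)))
  (cofinite_and (cofinite_neq (z5 l)) (cofinite_neq (z6 l))).
by apply: cofinite_imp => z [[h1 h2] [h3 h4]]; rewrite !mulf_neq0 // subr_eq0 // eq_sym.
Qed.

Lemma cofinite_sqr_neq (c : F) : cofinite (fun z => z ^+ 2 != c ^+ 2).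
Proof.
have := cofinite_and (cofinite_neq c) (cofinite_neq (- c)).
by apply: cofinite_imp => z [h1 h2]; rewrite eqf_sqr negb_or h1.
Qed.

Lemma cofinite_f_det : cofinite (fun x => f_A0 x * f_B1 x - f_A1 x * f_B0 x != 0).
Proof.
have [n1' n2' n3' [n4' n5' n6']] := adm_zn hl'.
have A k : k != 0 -> cofinite (fun x => k * x - k ^+ 2 - u ^+ 2 != 0).
  move=> kn; have := @cofinite_affine F k (- k ^+ 2 - u ^+ 2) (introT orP (or_introl kn)).
  by apply: cofinite_imp => x; rewrite addrA.
have := cofinite_and (cofinite_neq (- (u + u))) (cofinite_and (A _ n2') (cofinite_and (A _ n4') (A _ n6'))).
apply: cofinite_imp => x [h0 [h1 [h2 h3]]]; rewrite f_det oppr_eq0.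
by rewrite !mulf_neq0 // -addrA addr_eq0.
Qed.

Lemma generic2_next_y P : generic2 P -> generic2 (fun x z => P x (next_y x z)).
Proof.
apply: (@generic2_moebius _ _ (fun x => - f_A0 x) f_B0 f_A1 (fun x => - f_B1 x)).
- rewrite /rational2 /next_y /f_A0 /f_B0 /f_A1 /f_B1; solve_rational.
- by apply: cofinite_imp cofinite_f_det => x; congr (_ != 0); ring.
by move=> x z _ _; rewrite /next_y; congr (_ / _); rewrite [in RHS]addrC mulNr.
Qed.

Lemma generic2_next_y_den : generic2 (fun x z => f_A1 x * z - f_B1 x != 0).
Proof.
have [x hx] := cofinite_exists cofinite_f_det.
have [|z hz] := cofinite_exists (@cofinite_affine F (f_A1 x) (- f_B1 x) _).
  rewrite oppr_eq0 -negb_and; apply: contraNN hx => /andP[/eqP-> /eqP->].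
  by rewrite mulr0 mul0r subrr.
apply: (@generic2_witness _ _ x z) => //.
rewrite /f_A1 /f_B1; solve_polyfun.
Qed.

(** The determinant of this Moebius map is a multiple of e - 1, as is that of [next_z]: both are
    dominant because e <> 1. *)
Lemma generic2_next_x P : generic2 P -> generic2 (fun z g => P z (next_x z g)).
Proof.
apply: (@generic2_moebius _ _ (fun z => (z ^+ 2 + u ^+ 2) * Phi (e * z) + e * T' z)
  (fun z => - z * ((z ^+ 2 + u ^+ 2) * Phi (e * z) + e ^+ 2 * T' z))
  (fun z => z * Phi (e * z)) (fun z => - z ^+ 2 * Phi (e * z))).
- rewrite /rational2 /next_x /Phi /par_Phi /par_P3; solve_rational.
- have := cofinite_and (cofinite_neq 0) (cofinite_and cofinite_scaled_Phi cofinite_T').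
  apply: cofinite_imp => z [z0 [h1 h2]]; move: (Phi (e * z)) (T' z) h1 h2 => p t pn tn.
  rewrite (_ : _ - _ = z ^+ 2 * p * (e * t) * (e - 1)); last by ring.
  exact: mulf_neq0 (mulf_neq0 (mulf_neq0 (mulf_neq0 z0 z0) pn) (mulf_neq0 en tn)) e10.
move=> z g h1 h2.
have -> : next_x z g = z + u ^+ 2 / z + e * T' z * (g - e * z) / (z * (g - z) * Phi (e * z)).
  by rewrite /next_x /T' (mulrA e).
move: (Phi (e * z)) (T' z) h1 h2 => p t h1 h2.
have : z * p * (g - z) != 0 by rewrite (_ : _ * _ = z * p * g + - z ^+ 2 * p); last by ring.
rewrite !mulf_eq0 !negb_or => /andP[/andP[z0 p0] gz0].
have h3 : z * p * g + - z ^+ 2 * p != 0 := h2.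
by field; rewrite z0 p0 gz0 h3.
Qed.

Lemma generic2_next_z P : generic2 P -> generic2 (fun g x => P g (next_z g x)).
Proof.
apply: (@generic2_moebius _ _ (fun g => - g ^+ 2 * Phi g)
  (fun g => g * (Phi g * (g ^+ 2 + u ^+ 2) - T g))
  (fun g => - g * Phi g) (fun g => Phi g * (g ^+ 2 + u ^+ 2) - e * T g)).
- rewrite /rational2 /next_z /Phi /par_Phi /T /par_P3 /G; solve_rational.
- have := cofinite_and (cofinite_neq 0) (cofinite_and cofinite_Phi cofinite_T).
  apply: cofinite_imp => g [g0 [h1 h2]]; move: (Phi g) (T g) h1 h2 => p t pn tn.
  rewrite (_ : _ - _ = g ^+ 2 * p * t * (e - 1)); last by ring.
  exact: mulf_neq0 (mulf_neq0 (mulf_neq0 (mulf_neq0 g0 g0) pn) tn) e10.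
by move=> g x _ _; rewrite /next_z /G; congr (_ / _); ring.
Qed.

Lemma generic2_next_z_den : generic2 (fun g x => Phi g * G g x - e * T g != 0).
Proof.
have [g [gn pn]] := cofinite_exists (cofinite_and (cofinite_neq 0) cofinite_Phi).
have cn : - g * Phi g != 0 by rewrite mulf_neq0 ?oppr_eq0.
have [x hx] := cofinite_exists (cofinite_affine (introT orP
  (or_introl cn : _ \/ (Phi g * (g ^+ 2 + u ^+ 2) - e * T g != 0)))).
apply: (@generic2_witness _ _ g x).
  by rewrite /Phi /par_Phi /T /par_P3 /G; solve_polyfun.
by move: hx; congr (_ != 0); rewrite /G; ring.
Qed.

Lemma generic2_yy : generic2 (fun x y => y ^+ 2 * u ^+ 2 - x * y * u + u ^+ 2 != 0).
Proof.
apply: (@generic2_witness _ _ 0 0); first by solve_polyfun.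
by rewrite expr0n !mul0r subr0 add0r expf_neq0.
Qed.

(** The predicates from here to [good_xy] are nested along the chain of coordinates, each one
    containing the pullback of the preceding one, so that genericity passes from one to the next. *)
Definition good_Xy (X y' : F) : Prop :=
  [/\ regular_x l' X, f_den u l' X y' != 0 /\ g_den u l' X y' != 0
    & y' ^+ 2 * u ^+ 2 - X * y' * u + u ^+ 2 != 0].

Definition good_zX (z X : F) : Prop :=
  f_A1 X * z - f_B1 X != 0 /\ good_Xy X (next_y X z).

Definition good_gz (g z : F) : Prop :=
  [/\ [/\ z != 0, z ^+ 2 != u ^+ 2, Phi (e * z) != 0 & T' z != 0],
      [/\ g != z, g * z != u ^+ 2 & g != e * z]
    & good_zX z (next_x z g)].

Definition good_xg (x g : F) : Prop :=
  [/\ [/\ g != 0, g ^+ 2 != u ^+ 2, Phi g != 0, T g != 0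
        & (z2 l * g - u ^+ 2) * (z4 l * g - u ^+ 2) != 0],
      G g x != 0, Phi g * G g x - e * T g != 0
    & good_gz g (next_z g x)].

Definition good_xy (x y : F) : Prop :=
  [/\ regular_x l x, f_den u l x y != 0 /\ g_den u l x y != 0,
      y ^+ 2 * u ^+ 2 - x * y * u + u ^+ 2 != 0 & good_xg x (g_of u l x y)].

Lemma generic2_good_Xy : generic2 good_Xy.
Proof.
have [_ n2' _ [n4' _ n6']] := adm_zn hl'.
have := generic2_and (generic2_poly1 (cofinite_regular_x l'))
  (generic2_and (generic2_fg_defined u n2' n4' n6') generic2_yy).
by apply: generic2_imp => x y [? [? ?]].
Qed.

Lemma generic2_good_zX : generic2 good_zX.
Proof.
apply: (@generic2_swap _ (fun X z => good_zX z X)).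
exact: generic2_and generic2_next_y_den (generic2_next_y generic2_good_Xy).
Qed.

Lemma generic2_good_gz : generic2 good_gz.
Proof.
apply: (@generic2_swap _ (fun z g => good_gz g z)).
have h1 : generic2 (fun z g : F => g - z != 0).
  apply: (@generic2_witness _ _ 0 1); first by solve_polyfun.
  by rewrite subr0 oner_neq0.
have h2 : generic2 (fun z g : F => g * z - u ^+ 2 != 0).
  apply: (@generic2_witness _ _ 0 0); first by solve_polyfun.
  by rewrite mulr0 sub0r oppr_eq0 expf_neq0.
have h3 : generic2 (fun z g : F => g - e * z != 0).
  apply: (@generic2_witness _ _ 0 1); first by solve_polyfun.
  by rewrite mulr0 subr0 oner_neq0.
have := generic2_and (generic2_poly1 (cofinite_and (cofinite_and (cofinite_neq 0)
   (cofinite_sqr_neq u)) (cofinite_and cofinite_scaled_Phi cofinite_T')))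
  (generic2_and (generic2_and h1 (generic2_and h2 h3)) (generic2_next_x generic2_good_zX)).
apply: generic2_imp => z g [[[? ?] [? ?]] [[a [b c]] ?]].
by split=> //; split; rewrite -subr_eq0.
Qed.

Lemma generic2_good_xg : generic2 good_xg.
Proof.
apply: (@generic2_swap _ (fun g x => good_xg x g)).
have h1 : generic2 (fun g x : F => G g x != 0) := @generic2_G F u un.
have := generic2_and (generic2_poly1 (cofinite_and (cofinite_and (cofinite_neq 0)
   (cofinite_sqr_neq u)) (cofinite_and (cofinite_and cofinite_Phi cofinite_T)
   (@cofinite_Y F u l n2 n4))))
  (generic2_and (generic2_and h1 generic2_next_z_den) (generic2_next_z generic2_good_gz)).
by apply: generic2_imp => g x [[[? ?] [[? ?] ?]] [[? ?] ?]].
Qed.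

Lemma generic2_good_xy : generic2 good_xy.
Proof.
have := generic2_and (generic2_poly1 (cofinite_regular_x l))
  (generic2_and (generic2_and (generic2_fg_defined u n2 n4 n6) generic2_yy)
   (@generic2_g_of F u l n6 _ generic2_good_xg)).
by apply: generic2_imp => x y [? [[? ?] ?]].
Qed.

Theorem equivalent_dynamics_proof : equivalent_dynamics u q l.
Proof.
apply: generic_imp generic2_good_xy => v; move: (v ord0) (v ord_max) => x y /=.
move=> [xg fgd yy [[gn gu Pg Tg Yg] Gn dn [[zn zu Pz Tz] [gz gzu gez] [yd [Xg fgd' yy']]]]].
pose g := g_of u l x y; pose z := next_z g x; pose X := next_x z g.
have [A0 [_ [hA0 cA0 _ _ _]]] :
    exists A A' : 'M[ratfun F]_2, [/\ is_connection u q l A, has_coords u q l A x y,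
      modification u q A A', is_connection u q l' A' & has_coords u q l' A' X (next_y X z)].
  exact: (@connections_at_point x y g z X (next_y X z)).
split; first by exists A0.
  move=> A A' hA cA hA' cA'.
  exact (class_unique un qn u2n hl (fun t => regular_x_nonsingular hl xg) hA cA hA' cA').
move=> A hA cA.
have [A' [hm cA']] : exists A', isomonodromic u q l A A' /\ has_coords u q l' A' X (next_y X z).
  exact: (@isomonodromy_at_point x y g z X (next_y X z)).
exists A', X, (next_y X z); split=> // fn gn'.
exact: (@painleve_at_point x y g z X (next_y X z)).
Qed.

End Dynamics.

(** * Very generic parameters *)

Section VeryGeneric.
Variables (F : fieldType) (n : nat).
Implicit Types (P Q : ('I_n -> F) -> Prop).

Lemma generic_all (I : finType) (P : I -> ('I_n -> F) -> Prop) :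
  (forall i, generic (P i)) -> generic (fun v => forall i, P i v).
Proof.
move=> h; suff: generic (fun v => forall i, i \in enum I -> P i v).
  by apply: generic_imp => v hv i; apply: hv; rewrite mem_enum.
elim: (enum I) => [|i s IH]; first by exists 1 => //; apply: oner_neq0.
apply: generic_imp (generic_and (h i) IH) => v [hi hs] j.
by rewrite inE => /predU1P[->|/hs].
Qed.

(** Countable choice selects one polynomial for each k. *)
Lemma very_generic_forall (P : nat -> ('I_n -> F) -> Prop) :
  (forall k, generic (P k)) -> very_generic (fun v => forall k, P k v).
Proof.
move=> h.
have [N hN] := @choice _ _ (fun k N => N != 0 /\ forall v, meval v N != 0 -> P k v)
   (fun k => let: ex_intro2 N Nn hN := h k in ex_intro _ N (conj Nn hN)).
exists N => [k|v hv k]; first by case: (hN k).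
by have [_] := hN k; apply.
Qed.

Lemma very_generic_imp P Q : (forall v, P v -> Q v) -> very_generic P -> very_generic Q.
Proof. by move=> PQ [N Nn h]; exists N => // v /h /PQ. Qed.

Lemma generic_neq (i : 'I_n) (c : F) : generic (fun v => v i != c).
Proof.
have : generic (fun v : 'I_n -> F => v i - c != 0).
  apply: (generic_polyfun (v0 := fun=> c + 1)); first by solve_polyfun.
  by rewrite addrAC subrr add0r oner_neq0.
by apply: generic_imp => v; rewrite subr_eq0.
Qed.

Lemma generic_neq_lin (i j : 'I_n) (a b : F) : i != j -> a != 0 ->
  generic (fun v => a * v i != b * v j).
Proof.
move=> ij an; have : generic (fun v : 'I_n -> F => a * v i - b * v j != 0).
  apply: (generic_polyfun (v0 := fun k => (k == i)%:R)); first by solve_polyfun.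
  by rewrite eqxx [j == i]eq_sym (negbTE ij) mulr1 mulr0 subr0.
by apply: generic_imp => v; rewrite subr_eq0.
Qed.

Lemma generic_neq_bilin (i j : 'I_n) (a b : F) : b != 0 ->
  generic (fun v => a * (v i * v j) != b).
Proof.
move=> bn; have : generic (fun v : 'I_n -> F => a * (v i * v j) - b != 0).
  apply: (generic_polyfun (v0 := fun k => 0)); first by solve_polyfun.
  by rewrite !mulr0 sub0r oppr_eq0.
by apply: generic_imp => v; rewrite subr_eq0.
Qed.

End VeryGeneric.

Section GoodValues.
Variable F : closedFieldType.
Variables u q : F.
Hypothesis un : u != 0.
Hypothesis qn : q != 0.
Hypothesis u2n : u != - u.
Hypothesis q_free : forall n, q ^+ n.+1 != 1.

(** Singular points are the z_i and their reflections. Ratios of two points of the same kind are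
    covered by the first condition, mixed ratios by products z_i z_j compared with u^2. *)
Lemma nonresonant_zs l : admissible u q l ->
  (forall i j n, (i < 6)%N -> (j < 6)%N -> i != j ->
     q ^+ n.+1 * (zs l)`_i != (zs l)`_j) ->
  (forall i j n, (i < 6)%N -> (j < 6)%N ->
     q ^+ n.+1 * ((zs l)`_i * (zs l)`_j) != u ^+ 2 /\
     (zs l)`_i * (zs l)`_j != q ^+ n.+1 * u ^+ 2) ->
  (forall n, q ^+ n.+1 * minus_rho1 l != minus_rho2 q l /\
             q ^+ n.+1 * minus_rho2 q l != minus_rho1 l) ->
  nonresonant u q l.
Proof.
move=> hl h1 h2 h3; split=> // s s' n.
have z0 i : (i < 6)%N -> (zs l)`_i != 0 by move=> hi; apply: (allP (adm_z hl)); apply: mem_nth.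
have h0 i j m : (i < 6)%N -> (j < 6)%N -> q ^+ m.+1 * (zs l)`_i != (zs l)`_j.
  move=> hi hj; have [<-|ij] := eqVneq i j; last exact: h1.
  by rewrite -[X in _ != X]mul1r (inj_eq (mulIf (z0 _ hi))).
have mem w : w \in singular_points u l -> exists2 i, (i < 6)%N &
    w = (zs l)`_i \/ w = u ^+ 2 / (zs l)`_i.
  rewrite mem_cat => /orP[/(nthP 0)[i hi <-]|/mapP[z /(nthP 0)[i hi <-] ->]].
    by exists i => //; left.
  by exists i => //; right.
move=> /mem[i hi sE] /mem[j hj sE']; have zi := z0 _ hi; have zj := z0 _ hj.
have u2 : u ^+ 2 != 0 by rewrite expf_neq0.
have [b1 b2] := h2 i j n hi hj.
case: sE sE' => -> [] ->; first exact: h0.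
- by rewrite -(inj_eq (mulIf zj)) divfK // -mulrA.
- by rewrite -(inj_eq (mulIf zi)) -(mulrA (q ^+ n.+1)) divfK // eq_sym [_ * (zs l)`_i]mulrC.
- rewrite mulrA eqr_div // (mulrAC (q ^+ n.+1)) (mulrC (u ^+ 2)) (inj_eq (mulIf u2)).
  exact: h0.
Qed.

(** The factor by which the evolution multiplies the i-th entry of [zs]; z2 and z4 have the indices
    1 and 3. *)
Definition scale (i : nat) : F := if (i == 1%N) || (i == 3%N) then q else 1.

(** The ratio rho1/rho2 is q times [monomial_E] over [monomial_D], and the evolution leaves it
    unchanged. *)
Definition monomial_D (v : 'I_7 -> F) := v (inord 0) * v (inord 2) * v (inord 4).
Definition monomial_E (v : 'I_7 -> F) := v (inord 1) * v (inord 3) * v (inord 5) * v (inord 6) ^+ 2.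

(** The conditions that involve q^m, cleared of denominators. Levels m > 0 give nonresonance, level
    0 admissibility; the index k treats z_i and q z_i together. *)
Definition good_level (m : nat) (v : 'I_7 -> F) : Prop :=
  [/\ forall i : 'I_7, v i != 0 /\ forall k : 'I_2, v i != u / q ^+ k /\ v i != - u / q ^+ k,
      forall i j : 'I_6, i != j ->
        q ^+ m * scale i * v (inord i) != scale j * v (inord j),
      forall i j : 'I_6,
        q ^+ m * (scale i * scale j) * (v (inord i) * v (inord j)) != u ^+ 2 /\
        scale i * scale j * (v (inord i) * v (inord j)) != q ^+ m * u ^+ 2
    & q ^+ m * q * monomial_E v != monomial_D v /\ q ^+ m * monomial_D v != q * monomial_E v].

Lemma scale_neq0 i : scale i != 0.
Proof. by rewrite /scale; case: ifP => _ //; apply: oner_neq0. Qed.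

Lemma generic_neq_ED (a b : F) : a != 0 -> generic (fun v => a * monomial_E v != b * monomial_D v).
Proof.
move=> an.
have : generic (fun v => a * monomial_E v - b * monomial_D v != 0).
  (* At this point [monomial_D] vanishes and [monomial_E] is 1. *)
  apply: (generic_polyfun (v0 := fun k => (k != inord 0)%:R)).
    by rewrite /monomial_E /monomial_D; solve_polyfun.
  rewrite /monomial_E /monomial_D eqxx !mul0r mulr0 subr0.
  by do 4 (rewrite (_ : inord _ == inord 0 = false); last by
     [apply/negbTE/eqP => /(congr1 val); rewrite /= !inordK]); rewrite expr1n !mulr1.
by apply: generic_imp => v; rewrite subr_eq0.
Qed.

Lemma generic_good_level m : generic (good_level m).
Proof.
have qm : q ^+ m != 0 by rewrite expf_neq0.
have h1 : generic (fun v : 'I_7 -> F => forall i : 'I_7, v i != 0 /\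
    forall k : 'I_2, v i != u / q ^+ k /\ v i != - u / q ^+ k).
  apply: generic_all => i; apply: generic_and; first exact: generic_neq.
  by apply: generic_all => k; apply: generic_and; apply: generic_neq.
have h2 : generic (fun v : 'I_7 -> F => forall i j : 'I_6, i != j ->
        q ^+ m * scale i * v (inord i) != scale j * v (inord j)).
  apply: generic_all => i; apply: generic_all => j.
  have [->|ij] := eqVneq i j; first by exists 1 => //; apply: oner_neq0.
  have ij' : (inord i : 'I_7) != inord j.
    apply: contraNneq ij => /(congr1 val); rewrite /= !inordK ?(leq_trans (ltn_ord _)) //.
    by move=> E; apply/eqP/val_inj.
  have := generic_neq_lin (scale j) ij' (mulf_neq0 qm (scale_neq0 i)).
  exact: generic_imp.
have h3 : generic (fun v : 'I_7 -> F => forall i j : 'I_6,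
        q ^+ m * (scale i * scale j) * (v (inord i) * v (inord j)) != u ^+ 2 /\
        scale i * scale j * (v (inord i) * v (inord j)) != q ^+ m * u ^+ 2).
  apply: generic_all => i; apply: generic_all => j.
  by apply: generic_and; apply: generic_neq_bilin; rewrite ?mulf_neq0 ?expf_neq0.
have h4 : generic (fun v => q ^+ m * q * monomial_E v != 1 * monomial_D v /\
    q * monomial_E v != q ^+ m * monomial_D v).
  by apply: generic_and; apply: generic_neq_ED; rewrite ?mulf_neq0.
apply: generic_imp (generic_and (generic_and h1 h2) (generic_and h3 h4)).
by move=> v [[? ?] [? [a b]]]; split=> //; rewrite mul1r in a; split=> //; rewrite eq_sym.
Qed.

Lemma zs_evolve (v : 'I_7 -> F) i : (i < 6)%N ->
  (zs (evolve q (param_of v)))`_i = scale i * v (inord i).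
Proof. by case: i => [|[|[|[|[|[|i]]]]]] //= _; rewrite /scale /= ?mul1r. Qed.

Lemma all_zs (P : pred F) (v : 'I_7 -> F) : (forall i, P (v i)) -> all P (zs (param_of v)).
Proof. by move=> h; rewrite /zs /= !h. Qed.

Lemma eq_ratio (a b d e D : F) : e != 0 -> d != 0 ->
  (a * d == b * (D / (e * d))) = (a * (e * d ^+ 2) == b * D).
Proof.
move=> en dn; rewrite -(inj_eq (mulIf (mulf_neq0 en dn))) -!mulrA mulVf ?mulf_neq0 // mulr1.
by congr (_ * _ == _); ring.
Qed.

Section Good.
Variable v : 'I_7 -> F.
Hypothesis hv : forall m, good_level m v.
Let l := param_of v.

Let vn i : v i != 0. Proof. by have [/(_ i)[]] := hv 0. Qed.

Lemma good_admissible : admissible u q l.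
Proof.
have hu i : (v i != u) && (v i != - u).
  by have [/(_ i)[_ /(_ ord0)]] := hv 0; rewrite !divr1 => -[-> ->].
split; [exact: all_zs|exact: all_zs|exact: vn|].
have [_ _ _ [h _]] := hv 0; move: h; rewrite expr0 mul1r.
rewrite /minus_rho1 /minus_rho2 /monomial_E /monomial_D /=.
rewrite -[X in X != _ / _]mul1r -[X in _ != X / _]mul1r -[1 * _ / _]mulrA eq_ratio ?mulf_neq0 //.
by rewrite !mul1r; congr (_ != _); ring.
Qed.

Let l' := evolve q l.

Lemma good_rho a b : (a * minus_rho1 l' == b * minus_rho2 q l') =
  (a * (q * monomial_E v) == b * monomial_D v).
Proof.
rewrite /minus_rho1 /minus_rho2 /monomial_E /monomial_D /=.
rewrite eq_ratio ?mulf_neq0 ?invr_eq0 //; congr (_ == _).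
by field.
Qed.

Lemma good_admissible_evolve : admissible u q l'.
Proof.
have hu (k : 'I_2) i : (q ^+ k * v i != u) && (q ^+ k * v i != - u).
  have qk : q ^+ k != 0 by rewrite expf_neq0.
  have [/(_ i)[_ /(_ k)[h1 h2]] _ _ _] := hv 0.
  rewrite mulrC -[X in _ * _ != X](divfK qk) (inj_eq (mulIf qk)) h1.
  by rewrite -[X in _ * _ != X](divfK qk) (inj_eq (mulIf qk)) h2.
split.
- by apply/(all_nthP 0) => i hi; rewrite zs_evolve // mulf_neq0 ?scale_neq0.
- apply/(all_nthP 0) => i hi; rewrite zs_evolve // /scale; case: ifP => _.
    exact: (hu ord_max).
  exact: (hu ord0).
- by rewrite /= mulf_neq0 ?invr_eq0.
rewrite -[minus_rho1 _]mul1r -[minus_rho2 _ _]mul1r good_rho.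
by have [_ _ _ [h _]] := hv 0; move: h; rewrite expr0 !mul1r.
Qed.

Lemma good_nonresonant : nonresonant u q l'.
Proof.
apply: (nonresonant_zs good_admissible_evolve).
- move=> i j n hi hj ij; rewrite !zs_evolve // mulrA.
  by have [_ h _ _] := hv n.+1; apply: (h (Ordinal hi) (Ordinal hj)).
- move=> i j n hi hj; rewrite !zs_evolve //.
  have [_ _ h _] := hv n.+1; have [a b] := h (Ordinal hi) (Ordinal hj).
  by rewrite mulrACA (mulrA (q ^+ _)).
move=> n; have [_ _ _ [a b]] := hv n.+1.
rewrite -[minus_rho2 _ _ in X in X /\ _]mul1r good_rho mul1r mulrA a eq_sym.
by rewrite -[minus_rho1 _]mul1r good_rho mul1r eq_sym b.
Qed.

Lemma good_products : [/\ u ^+ 2 - z2 l * z4 l != 0, par_e u q l != 1 & par_e u q l != q].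
Proof.
(* After evolution the product of z2 and z4 is q^2 z2 z4. Comparing it with u^2, q u^2 and q^2 u^2,
   at levels 0, 1 and 2, excludes e = q, e = 1 and z2 z4 = u^2. *)
have [_ _ h2 _] := hv 2; have [_ _ h1 _] := hv 1; have [_ _ h0 _] := hv 0.
have z2E : scale 1 * v (inord 1) = q * z2 l by [].
have z4E : scale 3 * v (inord 3) = q * z4 l by [].
have i1 : (1 < 6)%N by []. have i3 : (3 < 6)%N by [].
have [c0 _] := h0 (Ordinal i1) (Ordinal i3).
have [_ c1] := h1 (Ordinal i1) (Ordinal i3).
have [_ c2] := h2 (Ordinal i1) (Ordinal i3).
have zz : q * z2 l * z4 l != 0 by rewrite !mulf_neq0 ?vn.
have E : scale 1 * scale 3 * (v (inord 1) * v (inord 3)) = q * (q * z2 l * z4 l).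
  by rewrite mulrACA z2E z4E; ring.
move: c0 c1 c2; rewrite -[q ^+ 0 * _ * _]mulrA /= !E expr0 mul1r expr1 (inj_eq (mulfI qn)) => c0 c1 c2.
split.
- apply: contraNneq c2 => /eqP; rewrite subr_eq0 => /eqP ->; apply/eqP; rewrite /=; ring.
- by apply: contraNneq c1 => h; rewrite -[u ^+ 2](divfK zz) -/(par_e u q l) h mul1r.
by apply: contraNneq c0 => h; rewrite -[u ^+ 2](divfK zz) -/(par_e u q l) h.
Qed.

Theorem good_parameters : [/\ equivalent_dynamics u q l, inverse_coordinates u q l
  & matching_compatible u q l].
Proof.
have [z24 e1 eqn] := good_products; have u6 : z6 l != - u.
  by have [/(_ (inord 5))[_ /(_ ord0)]] := hv 0; rewrite !divr1 => -[].
split.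
- exact: (equivalent_dynamics_proof un qn u2n q_free good_admissible good_admissible_evolve good_nonresonant).
- exact: (@inverse_coordinates_proof F u q un l (vn _) (vn _) (vn _) u6 z24).
exact: (@matching_compatible_proof F u q un l (vn _) (vn _) (vn _) qn (vn _) (vn _) (vn _) (vn _)).
Qed.

End Good.
End GoodValues.

Theorem theorem3p2p1 (R : realType) (u q : R)
    (hu : 0 < u < 1) (hq : 0 < q < 1) :
  very_generic (fun v : 'I_7 -> R[i] =>
    [/\ equivalent_dynamics u%:C q%:C (param_of v),
        inverse_coordinates u%:C q%:C (param_of v)
      & matching_compatible u%:C q%:C (param_of v)]).
Proof.
have /andP[u0 _] := hu; have /andP[q0 q1] := hq.
have inj := fmorph_inj (real_complex R).
have un : u%:C != 0 by rewrite -(rmorph0 (real_complex R)) (inj_eq inj) gt_eqF.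
have qn : q%:C != 0 by rewrite -(rmorph0 (real_complex R)) (inj_eq inj) gt_eqF.
have u2n : u%:C != - u%:C.
  rewrite -(rmorphN (real_complex R)) (inj_eq inj) -subr_eq0 opprK gt_eqF //.
  exact: addr_gt0.
have q_free n : q%:C ^+ n.+1 != 1.
  rewrite -(rmorphXn (real_complex R)) -(rmorph1 (real_complex R)) (inj_eq inj).
  by rewrite lt_eqF // exprn_ilt1 // ltW.
have := very_generic_forall (generic_good_level un qn).
apply: very_generic_imp => v hv; exact: good_parameters hv.
Qed.
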